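(* Suppose that the load balancing policy is JLMU and consider the occupancy processes $\boldsymbol{q}_n$ constructed on a common probability space $(\Omega,\mathcal{F},\mathbb{P})$ as in the context. Then there exists a set $\Gamma\subset\Omega$ of probability one with the following property: if $\omega\in\Gamma$, then $\boldsymbol{q}_n(\omega)$ converges in $D_{\ell_1}[0,\infty)$, as $n\to\infty$, to the unique fluid trajectory with initial condition $q_0(\omega)$.
   Context: Ranking. Let $\mathbb{N}=\{0,1,2,\dots\}$ and $m\geq 1$. For $i=1,\dots,m$ let $u_i:[0,\infty)\to\mathbb{R}$ be a concave function (only its values on $\mathbb{N}$ matter) and $\Delta(i,j)=u_i(j+1)-u_i(j)$ for $j\in\mathbb{N}$. Let $\mathcal{I}=\{1,\dots,m\}\times\mathbb{N}$ and $\mathcal{I}_+=\{(i,j)\in\mathcal{I}:j\geq 1\}$. Define a total order $\vartriangleleft$ on $\mathcal{I}_+$ by: $(i,j)\vartriangleleft(i',j')$ iff either $\Delta(i,j-1)<\Delta(i',j'-1)$, or $\Delta(i,j-1)=\Delta(i',j'-1)$ and $(i,j)$ is strictly larger than $(i',j')$ in the lexicographic order. Write $\vartriangleright$ for the reverse order. Every nonempty subset of $\mathcal{I}_+$ has a largest element for $\vartriangleleft$. For a sequence $q\in\mathbb{R}^{\mathcal I}$ that is non-increasing in $j$, vanishes as $j\to\infty$ and has $q(i,0)>0$, let $\sigma(q)=\max\{(i,j)\in\mathcal{I}_+:q(i,j-1)>q(i,j)\}$ with respect to $\vartriangleleft$. Spaces. $\ell_1$ is the space of absolutely summable elements of $\mathbb{R}^{\mathcal{I}}$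 with norm $\|\cdot\|_1$. $D_{\ell_1}[0,\infty)$ is the space of càdlàg functions from $[0,\infty)$ to $\ell_1$ with the topology of uniform convergence over compact sets. Systems and coupling. $\lambda,\mu>0$. For $n\ge m$, $A_n(i)\geq1$ are integers with $\sum_{i}A_n(i)=n$, $\alpha_n(i)=A_n(i)/n$, and $\alpha_n(i)\to\alpha(i)\in(0,1)$ for all $i$. $Q_n$ is the set of $q\in\ell_1$ with $nq(i,j)\in\mathbb{N}$ and $q(i,j+1)\leq q(i,j)\leq q(i,0)=\alpha_n(i)$ for all $(i,j)$; $Q=\{q\in[0,1]^{\mathcal{I}}\cap\ell_1: q(i,j+1)\leq q(i,j)\leq q(i,0)=\alpha(i)\text{ for all }(i,j)\}$. On a complete probability space $(\Omega,\mathcal{F},\mathbb{P})$ there are independent unit-rate Poisson processes $\mathcal{N}$ and $\mathcal{N}_{(i,j)}$, $(i,j)\in\mathcal{I}_+$, and, independent of them, initial conditions $\boldsymbol{q}_n(0)$ with values in $Q_n$ and a random variable $q_0$ with values in $Q$ such that $\|\boldsymbol{q}_n(0)-q_0\|_1\to0$ with probability one. Let $\mathcal{N}_n^\lambda(t)=\mathcal{N}(n\lambda t)$ with jump times $\tau_{n,1}<\tau_{n,2}<\cdots$. With probability one, for every $n$, $\boldsymbol{q}_n$ is the unique càdlàg $Q_n$-valued solution of $\boldsymbol{q}_n(t)=\boldsymbol{q}_n(0)+\mathcal{A}_n(t)-\mathcal{D}_n(t)$, where $\mathcal{A}_n(t,i,0)=\mathcal{D}_n(t,i,0)=0$ and,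 for $(i,j)\in\mathcal{I}_+$, $\mathcal{A}_n(t,i,j)=\frac1n\sum_{k=1}^{\mathcal{N}_n^\lambda(t)}\mathbf{1}\{(i,j)=\sigma(\boldsymbol{q}_n(\tau_{n,k}^-))\}$ and $\mathcal{D}_n(t,i,j)=\frac1n\mathcal{N}_{(i,j)}\left(n\int_0^t\mu j[\boldsymbol{q}_n(s,i,j)-\boldsymbol{q}_n(s,i,j+1)]ds\right)$. Fluid trajectories. Define $\Lambda:Q\times\mathcal{I}_+\to\mathbb{R}$ by $\Lambda(q,i,j)=0$ if $(i,j)\vartriangleleft\sigma(q)$; $\Lambda(q,i,j)=\mu j[\alpha(i)-q(i,j+1)]$ if $(i,j)\vartriangleright\sigma(q)$; and $\Lambda(q,i,j)=\lambda-\sum_{(k,l)\vartriangleright\sigma(q)}\mu l[\alpha(k)-q(k,l+1)]$ if $(i,j)=\sigma(q)$. A function $\boldsymbol{q}:[0,\infty)\to Q$ is a fluid trajectory if all coordinate functions are absolutely continuous (on bounded intervals) and, for almost every $t$, $\dot{\boldsymbol{q}}(i,j)=\Lambda(\boldsymbol{q},i,j)-\mu j[\boldsymbol{q}(i,j)-\boldsymbol{q}(i,j+1)]$ and $\Lambda(\boldsymbol{q},i,j)\geq 0$ for all $(i,j)\in\mathcal{I}_+$. For each $q\in Q$ there is at most one fluid trajectory starting at $q$; the claim includes existence of the fluid trajectory starting at $q_0(\omega)$. *)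

(* Defs.v *)
From mathcomp Require Export all_boot all_order all_algebra.
From mathcomp Require Export all_classical all_reals all_analysis.
Export Order.TTheory GRing.Theory Num.Theory.
Export numFieldNormedType.Exports.
Set Implicit Arguments.
Unset Strict Implicit.
Unset Printing Implicit Defensive.
Local Open Scope classical_set_scope.
Local Open Scope ring_scope.

(* There are [m.+1 >= 1] classes, numbered from 0. *)
Notation idx m := ('I_m.+1 * nat)%type.

Definition Iplus m : set (idx m) := [set x | (0 < x.2)%N].

Section Ranking.
Context {R : realType} {m : nat}.
Implicit Types (u : 'I_m.+1 -> R -> R) (q : idx m -> R) (x y : idx m).

Definition concave_on (D : set R) (f : R -> R) : Prop :=
  @convex_function R R^o D (fun z : R => - f z).

Definition Delta u (i : 'I_m.+1) (j : nat) : R := u i j.+1%:R - u i j%:R.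

Definition lex_lt x y : bool :=
  (x.1 < y.1)%N || ((x.1 == y.1) && (x.2 < y.2)%N).

(* The total order on [Iplus]; meaningful only there, as [0.-1 = 0]. *)
Definition rank_lt u x y : bool :=
  (Delta u x.1 x.2.-1 < Delta u y.1 y.2.-1) ||
  ((Delta u x.1 x.2.-1 == Delta u y.1 y.2.-1) && lex_lt y x).

Definition drop_set q : set (idx m) :=
  [set x | Iplus x /\ q (x.1, x.2.-1) > q x].

(* The default [(ord0, 1)] is returned only if [drop_set q] has no largest
   element, which does not happen when [q] is non-increasing in [j], vanishes
   at infinity and satisfies [0 < q (i, 0)]. *)
Definition sigma u q : idx m :=
  xget (ord0, 1%N)
    [set x | drop_set q x /\ forall y, drop_set q y -> y = x \/ rank_lt u y x].

End Ranking.

Section Ell1.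
Context {R : realType} {m : nat}.
Implicit Types (q : idx m -> R) (f g : R -> idx m -> R).
Local Open Scope ereal_scope.

Definition l1norm q : \bar R := \esum_(x in [set: idx m]) `|q x|%:E.

Definition ell1 q : Prop := summable [set: idx m] (EFin \o q).

(* Paths on [0, oo) are functions on [R] whose values at negative times are
   irrelevant. *)
Definition cadlag f : Prop :=
  [/\ forall t : R, (0 <= t)%R -> ell1 (f t),
      forall t : R, (0 <= t)%R -> l1norm (f s \- f t)%R @[s --> t^'+] --> 0 &
      forall t : R, (0 < t)%R ->
        exists2 l, ell1 l & l1norm (f s \- l)%R @[s --> t^'-] --> 0].

Definition cvg_D (f : nat -> R -> idx m -> R) g : Prop :=
  [/\ \forall n \near \oo, cadlag (f n),
      cadlag g &
      forall K : set R, compact K -> K `<=` [set t | (0 <= t)%R] ->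
        forall e : R, (0 < e)%R ->
          \forall n \near \oo, forall t, K t ->
            l1norm (f n t \- g t)%R < e%:E].

End Ell1.

Section Probability.
Context {R : realType} {d : measure_display} {Omega : measurableType d}.
Variable P : probability Omega R.

(* Mutual independence of the classes of events [F a], [a] in [D]: product
   rule over all finite subfamilies. *)
Definition independent (J : Type) (D : set J) (F : J -> set (set Omega)) :
    Prop :=
  forall (k : nat) (a : 'I_k -> J) (E : 'I_k -> set Omega),
    injective a -> (forall i, D (a i)) -> (forall i, F (a i) (E i)) ->
    P (\bigcap_(i in [set: 'I_k]) E i) = (\prod_(i < k) fine (P (E i)))%:E.

(* The events [X \in B]. *)
Definition events_of {d'} {T : measurableType d'} (X : Omega -> T) :
    set (set Omega) :=
  preimage_set_system setT X measurable.

Definition unit_poisson_process (N : Omega -> R -> nat) : Prop :=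
  [/\ forall t : R, 0 <= t -> measurable_fun setT (N^~ t),
      {ae P, forall w,
        [/\ N w 0 = 0%N,
            forall s t : R, 0 <= s -> s <= t -> (N w s <= N w t)%N &
            forall t : R, 0 <= t -> \forall s \near t^'+, N w s = N w t]},
      forall t : nat -> R, 0 <= t 0%N ->
        (forall i, t i <= t i.+1) ->
        independent setT
          (fun i => events_of (fun w => N w (t i.+1) - N w (t i))%N) &
      forall (s t : R) (k : nat), 0 <= s -> s < t ->
        P [set w | (N w t - N w s)%N = k] = (poisson_pmf (t - s) k)%:E].

End Probability.

Section Occupancy.
Context {R : realType} {m : nat}.
Implicit Types (u : 'I_m.+1 -> R -> R) (q : R -> idx m -> R) (x : idx m).

Definition Qn (n : nat) (A : 'I_m.+1 -> nat) : set (idx m -> R) :=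
  [set q | [/\ ell1 q,
               forall x, exists k : nat, n%:R * q x = k%:R,
               forall i j, q (i, j.+1) <= q (i, j) <= q (i, 0%N) &
               forall i, q (i, 0%N) = (A i)%:R / n%:R]].

Definition Qfluid (alpha : 'I_m.+1 -> R) : set (idx m -> R) :=
  [set q | [/\ ell1 q,
               forall x, 0 <= q x <= 1,
               forall i j, q (i, j.+1) <= q (i, j) <= q (i, 0%N) &
               forall i, q (i, 0%N) = alpha i]].

(* The [k]-th jump time (k >= 1) of a right-continuous path [c] started at 0
   whose jumps have size 1. *)
Definition jump_time (c : R -> nat) (k : nat) : R :=
  inf [set t | 0 <= t /\ (k <= c t)%N].

(* For a path that is cadlag in l1, this coordinatewise limit is the left
   limit in l1. *)
Definition left_limit q (t : R) : idx m -> R :=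
  fun x => lim (q s x @[s --> t^'-]).

Definition arrivals (lambda : R) u (n : nat) (N : R -> nat) q (t : R) x : R :=
  let Nn s := N (n%:R * lambda * s) in
  if x.2 == 0%N then 0 else
  n%:R^-1 *
    \sum_(1 <= k < (Nn t).+1) (x == sigma u (left_limit q (jump_time Nn k)))%:R.

Definition departures (mu : R) (n : nat) (Nd : idx m -> R -> nat) q (t : R) x :
    R :=
  if x.2 == 0%N then 0 else
  n%:R^-1 *
    (Nd x (n%:R * \int[lebesgue_measure]_(s in `[0, t])
                    (mu * x.2%:R * (q s x - q s (x.1, x.2.+1)))))%:R.

(* [q] is a cadlag [Qn]-valued solution of the evolution equations of the
   [n]-server system driven by the paths [N] and [Nd]. *)
Definition occupancy_solution (lambda mu : R) u (n : nat)
    (A : 'I_m.+1 -> nat) (N : R -> nat) (Nd : idx m -> R -> nat) q : Prop :=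
  [/\ cadlag q,
      forall t : R, 0 <= t -> Qn n A (q t) &
      forall (t : R) x, 0 <= t ->
        q t x = q 0 x + arrivals lambda u n N q t x - departures mu n Nd q t x].

End Occupancy.

Section Fluid.
Context {R : realType} {m : nat}.
Variables (lambda mu : R) (u : 'I_m.+1 -> R -> R) (alpha : 'I_m.+1 -> R).
Implicit Types (x y : idx m).

(* The sum is over a finite set when [q] is in [Qfluid alpha]. *)
Definition Lambda (q : idx m -> R) x : R :=
  let s := sigma u q in
  let rate y := mu * y.2%:R * (alpha y.1 - q (y.1, y.2.+1)) in
  if x == s then lambda - \sum_(y \in [set y | Iplus y /\ rank_lt u s y]) rate y
  else if rank_lt u x s then 0
  else rate x.

Definition abs_continuous (a b : R) (f : R -> R) : Prop :=
  forall e : R, 0 < e -> exists2 delta : R, 0 < delta &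
    forall (k : nat) (I : 'I_k -> R * R),
      (forall i, [/\ a <= (I i).1, (I i).1 <= (I i).2 & (I i).2 <= b]) ->
      trivIset setT (fun i => `](I i).1, (I i).2[%classic) ->
      \sum_(i < k) ((I i).2 - (I i).1) < delta ->
      \sum_(i < k) `|f (I i).2 - f (I i).1| < e.

Definition fluid_trajectory (q : R -> idx m -> R) : Prop :=
  [/\ forall t : R, 0 <= t -> Qfluid alpha (q t),
      forall x (T : R), 0 <= T -> abs_continuous 0 T (q^~ x) &
      {ae lebesgue_measure, forall t : R, 0 <= t -> forall x, Iplus x ->
        is_derive t (1 : R) (q^~ x)
          (Lambda (q t) x - mu * x.2%:R * (q t x - q t (x.1, x.2.+1))) /\
        0 <= Lambda (q t) x}].

End Fluid.

(* The independent sources of randomness. *)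
Variant source (m : nat) :=
  Initial | ArrivalClock | DepartureClock of idx m.
Arguments Initial {m}.
Arguments ArrivalClock {m}.

Section Sources.
Context {R : realType} {m : nat} {d : measure_display}
        {Omega : measurableType d}.

Definition sources : set (source m) :=
  [set a | if a is DepartureClock x then Iplus x else True].

Definition sigma_process (N : Omega -> R -> nat) : set (set Omega) :=
  <<s \bigcup_(t in [set t : R | 0 <= t]) events_of (N^~ t) >>.

(* The sigma-algebra generated jointly by [q0] and the initial states
   [q n _ 0], [n >= m.+1]. As l1 is separable, its Borel sigma-algebra is
   generated by the coordinates. *)
Definition sigma_initial (q : nat -> Omega -> R -> idx m -> R)
    (q0 : Omega -> idx m -> R) : set (set Omega) :=
  <<s \bigcup_(x in [set: idx m])
        (events_of (q0^~ x) `|`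
         \bigcup_(n in [set n | (m.+1 <= n)%N])
            events_of (fun w => q n w 0 x)) >>.

Definition sigma_source (N : Omega -> R -> nat)
    (Nd : idx m -> Omega -> R -> nat) (q : nat -> Omega -> R -> idx m -> R)
    (q0 : Omega -> idx m -> R) (a : source m) : set (set Omega) :=
  match a with
  | Initial => sigma_initial q q0
  | ArrivalClock => sigma_process N
  | DepartureClock x => sigma_process (Nd x)
  end.

End Sources.

(* Main.v *)
(* The argument is pathwise. Enumerate the positions in decreasing rank as
   x_0, x_1, ... ; on a bounded time interval only finitely many of them receive
   arrivals, because the initial occupancy plus the arriving mass is smaller than
   the total capacity of the first K positions for K large. Let v_k be the
   occupied mass of x_0, ..., x_k. An arrival is sent beyond x_k only while v_k is
   at its capacity, so v_k is the reflection at its capacity of a free path, with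
   the overflow beyond x_k as regulator.

   By the law of large numbers for the clocks, both the prelimit systems and the
   fluid trajectories satisfy this reflected system of equations up to a small
   error eta, and two such systems with close initial states stay close, by a
   Gronwall argument: while v_k is larger for one system than for the other, the
   other system is below its capacity and does not overflow beyond x_k, so the gap
   grows only through the difference of the departure rates. Hence q_n is uniformly
   Cauchy. Its limit solves the exact reflected equations; v_k is then
   differentiable almost everywhere, with zero derivative where the capacity is
   reached, which yields the rates Lambda.
   Uniqueness follows by comparing an arbitrary fluid trajectory with q_n. *)
Require Import Defs.
From mathcomp Require Import measurable_realfun.
From mathcomp Require Import ring lra zify.
Set Implicit Arguments.
Unset Strict Implicit.
Unset Printing Implicit Defensive.
Local Open Scope classical_set_scope.
Local Open Scope ring_scope.

(** * Calculus of absolutely continuous functions *)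

(** The comparison bears on the partial masses because only they see the policy as a one-sided
    reflection; a coordinate is recovered as a difference of two of them. Infinitely many departure
    clocks obey no common law of large numbers, so the equations are usable only up to a level [L],
    chosen after [K] and [T] but before [eta]. Outside the first [K] positions there are only
    departures, and the error made above [L] is passed down by a maximum principle, which costs a
    multiple of [eta] per level and no exponential factor in the unbounded rates [mu * j].

    The enumeration may fail to exhaust the positions, since their order type can exceed that of
    [nat]. This is harmless: [K] listed positions have capacity at least [K] times the smallest
    [alpha i], eventually more than any bounded mass.

    The fluid trajectory is obtained from the Cauchy estimate, without compactness. The delicate
    point is that v_k could a priori sit at its capacity on a set of times of positive measure that
    contains no interval; v_k is therefore shown to differ from its capacity by a primitive of a
    bounded measurable function. *)

Section cumulative_integral.
Context {R : realType}.
Implicit Types (f g : R -> R) (r s t T : R).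
Notation leb := (@lebesgue_measure R).

Definition cumul f t : R := \int[leb]_(s in `[0, t]) f s.

(** The standing class of integrands: [cumul f t] is a genuine integral for every [t <= T], and the
    class is stable under the linear operations of the balance equations. *)
Definition bounded_measurable T f : Prop :=
  measurable_fun `[0, T] f /\
  exists B, forall t, 0 <= t <= T -> `|f t| <= B.

Lemma bounded_measurable_integrable T f t : bounded_measurable T f -> t <= T ->
  leb.-integrable `[0, t] (EFin \o f).
Proof.
move=> [mf [B fB]] tT.
have sub : `[0, t] `<=` `[0, T].
  by apply: subset_itvl; rewrite bnd_simp.
apply: measurable_bounded_integrable => //.
- rewrite [X in (X < _)%E](lebesgue_measure_itv `[0, t])/=.
  by case: ifPn => // _; rewrite ltry.
- exact: measurable_funS mf.
- exists B; split; first exact: num_real.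
  move=> x Bx y /sub; rewrite /= in_itv/= => y0T.
  by apply: le_trans (ltW Bx); exact: fB.
Qed.

Lemma bounded_measurable_cst T c : bounded_measurable T (fun=> c).
Proof. by split => //; exists `|c|. Qed.

Lemma bounded_measurableD T f g : bounded_measurable T f ->
  bounded_measurable T g -> bounded_measurable T (fun s => f s + g s).
Proof.
move=> [mf [B fB]] [mg [C gC]]; split; first exact: measurable_funD.
exists (B + C) => t t0T; apply: le_trans (ler_normD _ _) _.
by apply: lerD; [exact: fB|exact: gC].
Qed.

Lemma bounded_measurableZ T f c : bounded_measurable T f ->
  bounded_measurable T (fun s => c * f s).
Proof.
move=> [mf [B fB]]; split.
  by apply: measurable_funM => //; exact: measurable_cst.
exists (`|c| * B) => t t0T; rewrite normrM ler_wpM2l//; exact: fB.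
Qed.

Lemma bounded_measurableB T f g : bounded_measurable T f ->
  bounded_measurable T g -> bounded_measurable T (fun s => f s - g s).
Proof.
move=> bf bg; have := bounded_measurableD bf (bounded_measurableZ (-1) bg).
by congr bounded_measurable; apply/funext => s; rewrite mulN1r.
Qed.

Lemma continuous_bounded_measurable T f :
  {within `[0, T], continuous f} -> bounded_measurable T f.
Proof.
move=> cf; split.
  by apply: subspace_continuous_measurable_fun => //.
have /compact_bounded[M [_ bM]] : compact (f @` `[0, T]).
  by apply: continuous_compact => //; exact: segment_compact.
exists (M + 1) => t t0T; apply: bM; first by rewrite ltrDl.
by exists t => //=; rewrite in_itv.
Qed.

Lemma cumul0 f : cumul f 0 = 0.
Proof. by rewrite /cumul set_itv1 Rintegral_set1. Qed.

Lemma cumul_cst c t : 0 <= t -> cumul (fun=> c) t = c * t.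
Proof.
move=> t0; rewrite /cumul Rintegral_cst//; congr (_ * _).
rewrite [X in fine X](lebesgue_measure_itv `[0, t])/=; case: ifPn; rewrite lte_fin /=.
  by rewrite oppr0 addr0.
by rewrite -leNgt => t0'; apply/eqP; rewrite eq_le t0'/= t0.
Qed.

Lemma cumulD T f g t : bounded_measurable T f -> bounded_measurable T g ->
  t <= T -> cumul (fun s => f s + g s) t = cumul f t + cumul g t.
Proof.
by move=> bf bg tT; rewrite /cumul RintegralD//;
  exact: bounded_measurable_integrable tT.
Qed.

Lemma cumulZ T f c t : bounded_measurable T f ->
  t <= T -> cumul (fun s => c * f s) t = c * cumul f t.
Proof.
by move=> bf tT; rewrite /cumul RintegralZl//;
  exact: bounded_measurable_integrable tT.
Qed.

Lemma cumulB T f g t : bounded_measurable T f -> bounded_measurable T g ->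
  t <= T -> cumul (fun s => f s - g s) t = cumul f t - cumul g t.
Proof.
by move=> bf bg tT; rewrite /cumul RintegralB//;
  exact: bounded_measurable_integrable tT.
Qed.

Lemma eq_cumul f g t : (forall s, 0 <= s <= t -> f s = g s) ->
  cumul f t = cumul g t.
Proof.
move=> fg; apply: eq_Rintegral => s.
by rewrite inE/= in_itv/=; exact: fg.
Qed.

Lemma cumul_le T f g s t : bounded_measurable T f -> bounded_measurable T g ->
  0 <= s -> s <= t -> t <= T -> (forall r, s < r <= t -> f r <= g r) ->
  cumul f t - cumul f s <= cumul g t - cumul g s.
Proof.
move=> bf bg s0 st tT fg.
have If := bounded_measurable_integrable bf tT.
have Ig := bounded_measurable_integrable bg tT.
rewrite /cumul !Rintegral_itvB ?bnd_simp//.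
have sub : `]s, t] `<=` `[0, t].
  by apply: subset_itvr; rewrite bnd_simp.
apply: le_Rintegral => //.
- by apply: integrableS If.
- by apply: integrableS Ig.
Qed.

Lemma cumul_le_cst T f C s t : bounded_measurable T f ->
  0 <= s -> s <= t -> t <= T -> (forall r, s < r <= t -> f r <= C) ->
  cumul f t - cumul f s <= C * (t - s).
Proof.
move=> bf s0 st tT fC; have t0 := le_trans s0 st.
have := cumul_le bf (bounded_measurable_cst T C) s0 st tT fC.
by rewrite !cumul_cst// -mulrBr.
Qed.

Lemma cumul_ge_cst T f C s t : bounded_measurable T f ->
  0 <= s -> s <= t -> t <= T -> (forall r, s < r <= t -> C <= f r) ->
  C * (t - s) <= cumul f t - cumul f s.
Proof.
move=> bf s0 st tT fC; have t0 := le_trans s0 st.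
have := cumul_le (bounded_measurable_cst T C) bf s0 st tT fC.
by rewrite !cumul_cst// -mulrBr.
Qed.

Lemma cumul_norm_le T f g s t : bounded_measurable T f ->
  bounded_measurable T g ->
  0 <= s -> s <= t -> t <= T -> (forall r, s < r <= t -> `|f r| <= g r) ->
  `|cumul f t - cumul f s| <= cumul g t - cumul g s.
Proof.
move=> bf bg s0 st tT fg; rewrite ler_norml; apply/andP; split; last first.
  by apply: cumul_le tT _ => // r /fg /ler_normlP[].
have bN := bounded_measurableZ (-1) bf.
have := cumul_le bN bg s0 st tT.
rewrite (cumulZ _ bf tT) (cumulZ _ bf (le_trans st tT)) => H.
have : -1 * cumul f t - -1 * cumul f s <= cumul g t - cumul g s.
  by apply: H => r /fg /ler_normlP[]; rewrite mulN1r.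
lra.
Qed.

Lemma cumul_exp (k : R) t : 0 < k -> 0 <= t ->
  cumul (fun s => expR (k * s)) t = k^-1 * (expR (k * t) - 1).
Proof.
move=> k0; rewrite le_eqVlt => /predU1P[<-|t0].
  by rewrite cumul0 mulr0 expR0 subrr mulr0.
pose F s := k^-1 * expR (k * s).
have dF x : is_derive x (1:R) F (expR (k * x)).
  rewrite /F; apply: is_derive_eq.
  rewrite /GRing.scale/= mulr1 (mulrC (expR _)) mulrA mulVf ?mul1r//.
  by rewrite gt_eqF.
rewrite /cumul /Rintegral (@continuous_FTC2 _ _ F)//=.
- by rewrite /F mulr0 expR0 mulrBr.
- apply: continuous_subspaceT => x.
  have: derivable (fun s => expR (k * s)) x 1 by [].
  by move=> /derivable1_diffP/differentiable_continuous.
- have dc x : {for x, continuous F}.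
    by apply/differentiable_continuous/derivable1_diffP; exact: ex_derive.
  split.
  + by move=> x _; exact: ex_derive.
  + by apply: cvg_at_right_filter; exact: dc.
  + by apply: cvg_at_left_filter; exact: dc.
- by move=> x _; rewrite derive1E; exact: derive_val.
Qed.

End cumulative_integral.

(** * Last times and induction along an interval *)

Section real_induction.
Context {R : realType}.
Implicit Types (a b s t : R) (P : R -> Prop).

(** [s] is the supremum of the times at which [P] holds. Prelimit paths jump, so [P] need not be
    closed and may fail at [s]; hence the times [r <= s] at which [P] does hold, arbitrarily close
    to [s]. *)
Lemma last_time P t : 0 <= t -> P 0 ->
  exists s, [/\ 0 <= s <= t, forall z, s < z <= t -> ~ P z &
    forall e, 0 < e -> exists r, [/\ 0 <= r, r <= s, s - e < r & P r]].
Proof.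
move=> t0 P0; pose S := [set r | 0 <= r <= t /\ P r].
have S0 : S 0 by split => //; rewrite lexx.
have hS : has_sup S.
  split; first by exists 0.
  by exists t => r [/andP[]].
exists (sup S); split.
- apply/andP; split; first by apply: ub_le_sup => //; case: hS.
  by apply: ge_sup; [exists 0|move=> r [/andP[]]].
- move=> z /andP[sz zt] Pz; move: (sz); apply/negP; rewrite -leNgt.
  apply: ub_le_sup; first by case: hS.
  split => //; rewrite zt andbT; apply: le_trans (ltW sz).
  by apply: ub_le_sup => //; case: hS.
- move=> e e0; have [r [/andP[r0 rt] Pr] er] := sup_adherent e0 hS.
  exists r; split => //; apply: ub_le_sup; first by case: hS.
  by split => //; rewrite r0.
Qed.

(** The step carries [P] across [s], from any time just before to any time just after. Applied at
    the supremum of the times where [P] holds, it needs no closedness of [P], and it overshoots the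
    supremum unless [b] has been reached. *)
Lemma real_induction P a b : a <= b -> P a ->
  (forall s, a <= s <= b -> exists2 h, 0 < h &
    forall t t', a <= t -> s - h < t <= s -> s <= t' < s + h -> t' <= b ->
      P t -> P t') ->
  P b.
Proof.
move=> ab Pa step.
pose S := [set r | a <= r <= b /\ P r].
have Sa : S a by split => //; rewrite lexx.
have hS : has_sup S.
  split; first by exists a.
  by exists b => r [/andP[]].
have aS : a <= sup S by apply: ub_le_sup => //; case: hS.
have Sb : sup S <= b by apply: ge_sup; [exists a|move=> r [/andP[]]].
have [|h h0 Ph] := step (sup S); first by rewrite aS.
have [r [/andP[ar rb] Pr] er] := sup_adherent h0 hS.
have rS : r <= sup S.
  by apply: ub_le_sup; [case: hS|split => //; rewrite ar].
have [bh|bh] := ltP b (sup S + h).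
  by apply: (Ph r b) => //; rewrite ?er ?Sb.
have h2 : 0 < h / 2 by rewrite divr_gt0.
have hh : h / 2 < h by rewrite ltr_pdivrMr// mulr2n mulrDr mulr1 ltrDl.
have : P (sup S + h / 2).
  apply: (Ph r) => //; rewrite ?er//.
  - by rewrite lerDl ltW//= ltrD2l.
  - by apply: le_trans bh; rewrite lerD2l ltW.
move=> PS; exfalso.
have : sup S + h / 2 <= sup S.
  apply: ub_le_sup; first by case: hS.
  split => //; rewrite (le_trans aS) ?lerDl ?(ltW h2)//=.
  by apply: le_trans bh; rewrite lerD2l ltW.
by rewrite gerDl leNgt h2.
Qed.

End real_induction.

(** * Derivatives at a point *)

Section derivative.
Context {R : realType}.
Implicit Types (f g : R -> R) (t d : R).

(** First-order expansion with the increment multiplied out, so that [y = t] need not be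
    excluded. *)
Lemma is_derive_nearP f t d : is_derive t (1 : R) f d <->
  forall e, 0 < e -> exists2 h, 0 < h &
    forall y, `|y - t| < h -> `|f y - f t - d * (y - t)| <= e * `|y - t|.
Proof.
split.
- move=> [/cvg_ex[l fl] fd] e e0.
  have ld : l = d by rewrite -fd; apply/esym/cvg_lim.
  rewrite {l}ld in fl.
  have /cvgrPdist_le/(_ _ e0)/nbhs_ballP[h /= h0 H] := fl.
  exists h => // y yt.
  have [->|yn] := eqVneq y t; first by rewrite !subrr mulr0 subrr normr0 mulr0.
  have yt0 : y - t != 0 by rewrite subr_eq0.
  have := H (y - t); rewrite /ball/= sub0r normrN => /(_ yt yt0).
  rewrite /GRing.scale/= mulr1 subrK => K.
  have -> : f y - f t - d * (y - t) =
    - ((d - (y - t)^-1 * (f y - f t)) * (y - t)).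
    by rewrite mulrBl mulrAC mulVf// mul1r opprB.
  by rewrite normrN normrM ler_wpM2r.
- move=> H; suff fl : h^-1 *: ((f \o shift t) (h *: (1:R)) - f t) @[h --> 0^'] --> d.
    by split; [apply/cvg_ex; exists d|exact/cvg_lim].
  apply/cvgrPdist_le => e e0; have [h h0 K] := H e e0.
  apply/nbhs_ballP; exists h => //= y; rewrite /ball/= sub0r normrN => yh y0.
  rewrite /GRing.scale/= mulr1.
  have := K (y + t); rewrite addrK => /(_ yh).
  have y0' : 0 < `|y| by rewrite normr_gt0.
  rewrite -(ler_pM2r y0' `|d - _|) -normrM mulrBl mulrAC mulVf// mul1r.
  by rewrite -[X in _ -> X <= _]normrN opprB.
Qed.

Lemma is_derive_near_eq f g t d : (\forall s \near t, f s = g s) ->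
  is_derive t (1 : R) f d -> is_derive t (1 : R) g d.
Proof.
move=> /nbhs_ballP[h h0 H] /is_derive_nearP K; apply/is_derive_nearP => e e0.
have [k k0 L] := K e e0; exists (Num.min h k); first by rewrite lt_min h0.
move=> y; rewrite lt_min => /andP[yh yk].
rewrite -(H y) -?(H t); first exact: L.
  exact: ballxx.
by rewrite /ball/= distrC.
Qed.

(** Fermat's rule. It serves at the times when an occupied mass sits at its capacity, hence at a
    maximum. *)
Lemma is_derive_max f t d : is_derive t (1 : R) f d ->
  (\forall s \near t, f s <= f t) -> d = 0.
Proof.
move=> /is_derive_nearP H /nbhs_ballP[k /= k0 K].
apply/eqP; rewrite -normr_eq0 eq_le normr_ge0 andbT.
apply/ler_addgt0Pl => e e0; rewrite addr0.
have [h h0 L] := H e e0.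
pose l := Num.min h k / 2; have l0 : 0 < l by rewrite divr_gt0// lt_min h0.
have : l < Num.min h k.
  by rewrite ltr_pdivrMr// mulr2n mulrDr mulr1 ltrDl lt_min h0.
rewrite lt_min => /andP[lh lk].
rewrite -(ler_pM2r l0).
have [d0|d0] := leP 0 d.
- have := L (t + l); rewrite addrAC subrr add0r gtr0_norm// => /(_ lh).
  have := K (t + l); rewrite /ball/= opprD addrA subrr add0r normrN gtr0_norm//.
  move=> /(_ lk) a /ler_normlP[b _]; rewrite ger0_norm//; lra.
- have := L (t - l); rewrite addrAC subrr add0r normrN gtr0_norm// => /(_ lh).
  have := K (t - l); rewrite /ball/= opprB addrC subrK gtr0_norm//.
  move=> /(_ lk) a /ler_normlP[b _]; rewrite ltr0_norm//; lra.
Qed.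

End derivative.

(** * Absolute continuity, and monotonicity from the sign of the derivative *)

Section absolute_continuity.
Context {R : realType}.
Implicit Types (f g : R -> R) (a b t d : R).
Notation leb := (@lebesgue_measure R).

Lemma abs_continuousD a b f g : abs_continuous a b f -> abs_continuous a b g ->
  abs_continuous a b (fun t => f t + g t).
Proof.
move=> cf cg e e0; have e2 : 0 < e / 2 by rewrite divr_gt0.
have [d1 d10 H1] := cf _ e2; have [d2 d20 H2] := cg _ e2.
exists (Num.min d1 d2); first by rewrite lt_min d10.
move=> k I Iab dI; rewrite lt_min => /andP[lt1 lt2].
rewrite [e]splitr; apply: le_lt_trans (ltrD (H1 _ _ Iab dI lt1) (H2 _ _ Iab dI lt2)).
rewrite -big_split/=; apply: ler_sum => i _; rewrite opprD addrACA.
exact: ler_normD.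
Qed.

Lemma lipschitz_abs_continuous a b f L :
  (forall s t, a <= s -> s <= t -> t <= b -> `|f t - f s| <= L * (t - s)) ->
  abs_continuous a b f.
Proof.
move=> fL e e0; have L1 : 0 < `|L| + 1 by rewrite ltr_wpDl.
exists (e / (`|L| + 1)); first by rewrite divr_gt0.
move=> k I Iab _; rewrite ltr_pdivlMr// mulrC => H; apply: le_lt_trans H.
rewrite mulr_sumr; apply: ler_sum => i _.
have [a1 h12 h2] := Iab i.
apply: le_trans (fL _ _ a1 h12 h2) _; apply: ler_wpM2r.
  by rewrite subr_ge0.
by rewrite (le_trans (ler_norm L))// lerDl.
Qed.

Lemma abs_continuousZ a b f c : abs_continuous a b f ->
  abs_continuous a b (fun t => c * f t).
Proof.
move=> cf e e0; have c1 : 0 < `|c| + 1 by rewrite ltr_wpDl.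
have [|d d0 H] := cf (e / (`|c| + 1)); first by rewrite divr_gt0.
exists d => // k I Iab dI ltd; have := H k I Iab dI ltd.
rewrite ltr_pdivlMr// mulrC; apply: le_lt_trans.
rewrite mulr_sumr; apply: ler_sum => i _.
by rewrite -mulrBr normrM ler_wpM2r// lerDl.
Qed.

Lemma abs_continuous_sum a b (I : Type) (s : seq I) (F : I -> R -> R) :
  (forall i, abs_continuous a b (F i)) ->
  abs_continuous a b (fun t => \sum_(i <- s) F i t).
Proof.
move=> cF; elim: s => [|i s IH].
  apply: (@lipschitz_abs_continuous _ _ _ 0) => x y _ _ _.
  by rewrite !big_nil subrr normr0 mul0r.
have := abs_continuousD (cF i) IH; congr (abs_continuous _ _ _).
by apply/funext => t; rewrite big_cons.
Qed.

(** Intervals are listed from right to left, because the covering argument moves to the right and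
    prepends the newest one. *)
Definition sorted_family (U : set R) a t (s : seq (R * R)) :=
  [/\ forall p, p \in s -> [/\ a <= p.1, p.1 <= p.2, p.2 <= t &
        `]p.1, p.2[ `<=` U] &
      pairwise (fun p p' : R * R => p'.2 <= p.1) s].

Lemma sorted_family_cons (U : set R) a t t' s : a <= t -> t <= t' ->
  `]t, t'[ `<=` U ->
  sorted_family U a t s -> sorted_family U a t' ((t, t') :: s).
Proof.
move=> aT tt' tU [H1 H2]; split.
  move=> p; rewrite inE => /predU1P[->//|/H1[h1 h2 h3 h4]].
  by split => //; exact: le_trans tt'.
rewrite pairwise_cons H2 andbT; apply/allP => p /H1[_ _ h _] //=.
Qed.

Lemma sorted_family_le (U : set R) a t t' s : t <= t' ->
  sorted_family U a t s -> sorted_family U a t' s.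
Proof.
move=> tt' [H1 H2]; split => // p /H1[h1 h2 h3 h4].
by split => //; exact: le_trans tt'.
Qed.

Lemma sorted_family_trivIset (U : set R) a t s : sorted_family U a t s ->
  trivIset setT (fun i : 'I_(size s) => `](nth 0 s i).1, (nth 0 s i).2[%classic).
Proof.
move=> [_ /(pairwiseP 0) H] i j _ _ [z [/=]].
rewrite !in_itv/= => /andP[i1 i2] /andP[j1 j2].
apply/val_inj => /=; case: (ltngtP i j) => // ij; exfalso.
  have := H _ _ (ltn_ord i) (ltn_ord j) ij; lra.
have := H _ _ (ltn_ord j) (ltn_ord i) ij; lra.
Qed.

(** Disjoint intervals inside [U] have total length at most the measure of [U]; a small [U] thus
    makes the smallness condition of absolute continuity available. *)
Lemma sorted_family_measure (U : set R) a t s : measurable U ->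
  sorted_family U a t s ->
  ((\sum_(i < size s) ((nth 0 s i).2 - (nth 0 s i).1))%:E <= leb U)%E.
Proof.
move=> mU sf; have dI := sorted_family_trivIset sf.
pose I (i : 'I_(size s)) : set R := `](nth 0 s i).1, (nth 0 s i).2[%classic.
have <- : (\sum_(i < size s) leb (I i) =
   (\sum_(i < size s) ((nth 0 s i).2 - (nth 0 s i).1))%R%:E)%E.
  rewrite -sumEFin; apply: eq_bigr => i _.
  have [h1 h2 h3 h4] := sf.1 _ (mem_nth 0 (ltn_ord i)).
  rewrite [LHS](lebesgue_measure_itv `](nth 0 s i).1, (nth 0 s i).2[)/= lte_fin.
  case: ifPn; first by rewrite EFinB.
  rewrite -leNgt => h2'; have -> : (nth 0 s i).1 = (nth 0 s i).2.
    by apply/eqP; rewrite eq_le h2.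
  by rewrite subrr.
have <- : leb (\big[setU/set0]_(i < size s) I i) = (\sum_(i < size s) leb (I i))%E.
  by apply: measure_bigsetU_ord => // i; exact: measurable_itv.
apply: le_measure; rewrite ?inE//.
  by apply: bigsetU_measurable => i _; exact: measurable_itv.
apply: (big_ind (fun A => A `<=` U)); first exact: sub0set.
  by move=> A B AU BU; rewrite subUset.
by move=> i _; have [] := sf.1 _ (mem_nth 0 (ltn_ord i)).
Qed.

(* Cousin-type covering argument: follow [f] to the right, through [U] (a small
   open set containing the exceptional points) when the derivative does not
   exist, and using the derivative otherwise. *)
Lemma abs_continuous_nonincreasing a b f : a <= b -> abs_continuous a b f ->
  {ae leb, forall t, a < t < b -> exists2 d, is_derive t (1 : R) f d & d <= 0} ->
  f b <= f a.
Proof.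
move=> ab cf [N [mN N0 sN]].
(* [e * (b - a)] pays for the points with a nonpositive derivative, the last [e] for the variation
   of [f] across the small open set [U]. *)
suff H e : 0 < e -> f b <= f a + (e * (b - a) + e).
  apply/ler_addgt0Pl => e e0.
  have ba : 0 < b - a + 1 by rewrite ltr_wpDl// subr_ge0.
  have := H (e / (b - a + 1)) (divr_gt0 e0 ba).
  by rewrite -[X in _ * _ + X]mulr1 -mulrDr divfK ?gt_eqF// addrC.
move=> e0; have [del del0 Hdel] := cf e e0.
(* The derivative is only available strictly inside the interval, so the endpoints join the
   exceptional set. *)
pose D := N `|` [set a; b].
have mab : measurable [set a; b] by apply: measurableU.
have mD : measurable D by apply: measurableU.
have D0 : (leb D = 0)%E.
  apply/eqP; rewrite eq_le measure_ge0 andbT.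
  have h1 : (leb D <= leb N + leb [set a; b])%E by exact: measureU2.
  have h2 : (leb [set a; b] <= leb [set a] + leb [set b])%E by exact: measureU2.
  apply: le_trans h1 _; rewrite N0 add0e; apply: le_trans h2 _.
  by rewrite !lebesgue_measure_set1 adde0.
have [|U [oU DU lU]] := lebesgue_regularity_outer mD _ del0.
  by rewrite [X in (X < _)%E]D0.
have mU : measurable U by exact: open_measurable.
have {}lU : (leb U < del%:E)%E.
  apply: le_lt_trans lU; rewrite -{1}(setDUK DU).
  have : (leb (D `|` U `\` D) <= leb D + leb (U `\` D))%E.
    by apply: measureU2 => //; exact: measurableD.
  by rewrite D0 add0e.
(* Invariant: up to slope [e], all the increase of [f] so far took place across listed intervals
   contained in [U]. *)
pose P t := exists s, sorted_family U a t s /\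
  f t - f a <= e * (t - a) + \sum_(p <- s) `|f p.2 - f p.1|.
suff [s [sf H]] : P b.
  rewrite -lerBlDl; apply: (le_trans H); rewrite lerD2l.
  rewrite (big_nth 0) big_mkord; apply/ltW/Hdel.
  - by move=> i; have [] := sf.1 _ (mem_nth 0 (ltn_ord i)).
  - exact: sorted_family_trivIset sf.
  - rewrite -lte_fin; apply: le_lt_trans lU; exact: sorted_family_measure sf.
apply: (real_induction ab).
  exists [::]; split; first by split.
  by rewrite !subrr mulr0 big_nil addr0.
move=> s /andP[as_ sb].
have [Ds|nDs] := pselect (D s).
  have /nbhs_ballP[h h0 hU] : nbhs s U by apply: open_nbhs_nbhs; split => //; exact: DU.
  exists h => // t t' aT /andP[ht ts] /andP[st' t'h] t'b [F [sf H]].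
  exists ((t, t') :: F); split.
    apply: sorted_family_cons => //; first exact: le_trans st'.
    move=> z /=; rewrite in_itv/= => /andP[z1 z2]; apply: hU.
    rewrite /ball/=; rewrite ltr_norml; apply/andP; split; lra.
  rewrite big_cons/=.
  have tt' : t <= t' := le_trans ts st'.
  have := ler_norm (f t' - f t); have : e * t <= e * t' by rewrite ler_pM2l.
  move: H; rewrite !mulrBr; lra.
have sab : a < s < b.
  rewrite !lt_neqAle as_ sb !andbT; apply/andP; split; apply/eqP => E; apply: nDs; right.
    by left.
  by right.
have [d /is_derive_nearP ds d0] : exists2 d, is_derive s (1 : R) f d & d <= 0.
  by apply: contrapT => nd; apply: nDs; left; apply: sN => /= /(_ sab).
have [h h0 hd] := ds _ e0; exists h => // t t' aT /andP[ht ts] /andP[st' t'h] t'b [F [sf H]].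
exists F; split; first by apply: sorted_family_le sf; exact: le_trans st'.
have /ler_normlP[A1 A2] := hd t ltac:(rewrite ltr_norml; apply/andP; split; lra).
have /ler_normlP[B1 B2] := hd t' ltac:(rewrite ltr_norml; apply/andP; split; lra).
rewrite ler0_norm ?subr_le0// in A1 A2; rewrite ger0_norm ?subr_ge0// in B1 B2.
have C1 : d * (t' - s) <= 0 by rewrite mulr_le0_ge0// subr_ge0.
have C2 : 0 <= d * (t - s) by rewrite mulr_le0// subr_le0.
move: H A1 B2 C1 C2; rewrite !mulrBr; lra.
Qed.

End absolute_continuity.

(** * Differentiability of reflected paths *)

Section reflected_path.
Context {R : realType}.
Implicit Types (f g z : R -> R) (s t T L : R).
Notation leb := (@lebesgue_measure R).

(* A smooth approximation of the identity on [0, oo) whose derivative vanishes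
   at 0; as [n] grows, its derivative tends to the indicator of (0, oo). *)
Let soft (n : nat) (x : R) := x - x / (1 + n%:R * `|x|).
Let dsoft (n : nat) (x : R) := 1 - (1 + n%:R * `|x|) ^- 2.

Let soft_den n (x : R) : 1 <= 1 + n%:R * `|x|.
Proof. by rewrite lerDl mulr_ge0. Qed.

Let soft_den0 n (x : R) : 0 < 1 + n%:R * `|x|.
Proof. exact: lt_le_trans (soft_den n x). Qed.

(** Quadratic at 0: composed with a Lipschitz [z], [soft n] has derivative zero wherever [z]
    vanishes, whatever the behaviour of [z] there. *)
Let soft_near0 n (x : R) : `|soft n x| <= n%:R * x ^+ 2.
Proof.
have d0 := soft_den0 n x.
have -> : soft n x = x * (n%:R * `|x|) / (1 + n%:R * `|x|).
  by rewrite /soft; field; rewrite gt_eqF.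
rewrite normrM normfV (gtr0_norm d0) ler_pdivrMr// !normrM normr_id normr_nat.
rewrite mulrCA -expr2 real_normK ?num_real//.
by rewrite ler_peMr// mulr_ge0// sqr_ge0.
Qed.

Let soft_id n (x : R) e : 0 < e -> e^-1 <= n%:R -> `|soft n x - x| <= e.
Proof.
move=> e0 en; have d0 := soft_den0 n x.
rewrite /soft addrAC subrr add0r normrN normrM normfV (gtr0_norm d0).
rewrite ler_pdivrMr// mulrDr mulr1 mulrA.
apply: (@le_trans _ _ (e * n%:R * `|x|)); last by rewrite lerDr ltW.
by rewrite ler_peMl// -ler_pdivrMl// mulr1.
Qed.

Let dsoft_bound n x : 0 <= dsoft n x <= 1.
Proof.
have d0 := soft_den0 n x.
rewrite subr_ge0 gerBl invr_ge0 exprn_ge0 ?(ltW d0)// andbT.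
by rewrite invf_le1 ?exprn_gt0// exprn_ege1// soft_den.
Qed.

Let dsoft1 n (x : R) e : 0 < e -> x != 0 -> (e * `|x|)^-1 <= n%:R ->
  `|dsoft n x - 1| <= e.
Proof.
move=> e0 x0 en; have d0 := soft_den0 n x; have d1 := soft_den n x.
have nx : 0 < `|x| by rewrite normr_gt0.
rewrite /dsoft addrAC subrr add0r normrN normfV normrX (gtr0_norm d0).
rewrite -[X in X <= _]mul1r ler_pdivrMr ?exprn_gt0//.
apply: (@le_trans _ _ (e * (1 + n%:R * `|x|))); last first.
  by rewrite ler_pM2l// expr2 ler_peMl// ltW.
rewrite mulrDr mulr1.
apply: (@le_trans _ _ (e * (n%:R * `|x|))); last by rewrite lerDr ltW.
by rewrite mulrCA -ler_pdivrMr ?mulr_gt0// mul1r.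
Qed.

Let soft_derive z g T L n t : (forall s, 0 <= s <= T -> 0 <= z s) ->
  (forall s r, 0 <= s <= T -> 0 <= r <= T -> `|z s - z r| <= L * `|s - r|) ->
  (forall s, 0 < s < T -> 0 < z s -> is_derive s (1 : R) z (g s)) ->
  0 < t < T -> is_derive t (1 : R) (soft n \o z) (dsoft n (z t) * g t).
Proof.
move=> z0 zL zg tT; have /andP[t0 tT'] := tT.
have t0T : 0 <= t <= T by rewrite !ltW.
have [zt0|zt0] := eqVneq (z t) 0.
  rewrite /dsoft zt0 normr0 mulr0 addr0 expr1n invr1 subrr mul0r.
  apply/is_derive_nearP => e e0.
  have C0 : 0 < n%:R * L ^+ 2 + 1 by rewrite ltr_wpDl// mulr_ge0// sqr_ge0.
  exists (Num.min (Num.min t (T - t)) (e / (n%:R * L ^+ 2 + 1))).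
    by rewrite !lt_min t0 subr_gt0 tT' divr_gt0.
  move=> y; rewrite !lt_min => /andP[/andP[y1 y2] y3].
  rewrite /= zt0 {2}/soft mul0r !subr0 mul0r subr0.
  have y0T : 0 <= y <= T.
    move: y1 y2; rewrite !ltr_norml => /andP[a1 _] /andP[_ a2].
    by apply/andP; split; lra.
  apply: le_trans (soft_near0 _ _) _.
  have zy : `|z y| <= L * `|y - t| by have := zL y t y0T t0T; rewrite zt0 subr0.
  rewrite -(real_normK (num_real (z y))).
  apply: (@le_trans _ _ (n%:R * (L * `|y - t|) ^+ 2)).
    by rewrite ler_wpM2l// lerXn2r// nnegrE// (le_trans _ zy).
  rewrite exprMn mulrA (expr2 `|y - t|) mulrA ler_wpM2r//.
  move: y3; rewrite ltr_pdivlMr// mulrC => /ltW; apply: le_trans.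
  by rewrite ler_wpM2r// lerDl.
have zt : 0 < z t by rewrite lt_neqAle eq_sym zt0 z0.
have dz := zg _ tT zt.
pose k := fun s => z s - z s * (1 + n%:R * z s)^-1.
apply: (@is_derive_near_eq _ k).
  have zc : {for t, continuous z}.
    by apply/differentiable_continuous/derivable1_diffP; exact: ex_derive.
  have : \forall s \near t, 0 < z s.
    by move/cvgrPdist_lt: zc => /(_ _ zt); apply: filterS => s; rewrite ltr_norml => /andP[_]; lra.
  by apply: filterS => s zs; rewrite /k/soft/= gtr0_norm.
have D0 : 1 + n%:R * z t != 0.
  by have := soft_den0 n (z t); rewrite gtr0_norm// => /gt_eqF ->.
rewrite /k /dsoft gtr0_norm//.
apply: is_derive_eq.
rewrite /GRing.scale/=; field; exact: D0.
Qed.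

(** Each [soft n \o z] has a continuous derivative [dsoft n (z s) * g s] inside the interval, zeros
    of [z] included, so the fundamental theorem of calculus applies to it. By dominated convergence
    [dsoft n (z s)] may then be replaced by the indicator of [0 < z s]: the time spent at 0
    contributes nothing. *)
Lemma reflected_path_cumul z g T L : continuous z -> continuous g ->
  (forall s, 0 <= s <= T -> 0 <= z s) ->
  (forall s r, 0 <= s <= T -> 0 <= r <= T -> `|z s - z r| <= L * `|s - r|) ->
  (forall s, 0 < s < T -> 0 < z s -> is_derive s (1 : R) z (g s)) ->
  bounded_measurable T (fun s => if 0 < z s then g s else 0) /\
  forall t, 0 <= t <= T -> z t - z 0 = cumul (fun s => if 0 < z s then g s else 0) t.
Proof.
move=> cz cg z0 zL zg.
set h := fun s => if 0 < z s then g s else 0.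
have mz : measurable_fun setT z by exact: continuous_measurable_fun.
have mg : measurable_fun setT g by exact: continuous_measurable_fun.
have mh : measurable_fun setT h.
  apply: measurable_fun_ifT => //.
  by apply: measurable_fun_ltr => //; exact: measurable_cst.
have [mg' [B gB]] : bounded_measurable T g.
  by apply: continuous_bounded_measurable; exact: continuous_subspaceT.
have B0 s : 0 <= s <= T -> 0 <= B by move=> /gB; exact: le_trans.
split.
  split; first exact: measurable_funTS.
  exists B => s sT; rewrite /h; case: ifPn => _; first exact: gB.
  by rewrite normr0 (B0 s).
move=> t /andP[]; rewrite le_eqVlt => /predU1P[<-|t0] tT.
  by rewrite subrr cumul0.
pose dp n s := dsoft n (z s) * g s.
have cnz n x : {for x, continuous (fun s => 1 + n%:R * `|z s|)}.
  apply: cvgD; first exact: cvg_cst.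
  apply: cvgM; first exact: cvg_cst.
  by apply: cvg_norm; exact: cz.
have cdp n : continuous (dp n).
  move=> x; apply: cvgM; last exact: cg.
  apply: cvgB; first exact: cvg_cst.
  apply: cvgV; first by rewrite expf_neq0// gt_eqF// soft_den0.
  exact: cvgM (cnz n x) (cnz n x).
have csoft n : continuous (soft n \o z).
  move=> x; apply: cvgB; first exact: cz.
  apply: cvgM; first exact: cz.
  apply: cvgV; first by rewrite gt_eqF// soft_den0.
  exact: cnz.
have ftc n : (\int[leb]_(s in `[0%R, t]) (dp n s)%:E =
    (soft n (z t) - soft n (z 0))%R%:E)%E.
  rewrite (@continuous_FTC2 _ (dp n) (soft n \o z))//.
  - by apply: continuous_subspaceT; exact: cdp.
  - split.
    + move=> x; rewrite in_itv/= => /andP[x0 xt].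
      have d : is_derive x (1 : R) (soft n \o z) (dp n x).
        by apply: (soft_derive _ z0 zL zg); rewrite x0 (lt_le_trans xt).
      exact: ex_derive.
    + by apply: cvg_at_right_filter; exact: csoft.
    + by apply: cvg_at_left_filter; exact: csoft.
  - move=> x; rewrite in_itv/= => /andP[x0 xt]; rewrite derive1E.
    have d : is_derive x (1 : R) (soft n \o z) (dp n x).
      by apply: (soft_derive _ z0 zL zg); rewrite x0 (lt_le_trans xt).
    exact: derive_val.
have [||||||_ _] := @dominated_convergence _ _ _ leb `[0, t]%classic _
   (fun n => EFin \o dp n) (EFin \o h) (EFin \o cst B).
- by [].
- move=> n; apply/measurable_EFinP; apply: measurable_funTS.
  exact: continuous_measurable_fun.
- by apply/measurable_EFinP; apply: measurable_funTS.
- apply/aeW => s; rewrite /= in_itv/= => /andP[s0 st].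
  have s0T : 0 <= s <= T by rewrite s0 (le_trans st).
  apply: cvg_EFin; first exact: nearW.
  rewrite /h /dp; case: ifPn => zs.
    rewrite -[X in _ --> X]mul1r; apply: cvgM; last exact: cvg_cst.
    apply/cvgrPdist_le => e e0; near=> n; rewrite distrC.
    apply: dsoft1 => //; first by rewrite gt_eqF.
    by near: n; exact: nbhs_infty_ger.
  have -> : z s = 0 by apply/eqP; rewrite eq_le z0// andbT leNgt.
  rewrite /dsoft normr0; apply: cvg_near_cst; apply: nearW => n /=.
  by rewrite mulr0 addr0 expr1n invr1 subrr mul0r.
- apply: bounded_measurable_integrable tT; exact: bounded_measurable_cst.
- apply/aeW => s n; rewrite /= in_itv/= => /andP[s0 st].
  have s0T : 0 <= s <= T by rewrite s0 (le_trans st).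
  rewrite lee_fin /dp normrM; have /andP[d0 d1] := dsoft_bound n (z s).
  rewrite ger0_norm//; apply: le_trans (gB _ s0T).
  by rewrite ler_piMl.
under eq_fun do rewrite ftc.
move=> H; have K : (soft n (z t) - soft n (z 0))%:E @[n --> \oo] --> (z t - z 0)%:E.
  apply: cvg_EFin; first exact: nearW.
  apply: cvgB; apply/cvgrPdist_le => e e0; near=> n; rewrite distrC;
    by apply: soft_id => //; near: n; exact: nbhs_infty_ger.
have E1 := cvg_lim (@ereal_hausdorff R) H.
have E2 := cvg_lim (@ereal_hausdorff R) K.
exact: (congr1 fine (etrans (esym (E2 _)) (E1 _))).
Unshelve. all: by end_near. Qed.

(** [z] is a primitive of a bounded measurable function, so Lebesgue's differentiation theorem
    applies. *)
Lemma reflected_path_ae_derivable z g T L : continuous z -> continuous g ->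
  (forall s, 0 <= s <= T -> 0 <= z s) ->
  (forall s r, 0 <= s <= T -> 0 <= r <= T -> `|z s - z r| <= L * `|s - r|) ->
  (forall s, 0 < s < T -> 0 < z s -> is_derive s (1 : R) z (g s)) ->
  {ae leb, forall t, 0 < t < T -> derivable z t 1}.
Proof.
move=> cz cg z0 zL zg.
have [] := reflected_path_cumul cz cg z0 zL zg.
set h := fun s => _ => bh zh.
(* Extension by 0, to have an integrable function on the whole line. *)
pose h' := h \_ `[0, T].
have ih : leb.-integrable setT (EFin \o h').
  rewrite -restrict_EFin; apply/integrable_restrict => //=; rewrite setTI.
  exact: bounded_measurable_integrable bh (lexx T).
have lih : locally_integrable setT h'.
  by apply: integrable_locally => //; exact: bounded_measurable_integrable bh (lexx T).
have := @FTC1 _ h' (BLeft 0).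
move=> /(_ _ lih)[]; first by move=> y; apply: integrableS ih.
move=> N [mN N0 sN]; exists N; split => // t /= nt; apply: sN => /= Ht; apply: nt.
move=> /andP[t0 tT].
have [|dF _] := Ht; first by rewrite lte_fin.
have : is_derive t (1 : R) z ('D_1 (cumul h') t).
  apply: (@is_derive_near_eq _ (fun x => z 0 + cumul h' x)).
    near=> x.
    have x0 : 0 < x by near: x; exact: lt_nbhsr.
    have xT : x < T by near: x; exact: lt_nbhsl.
    have x0T : 0 <= x <= T by rewrite !ltW.
    rewrite -[RHS](subrK (z 0)) zh// addrC; congr (_ + _).
    apply: eq_Rintegral => s; rewrite inE/= in_itv/= => /andP[s0 sx].
    rewrite /h' patchE mem_set//= in_itv/= s0/=.
    exact: le_trans (ltW xT).
  apply: is_derive_eq; last exact: add0r.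
  by apply: is_deriveD.
by move=> ?; exact: ex_derive.
Unshelve. all: by end_near. Qed.

End reflected_path.

(** * Uniform law of large numbers for Poisson clocks *)

Section poisson_law_of_large_numbers.
Context {R : realType}.

Lemma nneseries_exp (r : R) : 0 <= r ->
  (\sum_(j <oo) (r ^+ j / j`!%:R)%R%:E = (expR r)%:E)%E.
Proof.
move=> r0; rewrite expRE -EFin_lim; last first.
  rewrite /pseries/=; under eq_fun do rewrite mulrC.
  exact: is_cvg_series_exp_coeff.
apply/congr_lim/funext => n/=; rewrite /pseries/= /series/= -sumEFin//.
by under eq_bigr do rewrite mulrC.
Qed.

Lemma nneseries_geometric_lty (r : R) : 0 <= r -> r < 1 ->
  (\sum_(j <oo) (r ^+ j)%R%:E < +oo)%E.
Proof.
move=> r0 r1; have nr : `|r| < 1 by rewrite ger0_norm.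
have /cvg_lim E := @cvg_geometric_series R 1 r nr.
rewrite (_ : (\sum_(j <oo) (r ^+ j)%R%:E)%E = (limn (series (geometric 1 r)))%:E).
  exact: ltry.
rewrite -EFin_lim; last exact: is_cvg_geometric_series.
apply/congr_lim/funext => n/=; rewrite /series/= -sumEFin//.
by apply: eq_bigr => i _; rewrite mul1r.
Qed.

Section chernoff.
Context {d : measure_display} {Omega : measurableType d}.
Variables (P : probability Omega R) (X : Omega -> nat) (t : R).
Hypothesis mX : forall j, measurable [set w | X w = j].
Hypothesis t0 : 0 < t.
Hypothesis PX : forall j, P [set w | X w = j] = (poisson_pmf t j)%:E.

Lemma poisson_chernoff_measurable (a c : R) :
  measurable [set w | c <= a * (X w)%:R].
Proof.
rewrite (_ : [set _ | _] = \bigcup_(j in [set j : nat | c <= a * j%:R])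
    [set w | X w = j]); last first.
  by apply/seteqP; split => [w /= h|w [j /= h ->]//]; exists (X w).
by apply: bigcup_measurable => j _.
Qed.

(** Exponential Markov inequality, term by term: each [j] with [c <= a * j] has its weight
    multiplied by [expR (a * j - c) >= 1], and the full series is the Poisson generating function.
    The sign of [a] is free, which covers both tails. *)
Lemma poisson_chernoff (a c : R) :
  (P [set w | c <= a * (X w)%:R]%R <= (expR (- c + t * (expR a - 1)))%R%:E)%E.
Proof.
pose F j := if c <= a * j%:R then [set w | X w = j] else set0.
have mF j : measurable (F j) by rewrite /F; case: ifP.
have sub : [set w | c <= a * (X w)%:R] `<=` \bigcup_j F j.
  by move=> w /= h; exists (X w) => //; rewrite /F h.
have mA := poisson_chernoff_measurable a c.
apply: (@le_trans _ _ (\sum_(j <oo) P (F j))%E).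
  exact: measure_sigma_subadditive.
have b0 : 0 <= t * expR a by rewrite mulr_ge0 ?expR_ge0// ltW.
apply: (@le_trans _ _ (\sum_(j <oo) ((expR (- c - t))%R%:E * ((t * expR a) ^+ j / j`!%:R)%R%:E))%E).
  apply: lee_nneseries => j _ //; rewrite /F; case: ifPn => h; last first.
    by rewrite measure0 -EFinM lee_fin mulr_ge0 ?expR_ge0// divr_ge0 ?exprn_ge0.
  rewrite PX -EFinM lee_fin /poisson_pmf t0 exprMn -expRM_natl.
  have -> : expR (- c - t) * (t ^+ j * expR (j%:R * a) / j`!%:R) =
     t ^+ j / j`!%:R * expR (- t) * expR (a * j%:R - c).
    rewrite !expRD (mulrC a); ring.
  apply: ler_peMr; last by rewrite -[X in X <= _]expR0 ler_expR subr_ge0.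
  by rewrite mulr_ge0 ?expR_ge0// divr_ge0 ?exprn_ge0// ltW.
rewrite nneseriesZl; last first.
  by move=> j _; rewrite lee_fin divr_ge0 ?exprn_ge0.
rewrite nneseries_exp// -EFinM -expRD lee_fin ler_expR; lra.
Qed.

End chernoff.

(** The ratios [r1] and [r2] of the two tails depend on [e] only, so the deviation probabilities are
    summable in [k]. *)
Lemma poisson_large_deviation (e : R) : 0 < e ->
  exists r1 r2 : R, [/\ 0 <= r1 < 1, 0 <= r2 < 1 &
   forall (d : measure_display) (Omega : measurableType d)
     (P : probability Omega R) (X : Omega -> nat) (k : nat),
   (0 < k)%N ->
   (forall j, measurable [set w | X w = j]) ->
   (forall j, P [set w | X w = j] = (poisson_pmf k%:R j)%:E) ->
   exists B : set Omega, [/\ measurable B,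
     forall w, ~ B w -> `|(X w)%:R - k%:R| <= e * k%:R &
     (P B <= (r1 ^+ k)%R%:E + (r2 ^+ k)%R%:E)%E]].
Proof.
move=> e0; pose a := e / (2 * (1 + e)).
have e1 : 0 < 1 + e by rewrite ltr_wpDl.
have a0 : 0 < a by rewrite divr_gt0// mulr_gt0.
have ae : a * (1 + e) = e / 2 by rewrite /a; field; rewrite gt_eqF.
have a1 : a < 1.
  by rewrite ltr_pdivrMr ?mulr_gt0// mul1r; lra.
pose x1 := - (a * (1 + e)) + (expR a - 1).
pose x2 := a * (1 - e) + (expR (- a) - 1).
have x10 : x1 < 0.
  have : expR a * (1 - a) <= 1.
    have := expR_ge1Dx (- a); rewrite -(ler_pM2l (expR_gt0 a)).
    by rewrite -expRD subrr expR0.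
  rewrite -ler_pdivlMr ?subr_gt0// => h.
  rewrite /x1; have h2 : 1 / (1 - a) < a * (1 + e) + 1.
    rewrite ltr_pdivrMr ?subr_gt0//; nra.
  lra.
have x20 : x2 < 0.
  have : expR (- a) * (1 + a) <= 1.
    have := expR_ge1Dx a; rewrite -(ler_pM2l (expR_gt0 (- a))).
    by rewrite -expRD addNr expR0.
  rewrite -ler_pdivlMr ?addr_gt0// => h.
  rewrite /x2; have h2 : 1 / (1 + a) < 1 - a * (1 - e).
    rewrite ltr_pdivrMr ?addr_gt0//; nra.
  lra.
exists (expR x1), (expR x2); rewrite !expR_ge0 !expR_lt1 x10 x20; split => //.
move=> d Omega P X k k0 mX PX.
have k0' : 0 < (k%:R : R) by rewrite ltr0n.
exists ([set w | a * (1 + e) * k%:R <= a * (X w)%:R] `|`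
        [set w | - (a * (1 - e) * k%:R) <= - a * (X w)%:R]).
have m1 := poisson_chernoff_measurable mX a (a * (1 + e) * k%:R).
have m2 := poisson_chernoff_measurable mX (- a) (- (a * (1 - e) * k%:R)).
split; first exact: measurableU.
  move=> w /not_orP[/= /negP + /negP]; rewrite -!ltNge.
  rewrite mulNr ltrN2 -!(mulrA a) !(ltr_pM2l a0) => h1 h2.
  by rewrite ler_norml; apply/andP; split; lra.
apply: le_trans (measureU2 _ m1 m2) _; apply: leeD.
  apply: le_trans (poisson_chernoff mX k0' PX _ _) _.
  rewrite lee_fin -expRM_natl ler_expR /x1; lra.
apply: le_trans (poisson_chernoff mX k0' PX _ _) _.
rewrite lee_fin -expRM_natl ler_expR /x2; lra.
Qed.

(** Borel-Cantelli along the integers, where the count has the Poisson law of parameter [k], for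
    each of the countably many tolerances [1 / p.+1]. *)
Lemma poisson_slln (d : measure_display) (Omega : measurableType d)
  (P : probability Omega R) (N : Omega -> R -> nat) :
  unit_poisson_process P N ->
  {ae P, forall w, forall e : R, 0 < e ->
    \forall k \near \oo, `|(N w k%:R - N w 0%R)%:R - k%:R| <= e * k%:R}.
Proof.
move=> [mN _ _ PN].
suff H (p : nat) : {ae P, forall w,
    \forall k \near \oo, `|(N w k%:R - N w 0%R)%:R - k%:R| <= p.+1%:R^-1 * (k%:R : R)}.
  have /ae_foralln := H; apply: filterS => w Hw e e0.
  have [p /= ] := near_infty_natSinv_lt (PosNum e0).
  move=> _ /(_ p (leqnn p)) /ltW/= pe; apply: filterS (Hw p) => k /le_trans; apply.
  by rewrite ler_wpM2r.
have p0 : 0 < (p.+1%:R^-1 : R) by rewrite invr_gt0.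
have [r1 [r2 [/andP[r10 r11] /andP[r20 r21] H]]] := poisson_large_deviation p0.
have /choice[B HB] : forall k : nat, exists B : set Omega, [/\ measurable B,
     (0 < k)%N -> forall w, ~ B w -> `|(N w k%:R - N w 0%R)%:R - k%:R| <= p.+1%:R^-1 * (k%:R : R) &
     (P B <= (r1 ^+ k)%R%:E + (r2 ^+ k)%R%:E)%E].
  (* At [k = 0] no deviation bound is claimed, and the empty set fills the slot. *)
  move=> [|k].
    by exists set0; split => //; rewrite measure0 !expr0 -EFinD lee_fin.
  have mX j : measurable [set w | (N w k.+1%:R - N w 0%R)%N = j].
    have m0 := mN 0 (lexx _); have mk := mN k.+1%:R (ler0n _ _).
    have : measurable_fun setT (fun w => (N w k.+1%:R - N w 0%R)%N).
      exact: measurable_fun_subn.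
    move=> /(_ measurableT [set j]); rewrite setTI; exact.
  have PX j : P [set w | (N w k.+1%:R - N w 0%R)%N = j] = (poisson_pmf k.+1%:R j)%:E.
    by rewrite PN// subr0.
  have [B [h1 h2 h3]] := H _ _ P _ _ (ltn0Sn k) mX PX.
  by exists B; split.
exists (lim_sup_set B); split.
- apply: bigcapT_measurable => n; apply: bigcup_measurable => k _.
  by have [] := HB k.
- apply: lim_sup_set_cvg0; first by move=> k; have [] := HB k.
  apply: (@le_lt_trans _ _ (\sum_(k <oo) ((r1 ^+ k)%R%:E + (r2 ^+ k)%R%:E))%E).
    by apply: lee_nneseries => // k _; have [] := HB k.
  rewrite nneseriesD; last 2 first.
    by move=> *; rewrite lee_fin exprn_ge0.
    by move=> *; rewrite lee_fin exprn_ge0.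
  by apply: lte_add_pinfty; exact: nneseries_geometric_lty.
- move=> w /= nw n _; apply: contrapT => nB; apply: nw.
  exists (maxn n 1) => // k /=; rewrite geq_max => /andP[nk k0].
  have [_ + _] := HB k; apply => // Bk; apply: nB.
  by exists k.
Qed.

(** Monotonicity squeezes the count at a real time between those at the neighbouring integers. This
    gives [h * x + C] as a bound on the error at every [x >= 0], where [C] absorbs an initial
    stretch of time; after division by [n] it is uniform on [[0, T]]. *)
Lemma counting_uniform_lln (c : R -> nat) : c 0 = 0%N ->
  (forall s t, 0 <= s -> s <= t -> (c s <= c t)%N) ->
  (forall e : R, 0 < e -> \forall k \near \oo, `|(c k%:R)%:R - k%:R| <= e * k%:R) ->
  forall T e : R, 0 < e -> \forall n \near \oo, forall s, 0 <= s <= T ->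
    `|n%:R^-1 * (c (n%:R * s))%:R - s| <= e.
Proof.
move=> c0 cm H T e e0.
pose T' := Num.max T 1; have T1 : 1 <= T' by rewrite le_max lexx orbT.
(* The slope [h] costs at most [e / 2] up to time [T'], and [h <= 1] bounds the cost of passing from
   [k] to [k.+1]. *)
pose h := Num.min 1 (e / (2 * T')).
have T0 : 0 < T' := lt_le_trans ltr01 T1.
have h0 : 0 < h by rewrite lt_min ltr01 divr_gt0// mulr_gt0.
have h1 : h <= 1 by rewrite ge_min lexx.
have hT : h * T' <= e / 2.
  have : h <= e / (2 * T') by rewrite ge_min lexx orbT.
  rewrite ler_pdivlMr ?mulr_gt0//; lra.
have [K _ HK] := H h h0.
(* The 2 pays for rounding to integers, the rest for the times before [K]. *)
pose C : R := (c K%:R)%:R + K%:R + 2.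
have key x : 0 <= x -> `|(c x)%:R - x| <= h * x + C.
  move=> x0; have /andP[k1 k2] := truncn_itv x0.
  set k := Num.truncn x in k1 k2.
  have c1 : ((c k%:R)%:R : R) <= (c x)%:R by rewrite ler_nat; apply: cm.
  have c2 : ((c x)%:R : R) <= (c k.+1%:R)%:R.
    by rewrite ler_nat; apply: cm => //; exact: ltW.
  have [Kk|kK] := leqP K k.
    have /ler_normlP[a1 a2] := HK k Kk.
    have /ler_normlP[b1 b2] := HK k.+1 (leqW Kk).
    have C2 : 2 <= C by rewrite lerDr addr_ge0.
    rewrite -natr1 in k2 b1 b2 c2.
    rewrite ler_norml; apply/andP; split; nra.
  have xK : x <= K%:R.
    by apply: (le_trans (ltW k2)); rewrite ler_nat.
  have c3 : ((c x)%:R : R) <= (c K%:R)%:R by rewrite ler_nat; apply: cm.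
  have c4 : 0 <= ((c x)%:R : R) by [].
  have c5 : 0 <= h * x by rewrite mulr_ge0// ltW.
  rewrite ler_norml; apply/andP; split; rewrite /C; lra.
near=> n => s /andP[s0 sT].
have n0 : 0 < (n%:R : R) by rewrite ltr0n; near: n; exact: nbhs_infty_gt.
have nC : 2 * C / e <= n%:R by near: n; exact: nbhs_infty_ger.
have -> : n%:R^-1 * (c (n%:R * s))%:R - s =
  n%:R^-1 * ((c (n%:R * s))%:R - n%:R * s) by rewrite mulrBr mulKf ?gt_eqF.
rewrite normrM gtr0_norm ?invr_gt0// ler_pdivrMl//.
apply: le_trans (key _ _) _; first by rewrite mulr_ge0// ltW.
have sT' : s <= T' by rewrite le_max sT.
move: nC; rewrite ler_pdivrMr// => nC.
have : h * (n%:R * s) <= n%:R * (e / 2).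
  rewrite mulrCA ler_pM2l//; apply: le_trans hT.
  by rewrite ler_pM2l.
lra.
Unshelve. all: by end_near. Qed.

Lemma poisson_uniform_lln (d : measure_display) (Omega : measurableType d)
  (P : probability Omega R) (N : Omega -> R -> nat) :
  unit_poisson_process P N ->
  {ae P, forall w, forall T e : R, 0 < e ->
    \forall n \near \oo, forall s, 0 <= s <= T ->
    `|n%:R^-1 * (N w (n%:R * s))%:R - s| <= e}.
Proof.
move=> PN; have H1 := poisson_slln PN; have [_ H2 _ _] := PN.
apply: filterS2 H1 H2 => w lln [N0 Nm _].
apply: counting_uniform_lln => // e e0.
by have := lln e e0; apply: filterS => k; rewrite N0 subn0.
Qed.

End poisson_law_of_large_numbers.

(** * Enumeration of the positions by rank *)

Section ranking.
Context {R : realType} {m : nat}.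
Variable u : 'I_m.+1 -> R -> R.
Implicit Types (x y z : idx m) (q : idx m -> R) (S : set (idx m)).

Lemma rank_lt_irr x : rank_lt u x x = false.
Proof. by rewrite /rank_lt/lex_lt ltxx !ltnn !andbF. Qed.

Lemma rank_lt_trans y x z : rank_lt u x y -> rank_lt u y z -> rank_lt u x z.
Proof.
rewrite /rank_lt => /orP[xy|/andP[/eqP xy lxy]] /orP[yz|/andP[/eqP yz lyz]].
- by rewrite (lt_trans xy).
- by rewrite -yz xy.
- by rewrite xy yz.
- rewrite xy yz ltxx eqxx/=; move: lxy lyz; rewrite /lex_lt.
  case: x y z {xy yz} => [x1 x2] [y1 y2] [z1 z2]/=.
  move=> /orP[a|/andP[/eqP a b]] /orP[c|/andP[/eqP c e]]; apply/orP.
  + by left; exact: ltn_trans a.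
  + by left; rewrite c.
  + by left; rewrite -a.
  + by right; rewrite c a eqxx/=; exact: ltn_trans b.
Qed.

Lemma rank_lt_total x y : x <> y -> rank_lt u x y \/ rank_lt u y x.
Proof.
case: x y => [x1 x2] [y1 y2] xy; rewrite /rank_lt/lex_lt/=.
case: (ltgtP (Delta u x1 x2.-1) (Delta u y1 y2.-1)) => _ /=; [by left|by right|].
case: (ltngtP x1 y1) => [_|_|E] /=; [by right|by left|].
have e1 : x1 = y1 by exact: val_inj.
rewrite e1 eqxx/=; case: (ltngtP x2 y2) => [_|_|E2]/=; [by right|by left|].
by case: xy; rewrite e1 E2.
Qed.

(** [sigma u q] is [top (drop_set q)] by conversion. *)
Definition top S : idx m :=
  xget (ord0, 1%N) [set x | S x /\ forall y, S y -> y = x \/ rank_lt u y x].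

Hypothesis u_concave : forall i, concave_on [set x : R | 0 <= x] (u i).

(** Concavity at the midpoint [j.+1] of [j] and [j.+2]. *)
Lemma Delta_nonincreasing i j : Delta u i j.+1 <= Delta u i j.
Proof.
have h0 : 0 <= (2^-1 : R) by lra.
have h1 : (2^-1 : R) <= 1 by lra.
have in0 k : (k%:R : R) \in [set x : R | 0 <= x] by rewrite inE/=.
have : - u i (2^-1 * j%:R + (1 - 2^-1) * j.+2%:R) <=
    2^-1 * - u i j%:R + (1 - 2^-1) * - u i j.+2%:R.
  exact: u_concave i (Itv01 h0 h1) _ _ (in0 j) (in0 j.+2).
have -> : 2^-1 * j%:R + (1 - 2^-1) * j.+2%:R = j.+1%:R :> R.
  have e1 : (j.+1%:R : R) = j%:R + 1 by rewrite natr1.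
  have e2 : (j.+2%:R : R) = j%:R + 1 + 1 by rewrite !natr1.
  by rewrite e1 e2; lra.
rewrite /Delta; lra.
Qed.

(** Increments decrease along a class, and a tie favours the smaller index because the lexicographic
    order enters reversed. *)
Lemma rank_lt_class i j k : (0 < j)%N -> (j < k)%N -> rank_lt u (i, k) (i, j).
Proof.
move=> j0 jk; rewrite /rank_lt/lex_lt/= ltnn eqxx jk andbT/=.
suff : Delta u i k.-1 <= Delta u i j.-1 by rewrite andbT le_eqVlt orbC.
have -> : (k.-1 = j.-1 + (k - j))%N by lia.
elim: (k - j)%N => [|n IH]; first by rewrite addn0.
by rewrite addnS; exact: le_trans (Delta_nonincreasing _ _) IH.
Qed.

(** In each class the element of [S] with the smallest second coordinate dominates the others, so
    only finitely many candidates compete. The induction is on the number [n] of classes taken into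
    account. *)
Lemma topP S : S `<=` @Iplus m -> S !=set0 ->
  S (top S) /\ forall y, S y -> y = top S \/ rank_lt u y (top S).
Proof.
move=> SI [x0 Sx0]; rewrite /top; case: xgetP => [x _ []//|H].
suff K n : (exists x, S x /\ (x.1 < n)%N) -> exists x, [/\ S x, (x.1 < n)%N &
    forall y, S y -> (y.1 < n)%N -> y = x \/ rank_lt u y x].
  have [|x [Sx _ xtop]] := K m.+1; first by exists x0; split.
  by exfalso; apply: (H x); split => // y Sy; exact: xtop.
elim: n => [[x []//]|n IH [x [Sx xn]]].
have lift (y : idx m) : (y.1 < n.+1)%N -> (y.1 < n)%N \/ y.1 = n :> nat.
  by rewrite ltnS leq_eqVlt => /orP[/eqP|]; [right|left].
have [[i [E [j Sj]]]|no] := pselect (exists i : 'I_m.+1, i = n :> nat /\ exists j, S (i, j)); last first.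
  have lift' y : S y -> (y.1 < n.+1)%N -> (y.1 < n)%N.
    move=> Sy /lift[//|yn]; exfalso; apply: no; exists y.1; split => //.
    by exists y.2; case: y Sy {yn}.
  have [|z [Sz zn ztop]] := IH; first by exists x; split => //; exact: lift'.
  by exists z; split => //; [exact: leqW|move=> y Sy /(lift' _ Sy); exact: ztop].
have [k Sk kmin] : exists2 k, S (i, k) & forall l, S (i, l) -> (k <= l)%N.
  have ex : exists l, `[< S (i, l) >] by exists j; apply/asboolP.
  exists (ex_minn ex); case: ex_minnP => k /asboolP //.
  by move=> _ kmin l Sl; apply: kmin; apply/asboolP.
have ktop y : S y -> y.1 = n :> nat -> y = (i, k) \/ rank_lt u y (i, k).
  case: y => y1 y2 Sy /= yn; have e1 : y1 = i by apply: val_inj; rewrite /= yn E.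
  rewrite e1 in Sy *; have := kmin _ Sy; rewrite leq_eqVlt => /orP[/eqP->|ky].
    by left.
  by right; apply: rank_lt_class => //; exact: (SI _ Sk).
have [ex|nex] := pselect (exists x, S x /\ (x.1 < n)%N); last first.
  exists (i, k); split => //; first by rewrite /= E.
  move=> y Sy /lift[yn|]; last exact: ktop.
  by exfalso; apply: nex; exists y.
have [z [Sz zn ztop]] := IH ex.
have zi : z <> (i, k) by move=> zi; move: zn; rewrite zi/= E ltnn.
have [zlt|zgt] := rank_lt_total zi.
  exists (i, k); split => //; first by rewrite /= E.
  move=> y Sy /lift[yn|]; last exact: ktop.
  right; have [->//|yz] := ztop _ Sy yn; exact: rank_lt_trans zlt.
exists z; split => //; first exact: leqW.
move=> y Sy /lift[yn|yn]; first exact: ztop.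
right; have [->//|yk] := ktop _ Sy yn; exact: rank_lt_trans zgt.
Qed.

(** Greedy enumeration from the top. If infinitely many positions lie above some [y], then [y] is
    never listed; it is then treated as any other position outside the first [K]. *)
Fixpoint ranked_upto k : seq (idx m) :=
  if k is k'.+1 then
    rcons (ranked_upto k') (top [set x | Iplus x /\ x \notin ranked_upto k'])
  else [::].

Definition ranked k : idx m := top [set x | Iplus x /\ x \notin ranked_upto k].

Lemma ranked_uptoE k : ranked_upto k = [seq ranked l | l <- iota 0 k].
Proof.
elim: k => // k IH.
have -> : iota 0 k.+1 = rcons (iota 0 k) k by rewrite -[k.+1]addn1 iotaD cats1.
by rewrite map_rcons -IH.
Qed.

Lemma ranked_uptoP k x : x \in ranked_upto k <-> exists2 l, (l < k)%N & x = ranked l.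
Proof.
rewrite ranked_uptoE; split.
  by move=> /mapP[l]; rewrite mem_iota/= add0n => lk ->; exists l.
by move=> [l lk ->]; apply/mapP; exists l => //; rewrite mem_iota.
Qed.

Lemma rankedP k : [/\ Iplus (ranked k), ranked k \notin ranked_upto k &
  forall y, Iplus y -> y \notin ranked_upto k -> y = ranked k \/ rank_lt u y (ranked k)].
Proof.
have [||[h1 h2] h3] := @topP [set x | Iplus x /\ x \notin ranked_upto k].
- by move=> x [].
(* A second coordinate larger than all the listed ones yields a fresh position. *)
- pose M := (\max_(y <- ranked_upto k) y.2).+1.
  exists (ord0, M); split => //; apply/negP => h.
  have : (M <= \max_(y <- ranked_upto k) y.2)%N.
    by apply: (@leq_bigmax_seq _ _ xpredT (fun y : idx m => y.2) _ h).
  by rewrite ltnn.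
- by split => // y yI yn; exact: h3.
Qed.

Lemma ranked_lt k l : (l < k)%N -> rank_lt u (ranked k) (ranked l).
Proof.
move=> lk; have [Ik nk _] := rankedP k.
have nl : ranked k \notin ranked_upto l.
  apply/negP => /ranked_uptoP[l' l'l E]; move/negP: nk; apply.
  by apply/ranked_uptoP; exists l' => //; exact: ltn_trans lk.
have [_ _ /(_ _ Ik nl)[E|//]] := rankedP l.
by move/negP: nk; case; apply/ranked_uptoP; exists l.
Qed.

Lemma ranked_inj : injective ranked.
Proof.
move=> k l E; case: (ltngtP k l) => // h; exfalso.
  by have := ranked_lt h; rewrite E rank_lt_irr.
by have := ranked_lt h; rewrite E rank_lt_irr.
Qed.

Lemma ranked_gt k y : Iplus y -> rank_lt u (ranked k) y ->
  exists2 l, (l < k)%N & y = ranked l.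
Proof.
move=> Iy ky; apply/ranked_uptoP; apply: contraT => ny.
have [_ _ /(_ _ Iy ny)[E|lt]] := rankedP k.
  by move: ky; rewrite E rank_lt_irr.
by have := rank_lt_trans ky lt; rewrite rank_lt_irr.
Qed.

Lemma ranked_notin k y : Iplus y -> y \notin ranked_upto k ->
  forall l, (l < k)%N -> rank_lt u y (ranked l).
Proof.
move=> Iy ny l lk; have [_ _ /(_ y Iy)[|E|//]] := rankedP l.
  apply: contra ny => /ranked_uptoP[l' l'l ->].
  by apply/ranked_uptoP; exists l' => //; exact: ltn_trans lk.
by move/negP: ny; case; apply/ranked_uptoP; exists l.
Qed.

(* Within a class, positions are ranked in increasing order. *)
Lemma ranked_upto_closed k i j : (0 < j)%N ->
  (i, j) \notin ranked_upto k -> (i, j.+1) \notin ranked_upto k.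
Proof.
move=> j0; apply: contra => /ranked_uptoP[l lk E].
have [|l' l'l ->] := @ranked_gt l (i, j) j0.
  by rewrite -E; exact: rank_lt_class.
by apply/ranked_uptoP; exists l' => //; exact: ltn_trans lk.
Qed.

Section sigma.
Variables (c : 'I_m.+1 -> R) (q : idx m -> R).
Hypothesis q0 : forall i, q (i, 0%N) = c i.
Hypothesis q_mono : forall i j, q (i, j.+1) <= q (i, j).
Hypothesis q_drop : exists i j, q (i, j) < c i.

Lemma q_mono_le i j k : (j <= k)%N -> q (i, k) <= q (i, j).
Proof.
move=> /subnKC <-; elim: (k - j)%N => [|n IH]; first by rewrite addn0.
by rewrite addnS; exact: le_trans (q_mono _ _) IH.
Qed.

(** Without any drop in class [i], [q (i, j)] would equal [c i] for all [j], against [q_drop];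
    [topP] then supplies the maximum. *)
Lemma sigmaP : drop_set q (sigma u q) /\
  forall y, drop_set q y -> y = sigma u q \/ rank_lt u y (sigma u q).
Proof.
apply: topP; first by move=> x [].
have [i [j ij]] := q_drop.
apply: contrapT => nd; suff : q (i, j) = c i by move=> E; move: ij; rewrite E ltxx.
elim: j {ij} => [|j IH]; first exact: q0.
rewrite -IH; apply/eqP; rewrite eq_le q_mono/= leNgt; apply/negP => h.
by apply: nd; exists (i, j.+1).
Qed.

Lemma sigma_Iplus : Iplus (sigma u q).
Proof. by have [[]] := sigmaP. Qed.

Lemma sigma_lt : q (sigma u q) < c (sigma u q).1.
Proof.
have [[_ h] _] := sigmaP; apply: (lt_le_trans h).
by rewrite -q0; exact: q_mono_le.
Qed.

(** A drop in the class of [y] at or before [y] would rank at least as high as [y], hence above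
    [sigma u q], which is the highest drop. *)
Lemma sigma_above y : Iplus y -> rank_lt u (sigma u q) y -> q y = c y.1.
Proof.
case: y => i j; rewrite /Iplus/= => j0 sy.
have H k : (k <= j)%N -> q (i, k) = c i.
  elim: k => [_|k IH kj]; first exact: q0.
  rewrite -(IH (ltnW kj)); apply/eqP; rewrite eq_le q_mono/= leNgt.
  apply/negP => h; have d : drop_set q (i, k.+1) by [].
  have sk : rank_lt u (sigma u q) (i, k.+1).
    move: kj; rewrite leq_eqVlt => /orP[/eqP->//|kj].
    by apply: (rank_lt_trans sy); exact: rank_lt_class.
  have [_ /(_ _ d)[E|lt]] := sigmaP.
    by move: sk; rewrite E rank_lt_irr.
  by have := rank_lt_trans sk lt; rewrite rank_lt_irr.
exact: H.
Qed.

(** The link between policy and reflection: a task sent outside the first [k] positions finds all of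
    them full. *)
Lemma sigma_notin_full k : sigma u q \notin ranked_upto k ->
  forall l, (l < k)%N -> q (ranked l) = c (ranked l).1.
Proof.
move=> ns l lk; have [Il _ _] := rankedP l.
by apply: sigma_above => //; exact: ranked_notin sigma_Iplus ns _ lk.
Qed.

End sigma.
End ranking.

(** * Comparison of approximate reflected systems *)

Section relaxation.
Context {R : realType}.
Implicit Types (f h : R -> R) (T c e H t : R).

(** Maximum principle for a path relaxing towards [h] at rate [c]. The integral part [Y] is within
    [e] of [f]; while [Y > H + e], one has [f > H >= h], so [Y] cannot increase. The bound depends
    neither on [c] nor on [T], which matters because the rates grow with the level. *)
Lemma relaxation_le T c f h e H : 0 <= c -> 0 <= e ->
  bounded_measurable T f -> bounded_measurable T h ->
  (forall t, 0 <= t <= T ->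
    `|f t - (f 0 - c * cumul (fun s => f s - h s) t)| <= e) ->
  f 0 <= H -> (forall t, 0 <= t <= T -> h t <= H) ->
  forall t, 0 <= t <= T -> f t <= H + 2 * e.
Proof.
move=> c0 e0 bf bh fE f0 hH t tT; have /andP[t0 tT'] := tT.
pose g s := f s - h s.
have bg : bounded_measurable T g by exact: bounded_measurableB.
have [_ [B gB]] := bg.
have B0 : 0 <= B by apply: le_trans (gB 0 _) => //; rewrite lexx (le_trans t0).
pose Y s := f 0 - c * cumul g s.
suff Yt : Y t <= H + e.
  have /ler_normlP[_] := fE t tT; rewrite -/(Y t); lra.
rewrite leNgt; apply/negP => Yt.
have [|s [/andP[s0 st] Pn Pr]] := @last_time R (fun r => Y r <= H + e) t t0.
  by rewrite /Y cumul0; lra.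
have sT : s <= T := le_trans st tT'.
suff : forall d, 0 < d -> Y t <= H + e + c * B * d.
  move=> K; have cB : 0 <= c * B by rewrite mulr_ge0.
  (* Then [c * B * d] is less than the excess [Y t - (H + e)], a contradiction. *)
  pose d := (Y t - (H + e)) / (2 * (c * B + 1)).
  have cB1 : 0 < 2 * (c * B + 1) by rewrite mulr_gt0// ltr_wpDl.
  have d0 : 0 < d by rewrite divr_gt0// subr_gt0.
  have := K d d0.
  have dE : d * (2 * (c * B + 1)) = Y t - (H + e) by rewrite divfK// gt_eqF.
  nra.
move=> d d0; have [r [r0 rs srd Yr]] := Pr d d0.
have h1 : 0 <= cumul g t - cumul g s.
  rewrite -(mul0r (t - s)); apply: (cumul_ge_cst bg) => // z /andP[sz zt].
  have zT : 0 <= z <= T by rewrite (le_trans zt tT') (le_trans s0 (ltW sz)).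
  have := Pn z; rewrite sz zt => /(_ isT)/negP; rewrite -ltNge => Yz.
  have /ler_normlP[a _] := fE z zT; rewrite -/(Y z) in a.
  have := hH z zT; rewrite /g; lra.
have h2 : - B * (s - r) <= cumul g s - cumul g r.
  apply: (cumul_ge_cst bg) => // z /andP[rz zs].
  have zT : 0 <= z <= T by rewrite (le_trans zs sT) (le_trans r0 (ltW rz)).
  by have /ler_normlP[] := gB z zT; lra.
move: Yr; rewrite /Y.
have : c * - (B * d) <= c * (cumul g t - cumul g r).
  apply: ler_wpM2l => //.
  have : B * (s - r) <= B * d by rewrite ler_wpM2l//; lra.
  lra.
rewrite mulrBr mulrN mulrA; lra.
Qed.

Lemma relaxation_bound T c f h e H : 0 <= c -> 0 <= e ->
  bounded_measurable T f -> bounded_measurable T h ->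
  (forall t, 0 <= t <= T ->
    `|f t - (f 0 - c * cumul (fun s => f s - h s) t)| <= e) ->
  `|f 0| <= H -> (forall t, 0 <= t <= T -> `|h t| <= H) ->
  forall t, 0 <= t <= T -> `|f t| <= H + 2 * e.
Proof.
move=> c0 e0 bf bh fE /ler_normlP[f01 f02] hH t tT.
have N x : - x = -1 * x by rewrite mulN1r.
have bN g : bounded_measurable T g -> bounded_measurable T (fun s => - g s).
  by move=> /(bounded_measurableZ (-1)); under eq_fun do rewrite -N.
rewrite ler_norml; apply/andP; split; last first.
  by apply: (relaxation_le c0 e0 bf bh fE f02 _ tT) => s sT; have /ler_normlP[] := hH s sT.
rewrite lerNl.
apply: (relaxation_le c0 e0 (bN _ bf) (bN _ bh) _ f01 _ tT) => s sT.
  rewrite (@eq_cumul _ _ (fun s => -1 * (f s - h s))); last first.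
    by move=> r _; ring.
  rewrite (@cumulZ _ T); [|exact: bounded_measurableB|by case/andP: sT].
  move: (fE s sT); rewrite -normrN; congr (`|_| <= _); ring.
by have /ler_normlP[] := hH s sT.
Qed.

End relaxation.

Lemma ler_sum_ord_widen (R : numDomainType) (F : nat -> R) (k K : nat) :
  (k <= K)%N -> (forall l, 0 <= F l) -> \sum_(l < k) F l <= \sum_(l < K) F l.
Proof.
move=> kK F0; rewrite -(big_mkord xpredT F) -(big_mkord xpredT F).
by rewrite (big_cat_nat _ kK)//= lerDl sumr_ge0.
Qed.

Section approximate_systems.
Context {R : realType} {m : nat}.
Variables (lambda mu T : R) (xs : nat -> idx m) (K L : nat) (eta beta : R).
Implicit Types (q a : R -> idx m -> R) (th : R -> R) (c : nat -> R)
  (x : idx m) (k l : nat) (s t r : R).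

Definition next x : idx m := (x.1, x.2.+1).

Definition dep q x s : R := mu * x.2%:R * (q s x - q s (next x)).

Definition mass k (p : idx m -> R) : R := \sum_(l < k.+1) p (xs l).

Definition overflow a th k t : R := th t - mass k (a t).

(* [a t x] is the mass sent to [x] up to time [t], [th] the total arriving mass
   and [c k] the capacity of the first [k.+1] positions. The law of large numbers
   controls the departure clocks of finitely many positions only, so that
   [approx_eq] is limited to level [L], beyond which [q] is small. *)
Record approx_system c q a th : Prop := ApproxSystem {
  approx_measurable : forall x, measurable_fun `[0, T] (q^~ x);
  approx_eq : forall t x, 0 <= t <= T -> Iplus x -> (x.2 <= L)%N ->
    `|q t x - (q 0 x + a t x - cumul (dep q x) t)| <= eta;
  approx_out : forall t x, 0 <= t <= T -> Iplus x ->
    (forall l, (l < K)%N -> x <> xs l) -> a t x = 0;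
  approx_arrivals : forall t, 0 <= t <= T -> `|th t - lambda * t| <= eta;
  approx_mono : forall x s t, 0 <= s -> s <= t -> t <= T -> a s x <= a t x;
  approx_overflow : forall k s t, (k < K)%N -> 0 <= s -> s <= t -> t <= T ->
    0 <= overflow a th k t - overflow a th k s <= th t - th s;
  approx_reflection : forall k s t, (k < K)%N -> 0 <= s -> s < t -> t <= T ->
    (forall r, s < r <= t -> mass k (q r) < c k) ->
    forall r, s < r <= t -> overflow a th k r = overflow a th k t;
  approx_capacity : forall k t, (k < K)%N -> 0 <= t <= T -> mass k (q t) <= c k;
  approx_01 : forall t x, 0 <= t <= T -> 0 <= q t x <= 1;
  approx_tail : forall t x, 0 <= t <= T -> (L < x.2)%N -> q t x <= beta }.

Lemma massS k p : mass k.+1 p = mass k p + p (xs k.+1).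
Proof. by rewrite /mass big_ord_recr. Qed.

Hypothesis lambda_ge0 : 0 <= lambda.
Hypothesis mu_ge0 : 0 <= mu.
Hypothesis T_ge0 : 0 <= T.
Hypothesis xsI : forall l, Iplus (xs l).
Hypothesis xsL : forall l, (l < K)%N -> ((xs l).2 <= L)%N.
(** A position outside the list exchanges mass only with [next x], again outside: the unlisted
    positions form an autonomous system. *)
Hypothesis xs_closed : forall x, Iplus x ->
  (forall l, (l < K)%N -> x <> xs l) -> forall l, (l < K)%N -> next x <> xs l.

Lemma approx_bounded c q a th x : approx_system c q a th ->
  bounded_measurable T (q^~ x).
Proof.
move=> S; split; first exact: approx_measurable S x.
by exists 1 => t tT; have /andP[h1 h2] := approx_01 S x tT; rewrite ger0_norm.
Qed.

Lemma dep_bounded c q a th x : approx_system c q a th ->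
  bounded_measurable T (dep q x).
Proof.
move=> S; apply: bounded_measurableZ.
by apply: bounded_measurableB; exact: approx_bounded S.
Qed.

Section comparison.
Variables (c c' : nat -> R) (q q' a a' : R -> idx m -> R) (th th' : R -> R).
Hypotheses (S : approx_system c q a th) (S' : approx_system c' q' a' th').
Hypothesis q_init : forall x, Iplus x -> (x.2 <= L)%N -> `|q 0 x - q' 0 x| <= eta.

Let eta_ge0 : 0 <= eta.
Proof.
have T0 : 0 <= (0 : R) <= T by rewrite lexx.
exact: le_trans (normr_ge0 _) (approx_arrivals S T0).
Qed.

Let diff_bounded x : bounded_measurable T (fun s => q s x - q' s x).
Proof.
by apply: bounded_measurableB; [exact: approx_bounded S|exact: approx_bounded S'].
Qed.

(** Descending induction on the level, [n] being the number of steps that lead above [L], where both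
    systems are between 0 and [beta]. The gap at [y] relaxes towards the gap at [next y]; a level
    costs [5 * eta], one [eta] for the initial gap and [2 * (2 * eta)] for the two approximate
    equations. *)
Lemma compare_tail x t : Iplus x -> (forall l, (l < K)%N -> x <> xs l) ->
  0 <= t <= T -> `|q t x - q' t x| <= beta + 5 * L%:R * eta.
Proof.
move=> Ix nx tT.
suff H n y : Iplus y -> (forall l, (l < K)%N -> y <> xs l) -> (L < y.2 + n)%N ->
    forall s, 0 <= s <= T -> `|q s y - q' s y| <= beta + 5 * n%:R * eta.
  by apply: H => //; rewrite -addn1 addnC leq_add2r.
have large z s : (L < z.2)%N -> 0 <= s <= T -> `|q s z - q' s z| <= beta.
  move=> Ly sT; have h1 := approx_tail S sT Ly; have h2 := approx_tail S' sT Ly.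
  have /andP[a1 _] := approx_01 S z sT; have /andP[a2 _] := approx_01 S' z sT.
  by rewrite ler_norml; apply/andP; split; lra.
elim: n y => [|n IH] y Iy ny Ly s sT.
  by rewrite mulr0 mul0r addr0; apply: large => //; rewrite addn0 in Ly.
have [yL|Ly'] := leqP y.2 L; last first.
  apply: le_trans (large _ _ Ly' sT) _; rewrite lerDl.
  by rewrite !mulr_ge0.
have HB : 0 <= 5 * n%:R * eta by rewrite !mulr_ge0.
have b0 : 0 <= beta.
  have := @large (y.1, L.+1) s (ltnSn L) sT; exact: le_trans.
have -> : beta + 5 * n.+1%:R * eta = (beta + 5 * n%:R * eta + eta) + 2 * (2 * eta).
  by rewrite -natr1; ring.
apply: (@relaxation_bound R T (mu * y.2%:R) (fun s => q s y - q' s y)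
   (fun s => q s (next y) - q' s (next y))) sT => //.
- by rewrite mulr_ge0.
- by rewrite mulr_ge0.
- move=> r rT.
  have e1 := approx_eq S rT Iy yL; have e2 := approx_eq S' rT Iy yL.
  rewrite (approx_out S rT Iy ny) addr0 in e1.
  rewrite (approx_out S' rT Iy ny) addr0 in e2.
  have -> : mu * y.2%:R * cumul (fun s => q s y - q' s y - (q s (next y) - q' s (next y))) r
    = cumul (dep q y) r - cumul (dep q' y) r.
    have rT' : r <= T by case/andP: rT.
    rewrite -(@cumulB _ T) //; [|exact: dep_bounded S|exact: dep_bounded S'].
    rewrite -(@cumulZ _ T) //; last by apply: bounded_measurableB.
    by apply: eq_cumul => z _; rewrite /dep; ring.
  have := ler_normB (q r y - (q 0 y - cumul (dep q y) r)) (q' r y - (q' 0 y - cumul (dep q' y) r)).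
  move=> h; have h2 := le_trans h (lerD e1 e2).
  have {h2} : `|q r y - (q 0 y - cumul (dep q y) r) -
      (q' r y - (q' 0 y - cumul (dep q' y) r))| <= 2 * eta by lra.
  by congr (`|_| <= _); ring.
- apply: le_trans (q_init Iy yL) _; lra.
- move=> r rT; apply: (@le_trans _ _ (beta + 5 * n%:R * eta)); last by rewrite lerDl.
  by apply: IH => //; [exact: xs_closed|rewrite /= addSn -addnS].
Qed.

Lemma mass_coordinate_le b t l :
  (forall k, (k < K)%N -> `|mass k (q t) - mass k (q' t)| <= b) ->
  (l < K)%N -> `|q t (xs l) - q' t (xs l)| <= 2 * b.
Proof.
move=> H lK; case: l lK => [|l] lK.
  have := H 0%N lK; rewrite /mass !big_ord1 => h.
  by have := normr_ge0 (q t (xs 0%N) - q' t (xs 0%N)); lra.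
have := H l.+1 lK; have := H l (ltnW lK).
rewrite !massS => /ler_normlP[h1 h2] /ler_normlP[h3 h4].
by rewrite ler_norml; apply/andP; split; lra.
Qed.

Hypothesis c_close : forall k, (k < K)%N -> `|c k - c' k| <= eta.

Let eps := beta + 5 * L%:R * eta.

Let C0 := \sum_(l < K) mu * (xs l).2%:R.

(** Chosen so that [4 * C0 / kappa <= 1 / 2], which is the contraction factor. *)
Let kappa := 8 * C0 + 1.

(** Of [5 * K], four come from the equations of both systems at both ends of a time interval and one
    from the initial states. Of 7, four come from the total arrivals, one from the capacities and
    two from the growth of the overflow around the last time [s]. *)
Let A := (5 * K%:R + 7) * eta + C0 * T * eps.

Let w t := expR (kappa * t).

Let C0_ge0 : 0 <= C0.
Proof. by apply: sumr_ge0 => l _; rewrite mulr_ge0. Qed.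

Let kappa_gt0 : 0 < kappa.
Proof. by rewrite ltr_wpDl// mulr_ge0. Qed.

Let eps_ge0 : 0 <= eps.
Proof.
rewrite addr_ge0// ?mulr_ge0//.
have T0 : 0 <= (0 : R) <= T by rewrite lexx.
have /andP[h _] := approx_01 S (ord0, L.+1) T0.
exact: le_trans h (@approx_tail _ _ _ _ S 0 (ord0, L.+1) T0 (ltnSn L)).
Qed.

(* The weight [w] turns the Gronwall estimate into a contraction by 1/2, which is
   iterated from the trivial bound. *)
Lemma compare_mass_step b : 0 <= b ->
  (forall k t, (k < K)%N -> 0 <= t <= T -> `|mass k (q t) - mass k (q' t)| <= b * w t) ->
  forall k t, (k < K)%N -> 0 <= t <= T ->
    mass k (q t) - mass k (q' t) <= (A + b / 2) * w t.
Proof.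
move=> b0 H k t kK tT; have /andP[t0 tT'] := tT.
have w1 s : 0 <= s -> 1 <= w s.
  by move=> s0; rewrite /w -[X in X <= _]expR0 ler_expR mulr_ge0// ltW.
(* Bounds the difference of two net occupancies: [2 * b * w s] for [xs l], and [2 * b * w s + eps]
   for [next (xs l)], listed or not. *)
pose G s := 4 * b * w s + eps.
have bw : bounded_measurable T w.
  apply: continuous_bounded_measurable; apply: continuous_subspaceT => x.
  have: derivable w x 1 by [].
  by move=> /derivable1_diffP/differentiable_continuous.
have bG : bounded_measurable T G.
  apply: bounded_measurableD; last exact: bounded_measurable_cst.
  exact: bounded_measurableZ.
have cG s r : 0 <= s -> s <= r -> r <= T ->
    cumul G r - cumul G s <= 4 * b * (kappa^-1 * w r) + eps * T.
  move=> s0 sr rT; have r0 := le_trans s0 sr; have sT := le_trans sr rT.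
  have cE z : 0 <= z -> z <= T ->
      cumul G z = 4 * b * (kappa^-1 * (w z - 1)) + eps * z.
    move=> z0 zT; rewrite /G (@cumulD _ T)//; last 2 first.
      exact: bounded_measurableZ.
      exact: bounded_measurable_cst.
    by rewrite (@cumulZ _ T)// cumul_cst// cumul_exp.
  rewrite !cE//.
  have : 0 <= 4 * b * (kappa^-1 * (w s - 1)).
    by rewrite !mulr_ge0// ?invr_ge0 ?subr_ge0 ?w1// ltW.
  have : 0 <= 4 * b * kappa^-1 by rewrite !mulr_ge0// invr_ge0 ltW.
  have : eps * r <= eps * T by rewrite ler_wpM2l.
  have : 0 <= eps * s by rewrite mulr_ge0.
  rewrite !mulrBr; lra.
have coord l s : (l < K)%N -> 0 <= s <= T -> `|q s (xs l) - q' s (xs l)| <= 2 * (b * w s).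
  by move=> lK sT; apply: mass_coordinate_le => // k' k'K; exact: H.
have coord' l s : (l < K)%N -> 0 <= s <= T ->
    `|q s (next (xs l)) - q' s (next (xs l))| <= 2 * (b * w s) + eps.
  move=> lK sT; have [[l' l'K ->]|nF] := pselect (exists2 l', (l' < K)%N & next (xs l) = xs l').
    by apply: le_trans (coord _ _ l'K sT) _; rewrite lerDl.
  have ws := w1 s; have s0 : 0 <= s by case/andP: sT.
  apply: le_trans (compare_tail _ _ sT) _ => //.
  - by move=> l' l'K E; apply: nF; exists l'.
  - by rewrite lerDr !mulr_ge0// expR_ge0.
have depdiff l r s : (l < K)%N -> 0 <= r -> r <= s -> s <= T ->
   `|(cumul (dep q (xs l)) s - cumul (dep q (xs l)) r) -
     (cumul (dep q' (xs l)) s - cumul (dep q' (xs l)) r)| <=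
   mu * (xs l).2%:R * (4 * b * (kappa^-1 * w s) + eps * T).
  move=> lK r0 rs sT; have rT := le_trans rs sT.
  have bd := bounded_measurableB (dep_bounded (xs l) S) (dep_bounded (xs l) S').
  have mj0 : 0 <= mu * (xs l).2%:R by rewrite mulr_ge0.
  have -> : cumul (dep q (xs l)) s - cumul (dep q (xs l)) r -
      (cumul (dep q' (xs l)) s - cumul (dep q' (xs l)) r) =
      cumul (fun z => dep q (xs l) z - dep q' (xs l) z) s -
      cumul (fun z => dep q (xs l) z - dep q' (xs l) z) r.
    rewrite !(@cumulB _ T)//; try exact: dep_bounded S; try exact: dep_bounded S'.
    ring.
  apply: le_trans (ler_wpM2l mj0 (cG r s r0 rs sT)).
  rewrite mulrBr -!(@cumulZ _ T)//.
  apply: (cumul_norm_le bd _ r0 rs sT); first exact: bounded_measurableZ.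
  move=> z /andP[rz zs]; have zT : 0 <= z <= T.
    by rewrite (le_trans r0 (ltW rz)) (le_trans zs sT).
  rewrite /dep -mulrBr normrM ger0_norm// ler_wpM2l// /G.
  have -> : q z (xs l) - q z (next (xs l)) - (q' z (xs l) - q' z (next (xs l))) =
     (q z (xs l) - q' z (xs l)) - (q z (next (xs l)) - q' z (next (xs l))) by ring.
  apply: le_trans (ler_normB _ _) _.
  have c1 := coord l z lK zT; have c2 := coord' l z lK zT; lra.
have th1 := approx_arrivals S; have th2 := approx_arrivals S'.
have incr r : 0 <= r -> r <= t ->
   (mass k (q t) - mass k (q' t)) - (mass k (q r) - mass k (q' r)) <=
   4 * K%:R * eta + C0 * (4 * b * (kappa^-1 * w t) + eps * T) + 4 * eta
   - (overflow a th k t - overflow a th k r)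
   + (overflow a' th' k t - overflow a' th' k r).
  move=> r0 rt; have rT : 0 <= r <= T by rewrite r0 (le_trans rt).
  (* With the arrivals removed only departures move [d]; the arrivals come back through the totals
     and the overflows. *)
  pose d s l := (q s (xs l) - a s (xs l)) - (q' s (xs l) - a' s (xs l)).
  have massE s : mass k (q s) - mass k (q' s) =
     \sum_(l < k.+1) d s l + (th s - th' s) - overflow a th k s + overflow a' th' k s.
    by rewrite /d /overflow /mass !sumrB; ring.
  have dE l : (l < K)%N -> d t l - d r l <=
      4 * eta + mu * (xs l).2%:R * (4 * b * (kappa^-1 * w t) + eps * T).
    move=> lK; have Ll := xsL lK; have Il := xsI l.
    have /ler_normlP[a1 a2] := approx_eq S tT Il Ll.
    have /ler_normlP[b1 b2] := approx_eq S rT Il Ll.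
    have /ler_normlP[c1 c2] := approx_eq S' tT Il Ll.
    have /ler_normlP[d1 d2] := approx_eq S' rT Il Ll.
    have /ler_normlP[e1 e2] := depdiff l r t lK r0 rt tT'.
    by rewrite /d; lra.
  have sumd : \sum_(l < k.+1) d t l - \sum_(l < k.+1) d r l <=
     4 * K%:R * eta + C0 * (4 * b * (kappa^-1 * w t) + eps * T).
    rewrite -sumrB.
    apply: (@le_trans _ _ (\sum_(l < k.+1) (4 * eta + mu * (xs l).2%:R * (4 * b * (kappa^-1 * w t) + eps * T)))).
      by apply: ler_sum => l _; apply: dE; exact: leq_trans (ltn_ord l) kK.
    have Z : 0 <= 4 * b * (kappa^-1 * w t) + eps * T.
      rewrite addr_ge0 ?mulr_ge0// ?invr_ge0 ?expR_ge0//; exact: ltW.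
    rewrite /C0 mulr_suml.
    have -> : 4 * K%:R * eta = \sum_(l < K) 4 * eta.
      by rewrite big_const_ord iter_addr addr0 -mulr_natl; ring.
    rewrite -big_split/=.
    pose F l := 4 * eta + mu * (xs l).2%:R * (4 * b * (kappa^-1 * w t) + eps * T).
    apply: (@ler_sum_ord_widen R F _ _ kK) => l.
    by rewrite addr_ge0// ?mulr_ge0.
  rewrite !massE.
  have /ler_normlP[a1 a2] := th1 _ tT; have /ler_normlP[b1 b2] := th1 _ rT.
  have /ler_normlP[c1 c2] := th2 _ tT; have /ler_normlP[d1 d2] := th2 _ rT.
  lra.
have init0 : mass k (q 0) - mass k (q' 0) <= (K%:R + 1) * eta.
  rewrite /mass -sumrB.
  apply: (@le_trans _ _ (\sum_(l < k.+1) eta)).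
    apply: ler_sum => l _; have lK : (l < K)%N := leq_trans (ltn_ord l) kK.
    by have /ler_normlP[] := q_init (xsI l) (xsL lK).
  rewrite big_const_ord iter_addr addr0 -[eta *+ _]mulr_natl ler_wpM2r//.
  by rewrite (@le_trans _ _ K%:R)// ?ler_nat// lerDl.
have bound : mass k (q t) - mass k (q' t) <=
   (5 * K%:R + 7) * eta + C0 * (4 * b * (kappa^-1 * w t) + eps * T).
  have tot0 : 0 <= C0 * (4 * b * (kappa^-1 * w t) + eps * T).
    by rewrite mulr_ge0// addr_ge0 ?mulr_ge0// ?invr_ge0 ?expR_ge0//; exact: ltW.
  (* After the last time at which [P] holds, [q'] is below capacity, hence does
     not overflow. *)
  pose P s := mass k (q s) - mass k (q' s) <= (K%:R + 1) * eta.
  have [s [/andP[s0 st] Pn Pr]] := @last_time R P t t0 init0.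
  apply/ler_addgt0Pr => e e0.
  pose d := e / (2 * (lambda + 1)).
  have l1 : 0 < 2 * (lambda + 1) by rewrite mulr_gt0// ltr_wpDl.
  have d0 : 0 < d by rewrite divr_gt0.
  have dE : d * (2 * (lambda + 1)) = e by rewrite divfK// gt_eqF.
  have [r [r0 rs srd Prr]] := Pr d d0; have rt := le_trans rs st.
  (* Below capacity is known only strictly after [s], so the overflow is frozen from [z] on. Between
     [r] and [z] it grows at most like the arrivals, that is by [2 * lambda * d] up to [2 * eta]. *)
  pose z := Num.min t (s + d).
  have sz : s <= z by rewrite le_min st lerDl ltW.
  have zt : z <= t by rewrite ge_min lexx.
  have zsd : z <= s + d by rewrite ge_min lexx orbT.
  have rz := le_trans rs sz.
  have ovz : overflow a' th' k t = overflow a' th' k z.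
    have [->//|zt'] := eqVneq z t.
    have sz' : s < z.
      suff -> : z = s + d by rewrite ltrDl.
      by move: zt'; rewrite /z minElt; case: ifP; rewrite ?eqxx.
    apply/esym; apply: (approx_reflection S' kK s0 (lt_le_trans sz' zt) tT').
      move=> y /andP[sy yt]; have yT : 0 <= y <= T.
        by rewrite (le_trans s0 (ltW sy)) (le_trans yt).
      have := Pn y; rewrite sy yt => /(_ isT)/negP; rewrite -ltNge => Py.
      have c1 := approx_capacity S kK yT.
      have /ler_normlP[c2 c3] := c_close kK.
      have : 0 <= K%:R * eta by rewrite mulr_ge0.
      lra.
    by rewrite sz'.
  have zT : 0 <= z <= T by rewrite (le_trans s0 sz) (le_trans zt).
  have rT : 0 <= r <= T by rewrite r0 (le_trans rt).
  have /andP[_ ov1] := approx_overflow S' kK r0 rz (le_trans zt tT').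
  have /andP[ov2 _] := approx_overflow S kK r0 rt tT'.
  have /ler_normlP[c1 c2] := th2 _ zT; have /ler_normlP[d1 d2] := th2 _ rT.
  have := incr r r0 rt; rewrite ovz.
  have lz : lambda * z - lambda * r <= lambda * (2 * d).
    by rewrite -mulrBr ler_wpM2l//; lra.
  move: Prr; rewrite /P; nra.
apply: (le_trans bound).
have w1t := w1 t t0.
have h1 : C0 * (4 * b * (kappa^-1 * w t)) <= b / 2 * w t.
  have -> : C0 * (4 * b * (kappa^-1 * w t)) = (4 * C0 / kappa) * (b * w t) by ring.
  have -> : b / 2 * w t = 2^-1 * (b * w t) by ring.
  apply: ler_wpM2r; first by rewrite mulr_ge0// expR_ge0.
  rewrite ler_pdivrMr// /kappa; lra.
have A0 : 0 <= A by rewrite addr_ge0 ?mulr_ge0// addr_ge0// mulr_ge0.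
have : A <= A * w t by rewrite ler_peMr.
rewrite {1}/A; lra.
Qed.

End comparison.

(** The map sending [b] to [A + b / 2] has fixed point [2 * A], reached by iteration from the
    trivial bound [K]. A listed coordinate is a difference of two masses, whence the factor 4; the
    other coordinates fall under [compare_tail]. *)
Lemma compare_systems c c' q q' a a' th th' :
  approx_system c q a th -> approx_system c' q' a' th' ->
  (forall x, Iplus x -> (x.2 <= L)%N -> `|q 0 x - q' 0 x| <= eta) ->
  (forall k, (k < K)%N -> `|c k - c' k| <= eta) ->
  let C0 := \sum_(l < K) mu * (xs l).2%:R in
  let eps := beta + 5 * L%:R * eta in
  forall t x, 0 <= t <= T -> Iplus x ->
  `|q t x - q' t x| <=
    4 * ((5 * K%:R + 7) * eta + C0 * T * eps) * expR ((8 * C0 + 1) * T) + eps.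
Proof.
move=> S S' q_init c_close C0 eps.
pose A := (5 * K%:R + 7) * eta + C0 * T * eps.
pose w t := expR ((8 * C0 + 1) * t).
have T0 : 0 <= (0 : R) <= T by rewrite lexx.
have eta0 : 0 <= eta by exact: le_trans (normr_ge0 _) (approx_arrivals S T0).
have beta0 : 0 <= beta.
  have /andP[h _] := approx_01 S (ord0, L.+1) T0.
  exact: le_trans h (@approx_tail _ _ _ _ S 0 (ord0, L.+1) T0 (ltnSn L)).
have eps0 : 0 <= eps by rewrite addr_ge0// !mulr_ge0.
have C00 : 0 <= C0 by apply: sumr_ge0 => l _; rewrite mulr_ge0.
have A0 : 0 <= A by rewrite addr_ge0 ?mulr_ge0// addr_ge0// mulr_ge0.
have w1 s : 0 <= s -> 1 <= w s.
  move=> s0; rewrite /w -[X in X <= _]expR0 ler_expR mulr_ge0//.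
  by rewrite addr_ge0// mulr_ge0.
have q_init' x : Iplus x -> (x.2 <= L)%N -> `|q' 0 x - q 0 x| <= eta.
  by move=> Ix xL; rewrite distrC q_init.
have c_close' k : (k < K)%N -> `|c' k - c k| <= eta.
  by move=> kK; rewrite distrC c_close.
have step n k t : (k < K)%N -> 0 <= t <= T ->
    `|mass k (q t) - mass k (q' t)| <= (2 * A + K%:R / 2 ^+ n) * w t.
  elim: n k t => [|n IH] k t kK tT.
    have t0 : 0 <= t by case/andP: tT.
    apply: (@le_trans _ _ K%:R).
      rewrite /mass -sumrB; apply: le_trans (ler_norm_sum _ _ _) _.
      apply: (@le_trans _ _ (\sum_(l < k.+1) 1)).
        apply: ler_sum => l _.
        have /andP[a1 a2] := approx_01 S (xs l) tT.
        have /andP[b1 b2] := approx_01 S' (xs l) tT.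
        by rewrite ler_norml; apply/andP; split; lra.
      by rewrite big_const_ord iter_addr addr0 ler_nat.
    rewrite expr0 divr1; apply: (@le_trans _ _ (2 * A + K%:R)).
      by rewrite lerDr mulr_ge0.
    by rewrite ler_peMr ?w1// addr_ge0// mulr_ge0.
  have b0 : 0 <= 2 * A + K%:R / 2 ^+ n.
    by rewrite addr_ge0 ?mulr_ge0// invr_ge0 exprn_ge0.
  have -> : 2 * A + K%:R / 2 ^+ n.+1 = A + (2 * A + K%:R / 2 ^+ n) / 2.
    by rewrite exprS; field; rewrite expf_neq0.
  rewrite ler_norml; apply/andP; split; last first.
    exact: compare_mass_step S S' q_init c_close _ b0 IH k t kK tT.
  rewrite lerNl opprB.
  apply: compare_mass_step S' S q_init' c_close' _ b0 _ k t kK tT.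
  by move=> k' t' k'K t'T; rewrite distrC; exact: IH.
have lim k t : (k < K)%N -> 0 <= t <= T ->
    `|mass k (q t) - mass k (q' t)| <= 2 * A * w t.
  move=> kK tT; have t0 : 0 <= t by case/andP: tT.
  have wt : 0 < w t by exact: expR_gt0.
  rewrite -ler_pdivrMr//; apply/ler_addgt0Pr => e e0.
  rewrite ler_pdivrMr//.
  have K1 : 0 < K%:R + 1 :> R by rewrite ltr_wpDl.
  have [n nle] : exists n, K%:R / 2 ^+ n <= e.
    exists (Num.truncn (K%:R / e)).+1.
    set n := (Num.truncn _).+1.
    rewrite ler_pdivrMr ?exprn_gt0// -ler_pdivrMl// mulrC.
    apply: (@le_trans _ _ n%:R); first by apply/ltW; exact: truncnS_gt.
    by rewrite -natrX ler_nat ltnW// ltn_expl.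
  apply: le_trans (step n k t kK tT) _.
  by rewrite ler_wpM2r ?(ltW wt)// lerD2l.
move=> t x tT Ix; have /andP[t0 tT'] := tT.
have wT : w t <= w T by rewrite ler_expR ler_wpM2l// addr_ge0// mulr_ge0.
have [[l lK ->]|nF] := pselect (exists2 l, (l < K)%N & x = xs l).
  apply: le_trans (mass_coordinate_le _ lK) _; first by move=> k kK; exact: lim.
  have : 2 * A * w t <= 2 * A * w T by rewrite ler_wpM2l// mulr_ge0.
  rewrite -/A -/(w T); lra.
apply: le_trans (compare_tail S S' q_init Ix _ tT) _.
  by move=> l lK E; apply: nF; exists l.
rewrite lerDr !mulr_ge0//; exact: expR_ge0.
Qed.

End approximate_systems.

From mathcomp Require Import finmap.

(** * Tails in l1 *)

Section l1.
Context {R : realType} {m : nat}.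
Implicit Types (p : idx m -> R) (f : R -> idx m -> R) (x : idx m) (L : nat).

Definition l1tail L p : \bar R :=
  \esum_(x in [set x : idx m | (L < x.2)%N]) `|p x|%:E.

Lemma l1norm_ge0 p : (0 <= l1norm p)%E.
Proof. exact: esum_ge0. Qed.

Lemma l1norm_coord p x : (`|p x|%:E <= l1norm p)%E.
Proof.
rewrite -(@esum_set1 R _ x (fun x => `|p x|%:E))//.
apply: ereal_sup_le => _ [A [fA sA] <-].
by exists A.
Qed.

Lemma l1norm_split L p :
  (l1norm p = \esum_(x in [set x : idx m | (x.2 <= L)%N]) `|p x|%:E + l1tail L p)%E.
Proof.
rewrite /l1norm (esumID [set x : idx m | (x.2 <= L)%N])//; congr (_ + _)%E.
  by rewrite setTI.
by rewrite setTI /l1tail; congr esum; apply/seteqP; split => x /=;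
  rewrite ltnNge => /negP.
Qed.

Lemma finite_set_level L : finite_set [set x : idx m | (x.2 <= L)%N].
Proof.
apply: (@sub_finite_set _ _ ([set: 'I_m.+1] `*` `I_L.+1)).
  by move=> x /= xL; split.
by apply: finite_setX; [exact: finite_finset|exact: finite_II].
Qed.

(** Only finitely many positions have level at most [L], and [C] is their number. Convergence in l1
    thus reduces to uniform convergence of coordinates and control of tails. *)
Lemma l1norm_le L : exists2 C : R, 0 <= C & forall p e, 0 <= e ->
  (forall x, (x.2 <= L)%N -> `|p x| <= e) ->
  (l1norm p <= (C * e)%:E + l1tail L p)%E.
Proof.
have F := finite_set_level L.
exists (size (fset_set [set x : idx m | (x.2 <= L)%N]))%:R => // p e e0 pe.
rewrite (l1norm_split L) leeD2r//.
apply: (@le_trans _ _ (\esum_(x in [set x : idx m | (x.2 <= L)%N]) e%:E)%E).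
  by apply: le_esum => x /= xL; rewrite lee_fin pe.
rewrite esum_fset// fsbig_finite//= sumEFin lee_fin.
by rewrite big_const_seq count_predT iter_addr addr0 mulr_natl.
Qed.

Lemma l1tail_cvg p e : ell1 p -> 0 < e ->
  exists L0, forall L, (L0 <= L)%N -> (l1tail L p <= e%:E)%E.
Proof.
rewrite /ell1/summable/= => sp e0.
have fp : l1norm p \is a fin_num by rewrite ge0_fin_numE// l1norm_ge0.
have [_ [A [fA _] <-] h] := ub_ereal_sup_adherent e0 fp.
pose L0 := (\max_(x <- fset_set A) x.2)%N.
exists L0 => L L0L.
have AL : A `<=` [set x : idx m | (x.2 <= L)%N].
  move=> x Ax /=; apply: leq_trans L0L.
  apply: (@leq_bigmax_seq _ _ xpredT (fun y : idx m => y.2) x) => //.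
  by rewrite in_fset_set//; exact: mem_set.
have hA : (\sum_(x \in A) `|p x|%:E <= \esum_(x in [set x : idx m | (x.2 <= L)%N]) `|p x|%:E)%E.
  by apply: ereal_sup_ubound; exists A.
have {}h : (l1norm p - e%:E < \esum_(x in [set x : idx m | (x.2 <= L)%N]) `|p x|%:E)%E.
  exact: lt_le_trans h hA.
move: fp h; rewrite (l1norm_split L) fin_numD => /andP[f1 f2].
move: f1 f2 {hA}.
case: (\esum_(x in _) _) => [a| |]//; case: (l1tail L p) => [b| |]// _ _.
by rewrite !lte_fin lee_fin; lra.
Qed.

Lemma l1tail_le L p p' : (forall x, (L < x.2)%N -> `|p x| <= `|p' x|) ->
  (l1tail L p <= l1tail L p')%E.
Proof. by move=> pp'; apply: le_esum => x /= Lx; rewrite lee_fin pp'. Qed.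

Lemma l1tailD L p p' : (l1tail L (p \+ p')%R <= l1tail L p + l1tail L p')%E.
Proof.
rewrite /l1tail -esumD//; apply: le_esum => x _.
by rewrite -EFinD lee_fin ler_normD.
Qed.

Lemma l1tail_norm L p : (l1tail L p <= l1norm p)%E.
Proof. by rewrite (l1norm_split L) leeDr// esum_ge0. Qed.

Lemma ell1_vanish p i e : ell1 p -> 0 < e -> exists j, `|p (i, j)| < e.
Proof.
move=> p1 e0; have e2 : 0 < e / 2 by rewrite divr_gt0.
have [L0 /(_ _ (leqnn _)) h] := l1tail_cvg p1 e2.
exists L0.+1; rewrite -lte_fin; apply: (@le_lt_trans _ _ (e / 2)%:E); last first.
  by rewrite lte_fin; lra.
apply: le_trans h.
rewrite -(@esum_set1 R _ (i, L0.+1) (fun x => `|p x|%:E))//.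
apply: ereal_sup_le => _ [A [fA sA] <-].
exists A => //; split => //.
by move=> x /sA /= ->/=.
Qed.

Lemma l1_cvg_coord f (l : idx m -> R) (F : set_system R) {FF : Filter F} :
  l1norm (f s \- l)%R @[s --> F] --> 0%E ->
  forall x, f s x @[s --> F] --> l x.
Proof.
move=> h x; apply/cvgrPdist_lt => e e0.
have : \forall s \near F, (l1norm (f s \- l)%R < e%:E)%E.
  exact: h (@nbhs_open_ereal_lt R 0 (fun=> e) e0).
apply: filterS => s; rewrite -lte_fin distrC; apply: le_lt_trans.
exact: (l1norm_coord (f s \- l) x).
Qed.

Lemma l1_cvg0 (I : Type) (f : I -> idx m -> R) (F : set_system I) {FF : Filter F} :
  (forall e : R, 0 < e -> \forall s \near F, (l1norm (f s) <= e%:E)%E) ->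
  l1norm (f s) @[s --> F] --> 0%E.
Proof.
move=> H; have fin e s : (l1norm (f s) <= e%:E)%E -> l1norm (f s) \is a fin_num.
  by move=> le; rewrite ge0_fin_numE ?l1norm_ge0//; exact: le_lt_trans le (ltry _).
apply/fine_cvgP; split; first by apply: filterS (H 1 ltr01) => s; exact: fin.
apply/cvgrPdist_le => e e0; apply: filterS (H e e0) => s /= le.
have := fin _ _ le; have := l1norm_ge0 (f s); move: le.
case: (l1norm (f s)) => [r| |]//=; rewrite !lee_fin => re r0 _.
by rewrite sub0r normrN ger0_norm.
Qed.

End l1.

(** Sampling [f] at the first point of the grid of mesh [1 / n.+1] strictly to the right of [t]
    gives step functions, which converge to [f t] by right continuity. *)
Lemma right_continuous_measurable (R : realType) (f : R -> R) (T : R) :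
  (forall t, 0 <= t -> f s @[s --> t^'+] --> f t) ->
  measurable_fun `[0, T] f.
Proof.
move=> rc.
pose h (n : nat) (t : R) := f (((Num.truncn (n.+1%:R * t)).+1)%:R / n.+1%:R).
apply: (@measurable_fun_cvg _ _ _ _ h).
  move=> n _ Y mY.
  have -> : `[0, T] `&` h n @^-1` Y = `[0, T] `&`
    \bigcup_(j in [set j : nat | Y (f (j.+1%:R / n.+1%:R))])
      `[j%:R / n.+1%:R, j.+1%:R / n.+1%:R[%classic.
    apply/seteqP; split => t /= [t0T].
      rewrite /h => Yt; split => //; move: t0T; rewrite in_itv/= => /andP[t0 tT].
      exists (Num.truncn (n.+1%:R * t)) => //=; rewrite in_itv/=.
      rewrite ler_pdivrMr// ltr_pdivlMr// (mulrC t).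
      by apply: truncn_itv; rewrite mulr_ge0.
    move=> [j Yj] /=; rewrite in_itv/= ler_pdivrMr// ltr_pdivlMr// (mulrC t) => jt.
    by split => //; rewrite /h (truncn_def jt).
  apply: measurableI => //; apply: bigcup_measurable => j _; exact: measurable_itv.
move=> t /=; rewrite in_itv/= => /andP[t0 tT].
have := rc t t0 => /cvgrPdist_le fc; apply/cvgrPdist_le => e e0.
have := fc e e0; rewrite /at_right near_withinE => /nbhs_ballP[d /= d0 H].
near=> n; rewrite /h.
have nt0 : 0 <= n.+1%:R * t by rewrite mulr_ge0.
have /andP[h1 h2] := truncn_itv nt0.
set k := Num.truncn _ in h1 h2 *.
have tk : t < k.+1%:R / n.+1%:R by rewrite ltr_pdivlMr// mulrC.
apply: H => //; rewrite /ball/= distrC gtr0_norm ?subr_gt0//.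
have : k.+1%:R / n.+1%:R <= t + n.+1%:R^-1 :> R.
  by rewrite ler_pdivrMr// mulrDl mulVf// -natr1 lerD2r mulrC.
rewrite ltrBlDl => /le_lt_trans; apply; rewrite ltrD2l.
by near: n; exact: near_infty_natSinv_lt (PosNum d0).
Unshelve. all: by end_near. Qed.

(** * Prelimit systems *)

Section occupancy_process.
Context {R : realType} {m : nat}.
Variables (lambda mu : R) (u : 'I_m.+1 -> R -> R) (n : nat) (A : 'I_m.+1 -> nat)
  (N : R -> nat) (Nd : idx m -> R -> nat) (q : R -> idx m -> R).
Hypothesis u_concave : forall i, concave_on [set x : R | 0 <= x] (u i).
Hypothesis lambda_gt0 : 0 < lambda.
Hypothesis mu_ge0 : 0 <= mu.
Hypothesis n_gt0 : (0 < n)%N.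
Hypothesis A_ge1 : forall i, (1 <= A i)%N.
Hypothesis A_sum : (\sum_i A i)%N = n.
Hypothesis N0 : N 0 = 0%N.
Hypothesis N_mono : forall s t, 0 <= s -> s <= t -> (N s <= N t)%N.
Hypothesis N_right : \forall s \near 0^'+, N s = N 0.
Hypothesis sol : occupancy_solution lambda mu u n A N Nd q.
Implicit Types (x : idx m) (t s r : R) (k l j : nat).

Let alphan (i : 'I_m.+1) : R := (A i)%:R / n%:R.

Let Nn s := N (n%:R * lambda * s).

Definition arrival_rate_path s : R := n%:R^-1 * (Nn s)%:R.

Let theta := arrival_rate_path.

Let tau k := jump_time Nn k.

Let sg k := sigma u (left_limit q (tau k)).

Let nR_gt0 : 0 < n%:R :> R.
Proof. by rewrite ltr0n. Qed.

Let nl_gt0 : 0 < n%:R * lambda.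
Proof. exact: mulr_gt0. Qed.

Lemma occupancy_state t : 0 <= t -> Qn n A (q t).
Proof. by have [_ + _] := sol; exact. Qed.

Let alphan_gt0 i : 0 < alphan i.
Proof. by rewrite divr_gt0// ltr0n. Qed.

Let alphan_le1 i : alphan i <= 1.
Proof.
rewrite ler_pdivrMr// mul1r ler_nat -A_sum (bigD1 i)//=.
exact: leq_addr.
Qed.

Lemma occupancy_ge0 t x : 0 <= t -> 0 <= q t x.
Proof.
move=> /occupancy_state[_ /(_ x)[k E] _ _].
by rewrite -(pmulr_rge0 _ nR_gt0) E.
Qed.

Lemma occupancy_le_capacity t x : 0 <= t -> q t x <= (A x.1)%:R / n%:R.
Proof.
case: x => i [|j] /occupancy_state[_ _ H1 H2]/=; rewrite -H2//.
by have /andP[] := H1 i j.+1; have /andP[] := H1 i j.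
Qed.

Lemma occupancy_discrete s t x : 0 <= s -> 0 <= t ->
  `|q s x - q t x| < n%:R^-1 -> q s x = q t x.
Proof.
move=> /occupancy_state[_ /(_ x)[k Ek] _ _] /occupancy_state[_ /(_ x)[l El] _ _].
rewrite -(ltr_pM2l nR_gt0) mulfV ?gt_eqF// -[X in X * _](gtr0_norm nR_gt0).
rewrite -normrM mulrBr Ek El => kl.
apply: (mulfI (lt0r_neq0 nR_gt0)); rewrite Ek El; congr (_%:R).
move: kl; rewrite ltr_norml => /andP[k1 k2].
have : (k%:R : R) < l.+1%:R by rewrite -natr1; lra.
have : (l%:R : R) < k.+1%:R by rewrite -natr1; lra.
rewrite !ltr_nat; lia.
Qed.

Let Nn_mono s t : 0 <= s -> s <= t -> (Nn s <= Nn t)%N.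
Proof.
move=> s0 st; apply: N_mono; first by rewrite mulr_ge0// ltW.
by rewrite ler_pM2l.
Qed.

Let jump_lbound k : has_lbound [set t | 0 <= t /\ (k <= Nn t)%N].
Proof. by exists 0 => t []. Qed.

Let jump_time_le t k : 0 <= t -> (k <= Nn t)%N -> tau k <= t.
Proof. by move=> t0 kt; apply: ge_inf. Qed.

Let jump_time_ge r t k : 0 <= r -> (Nn r < k)%N -> 0 <= t -> (k <= Nn t)%N ->
  r <= tau k.
Proof.
move=> r0 rk t0 kt; apply: lb_le_inf; first by exists t.
move=> s [s0 ks]; rewrite leNgt; apply/negP => sr.
by have := Nn_mono s0 (ltW sr); lia.
Qed.

(** Right continuity of the clock at 0 keeps the jumps away from time 0, so there is room for a left
    limit. *)
Let jump_time_gt0 t k : (0 < k)%N -> 0 <= t -> (k <= Nn t)%N -> 0 < tau k.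
Proof.
move=> k0 t0 kt.
have := N_right; rewrite /at_right near_withinE => /nbhs_ballP[h /= h0 H].
pose r := h / (2 * (n%:R * lambda)).
have r0 : 0 < r by rewrite divr_gt0// mulr_gt0.
have rE : n%:R * lambda * r = h / 2 by rewrite /r; field; rewrite !gt_eqF.
apply: (lt_le_trans r0); apply: (jump_time_ge (ltW r0) _ t0 kt).
have h2 : 0 < h / 2 by rewrite divr_gt0.
rewrite /Nn rE H//; first by rewrite N0.
by rewrite /ball/= sub0r normrN gtr0_norm//; lra.
Qed.

(** Coordinates lie in a lattice of mesh [1 / n], so a left limit is attained just before [t]:
    statements about left limits become statements about actual states. *)
Lemma occupancy_left_limit t x : 0 < t ->
  \forall r \near t^'-, q r x = left_limit q t x.
Proof.
move=> t0; have [[_ _ /(_ t t0)[p _ qp]] _ _] := sol.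
have cx0 := @l1_cvg_coord _ _ q p _ _ qp x.
have /cvgrPdist_lt cx : q s x @[s --> t^'-] --> p x by exact: cx0.
have n2 : 0 < n%:R^-1 / 2 :> R by rewrite divr_gt0// invr_gt0.
have : \forall r \near t^'-, `|p x - q r x| < n%:R^-1 / 2 /\ 0 <= r.
  near=> r; split; first by near: r; exact: cx.
  near: r; apply: nbhs_left_ge => //.
move=> H; have [r0 [pr0 r00]] : exists r0, `|p x - q r0 x| < n%:R^-1 / 2 /\ 0 <= r0.
  by near t^'- => r0; exists r0; near: r0; exact: H.
have eqr : \forall r \near t^'-, q r x = q r0 x.
  apply: filterS H => r [pr r_0]; apply: occupancy_discrete => //.
  have -> : q r x - q r0 x = (p x - q r0 x) - (p x - q r x) by ring.
  apply: le_lt_trans (ler_normB _ _) _; lra.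
suff -> : left_limit q t x = q r0 x by [].
apply: cvg_lim => //; exact: cvg_near_cst.
Unshelve. all: by end_near. Qed.

Lemma occupancy_left_limits t k : 0 < t ->
  \forall r \near t^'-, forall l, (l < k)%N -> q r (ranked u l) = left_limit q t (ranked u l).
Proof.
move=> t0; elim: k => [|k IH]; first by apply: nearW.
apply: filterS2 IH (occupancy_left_limit (ranked u k) t0) => r H1 H2 l.
by rewrite ltnS leq_eqVlt => /orP[/eqP->//|]; exact: H1.
Qed.

Let left_limit_start t i : 0 < t -> left_limit q t (i, 0%N) = alphan i.
Proof.
move=> t0; near t^'- => r.
have <- : q r (i, 0%N) = left_limit q t (i, 0%N).
  by near: r; exact: occupancy_left_limit.
have /occupancy_state[_ _ _] : 0 <= r by near: r; exact: nbhs_left_ge.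
exact.
Unshelve. all: by end_near. Qed.

Let left_limit_mono t i j : 0 < t ->
  left_limit q t (i, j.+1) <= left_limit q t (i, j).
Proof.
move=> t0; near t^'- => r.
have <- : q r (i, j) = left_limit q t (i, j).
  by near: r; exact: occupancy_left_limit.
have <- : q r (i, j.+1) = left_limit q t (i, j.+1).
  by near: r; exact: occupancy_left_limit.
have /occupancy_state[_ _ H _] : 0 <= r by near: r; exact: nbhs_left_ge.
by have /andP[] := H i j.
Unshelve. all: by end_near. Qed.

Let left_limit_drop t : 0 < t -> exists i j, left_limit q t (i, j) < alphan i.
Proof.
move=> t0; have [[_ _ /(_ t t0)[p p1 qp]] _ _] := sol.
have [j pj] := ell1_vanish ord0 p1 (alphan_gt0 ord0).
exists ord0, j; suff -> : left_limit q t (ord0, j) = p (ord0, j).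
  exact: le_lt_trans (ler_norm _) pj.
by apply: cvg_lim => //; exact: (@l1_cvg_coord _ _ q p _ _ qp).
Qed.

(** Here [t] is the index of an arrival. Fullness of finitely many positions passes from the left
    limit to a whole interval before the jump. *)
Let sg_notin_full k (t : nat) : 0 < tau t -> sg t \notin ranked_upto u k ->
  \forall r \near (tau t)^'-, forall l, (l < k)%N ->
    q r (ranked u l) = alphan (ranked u l).1.
Proof.
move=> t0 ns; apply: filterS (occupancy_left_limits k t0) => r H l lk.
rewrite H//; apply: (@sigma_notin_full _ _ u u_concave alphan) ns l lk.
- by move=> i; exact: left_limit_start.
- by move=> i j; exact: left_limit_mono.
- exact: left_limit_drop.
Qed.

Lemma sum_ranked_eq k x :
  \sum_(l < k) (ranked u l == x)%:R = (x \in ranked_upto u k)%:R :> R.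
Proof.
elim: k => [|k IH]; first by rewrite big_ord0.
rewrite big_ord_recr/= IH mem_rcons inE eq_sym.
case: eqP => [->|_]/=; last by rewrite addr0.
by have [_ /negbTE + _] := rankedP u_concave k; rewrite /ranked => ->; rewrite add0r.
Qed.

Let arr t x := arrivals lambda u n N q t x.

Let arrE t x : Iplus x -> arr t x =
  n%:R^-1 * \sum_(1 <= j < (Nn t).+1) (x == sg j)%:R.
Proof. by rewrite /arr /arrivals /Iplus/= lt0n => /negbTE ->. Qed.

Lemma sum_arrivals k t : \sum_(l < k) arr t (ranked u l) =
  n%:R^-1 * \sum_(1 <= j < (Nn t).+1) (sg j \in ranked_upto u k)%:R.
Proof.
rewrite (eq_bigr (fun l : 'I_k =>
    n%:R^-1 * \sum_(1 <= j < (Nn t).+1) (ranked u l == sg j)%:R)); last first.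
  by move=> l _; apply: arrE; have [] := rankedP u_concave l.
rewrite -mulr_sumr exchange_big/=; congr (_ * _).
by apply: eq_bigr => j _; exact: sum_ranked_eq.
Qed.

Let thetaE t : theta t = n%:R^-1 * \sum_(1 <= j < (Nn t).+1) 1.
Proof. by rewrite big_const_nat iter_addr addr0 subSS subn0. Qed.

Let overflowE k t : overflow (ranked u) arr theta k t =
  n%:R^-1 * \sum_(1 <= j < (Nn t).+1) (sg j \notin ranked_upto u k.+1)%:R.
Proof.
rewrite /overflow /mass sum_arrivals thetaE -mulrBr -sumrB; congr (_ * _).
by apply: eq_bigr => j _; case: (_ \in _); rewrite ?subrr ?subr0.
Qed.

Let sum_incr (F : nat -> R) s t : 0 <= s -> s <= t ->
  \sum_(1 <= j < (Nn t).+1) F j - \sum_(1 <= j < (Nn s).+1) F j =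
  \sum_((Nn s).+1 <= j < (Nn t).+1) F j.
Proof.
move=> s0 st; rewrite (@big_cat_nat _ _ _ (Nn s).+1)//=.
  by rewrite addrAC subrr add0r.
by rewrite ltnS Nn_mono.
Qed.

Variables (T eta beta : R) (K L : nat).
Hypothesis T_ge0 : 0 <= T.
Hypothesis eta_ge0 : 0 <= eta.
Hypothesis ranked_level : forall l, (l < K)%N -> ((ranked u l).2 <= L)%N.
Hypothesis theta_lln : forall t, 0 <= t <= T -> `|theta t - lambda * t| <= eta.
Hypothesis Nd_lln : forall x, Iplus x -> (x.2 <= L)%N ->
  forall s, 0 <= s <= mu * L%:R * T -> `|n%:R^-1 * (Nd x (n%:R * s))%:R - s| <= eta.
Hypothesis capacity : \sum_(l < K) q 0 (ranked u l) + theta T <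
  \sum_(l < K) (A (ranked u l).1)%:R / n%:R.
Hypothesis init_tail : forall x, (L < x.2)%N -> q 0 x <= beta.

Let departures_ge0 t x : 0 <= departures mu n Nd q t x.
Proof.
by rewrite /departures; case: ifP.
Qed.

Let qE t x : 0 <= t -> q t x = q 0 x + arr t x - departures mu n Nd q t x.
Proof. by have [_ _] := sol; exact. Qed.

Let jump_in j : (0 < j)%N -> (j <= Nn T)%N -> sg j \in ranked_upto u K.
Proof.
move=> j0 jT; have t0 := jump_time_gt0 j0 T_ge0 jT.
have tT := jump_time_le T_ge0 jT.
apply: contraT => ns; exfalso.
have H := sg_notin_full t0 ns.
near (tau j)^'- => r.
have Hr : forall l, (l < K)%N -> q r (ranked u l) = alphan (ranked u l).1.
  by near: r; exact: H.
have r0 : 0 <= r by near: r; exact: nbhs_left_ge.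
have rt : r <= tau j by near: r; exact: nbhs_left_le.
have rT : r <= T := le_trans rt tT.
suff : \sum_(l < K) (A (ranked u l).1)%:R / n%:R <=
    \sum_(l < K) q 0 (ranked u l) + theta T by rewrite leNgt capacity.
apply: (@le_trans _ _ (\sum_(l < K) q r (ranked u l))).
  by apply: ler_sum => l _; rewrite Hr.
apply: (@le_trans _ _ (\sum_(l < K) (q 0 (ranked u l) + arr r (ranked u l)))).
  by apply: ler_sum => l _; rewrite qE// gerBl.
rewrite big_split/= lerD2l sum_arrivals thetaE ler_pM2l ?invr_gt0//.
apply: (@le_trans _ _ (\sum_(1 <= i < (Nn r).+1) 1)).
  by apply: ler_sum => i _; case: (_ \in _).
rewrite -subr_ge0 sum_incr//; exact: sumr_ge0.
Unshelve. all: by end_near. Qed.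

Let q_measurable x : measurable_fun `[0, T] (q^~ x).
Proof.
apply: right_continuous_measurable => t t0.
by have [[_ /(_ t t0) h _] _ _] := sol; exact: (@l1_cvg_coord _ _ q (q t) _ _ h).
Qed.

Let q01 t x : 0 <= t <= T -> 0 <= q t x <= 1.
Proof.
move=> /andP[t0 _]; rewrite occupancy_ge0//=.
exact: le_trans (occupancy_le_capacity _ t0) (alphan_le1 _).
Qed.

Let q_bounded x : bounded_measurable T (q^~ x).
Proof.
split => //; exists 1 => t tT; have /andP[h1 h2] := q01 x tT.
by rewrite ger0_norm.
Qed.

Let arr_out t x : 0 <= t <= T -> Iplus x ->
  (forall l, (l < K)%N -> x <> ranked u l) -> arr t x = 0.
Proof.
move=> /andP[t0 tT] Ix nx; rewrite arrE// big_nat_cond big1 ?mulr0// => j.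
rewrite andbT ltnS => /andP[j0 jt]; case: eqP => // xs.
have := jump_in j0 (leq_trans jt (Nn_mono t0 tT)); rewrite -xs.
by move=> /ranked_uptoP[l lK]; move/nx : lK.
Qed.

(** The equation is exact but for the replacement of each departure clock by its mean, and the
    overflow counts the arrivals sent beyond a given rank. *)
Lemma occupancy_approx_system :
  approx_system lambda mu T (ranked u) K L eta beta
    (fun k => mass (ranked u) k (fun x => (A x.1)%:R / n%:R)) q arr theta.
Proof.
split => //.
- move=> t x tT Ix xL; have /andP[t0 tT'] := tT.
  have x0 : (x.2 == 0%N) = false by apply/negbTE; rewrite -lt0n.
  rewrite qE// /departures x0.
  rewrite (_ : \int[lebesgue_measure]_(s in `[0, t])
    (mu * x.2%:R * (q s x - q s (x.1, x.2.+1))) = cumul (dep mu q x) t)//.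
  rewrite [X in `|X|](_ : _ = - (n%:R^-1 * (Nd x (n%:R * cumul (dep mu q x) t))%:R
     - cumul (dep mu q x) t)); last by ring.
  rewrite normrN; apply: Nd_lln => //.
  have bd : bounded_measurable T (dep mu q x).
    by apply: bounded_measurableZ; apply: bounded_measurableB.
  (* Keeps the internal time of the clock within [mu * L * T], where the law of large numbers is
     uniform. *)
  have d01 s : 0 < s <= t -> 0 <= dep mu q x s <= mu * L%:R.
    move=> /andP[/ltW s0 st].
    have /occupancy_state[_ _ /(_ x.1 x.2)/andP[le1 _] _] := s0.
    have sT : 0 <= s <= T by rewrite s0 (le_trans st).
    have /andP[_ h1] := q01 x sT; have /andP[h2 _] := q01 (x.1, x.2.+1) sT.
    have d0 : 0 <= q s x - q s (next x) by rewrite subr_ge0; case: (x) le1.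
    rewrite /dep mulr_ge0 ?mulr_ge0//=.
    have -> : mu * L%:R = mu * L%:R * 1 by rewrite mulr1.
    apply: ler_pM => //; rewrite ?mulr_ge0//.
      by rewrite ler_wpM2l// ler_nat.
    by rewrite lerBlDr; apply: le_trans h1 _; rewrite lerDl.
  have := @cumul_ge_cst _ _ _ 0 0 t bd (lexx _) t0 tT'.
  have := @cumul_le_cst _ _ _ (mu * L%:R) 0 t bd (lexx _) t0 tT'.
  rewrite cumul0 !subr0 mul0r => h1 h2; apply/andP; split.
    by apply: h2 => r /d01/andP[].
  apply: (@le_trans _ _ (mu * L%:R * t)); first by apply: h1 => r /d01/andP[].
  by rewrite ler_wpM2l// mulr_ge0.
- move=> [i [|j]] s t s0 st tT.
    by rewrite /arr /arrivals /=.
  rewrite !arrE// ler_pM2l ?invr_gt0// -subr_ge0 sum_incr//.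
  exact: sumr_ge0.
- move=> k s t kK s0 st tT; rewrite !overflowE !thetaE -!mulrBr !sum_incr//.
  rewrite pmulr_rge0 ?invr_gt0// sumr_ge0//= ler_pM2l ?invr_gt0//.
  by apply: ler_sum => j _; case: (_ \notin _).
- move=> k s t kK s0 st tT H r /andP[sr rt].
  have r0 : 0 <= r := le_trans s0 (ltW sr).
  have t0 : 0 <= t := le_trans r0 rt.
  rewrite !overflowE; congr (_ * _); apply/eqP; rewrite eq_sym -subr_eq0 sum_incr//.
  rewrite big_nat_cond big1// => j; rewrite andbT ltnS => /andP[rj jt].
  case: (boolP (sg j \in _)) => //= ns; exfalso.
  (* The jump occurs at or after [r], and [r > s] strictly, so the times just before it still lie in
     the window where the mass is below capacity. *)
  have jr := jump_time_ge r0 rj t0 jt; have jt' := jump_time_le t0 jt.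
  have j0 : 0 < tau j := le_lt_trans s0 (lt_le_trans sr jr).
  have H1 := @sg_notin_full k.+1 _ j0 ns.
  near (tau j)^'- => r'.
  have Hr : forall l, (l < k.+1)%N -> q r' (ranked u l) = alphan (ranked u l).1.
    by near: r'; exact: H1.
  have sr' : s < r' by near: r'; apply: nbhs_left_gt; exact: lt_le_trans jr.
  have rt' : r' <= tau j by near: r'; exact: nbhs_left_le.
  have := H r'; rewrite sr' (le_trans rt' jt') => /(_ isT).
  rewrite /mass (eq_bigr (fun l : 'I_k.+1 => (A (ranked u l).1)%:R / n%:R)) ?ltxx//.
  by move=> l _; rewrite Hr.
- move=> k t kK /andP[t0 _]; apply: ler_sum => l _.
  exact: occupancy_le_capacity.
- move=> t x tT Lx; have Ix : Iplus x by exact: leq_ltn_trans Lx.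
  rewrite qE; last by case/andP: tT.
  rewrite arr_out// ?addr0.
    by apply: le_trans (init_tail Lx); rewrite gerBl.
  by move=> l lK E; have := ranked_level lK; rewrite -E leqNgt Lx.
Unshelve. all: by end_near. Qed.

(* Outside the first [K] positions there are only departures. *)
Lemma occupancy_out_le t x : 0 <= t <= T -> (L < x.2)%N -> q t x <= q 0 x.
Proof.
move=> tT Lx; have Ix : Iplus x by exact: leq_ltn_trans Lx.
rewrite qE; last by case/andP: tT.
rewrite arr_out// ?addr0 ?gerBl//.
by move=> l lK E; have := ranked_level lK; rewrite -E leqNgt Lx.
Qed.

End occupancy_process.

(** * Fluid trajectories *)

Section calculus.
Context {R : realType}.
Implicit Types (f : R -> R) (a b s t T : R).
Notation leb := (@lebesgue_measure R).

Lemma abs_continuousS a b s t f : a <= s -> t <= b ->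
  abs_continuous a b f -> abs_continuous s t f.
Proof.
move=> as_ tb cf e e0; have [d d0 H] := cf e e0; exists d => // k I Ist.
apply: H => i; have [h1 h2 h3] := Ist i.
by split => //; [exact: le_trans as_ h1|exact: le_trans h3 tb].
Qed.

Lemma abs_continuous_near a b f t e : a <= t <= b -> abs_continuous a b f -> 0 < e ->
  exists2 d, 0 < d & forall s, a <= s <= b -> `|s - t| < d -> `|f s - f t| < e.
Proof.
move=> /andP[at_ tb] cf e0; have [d d0 H] := cf e e0; exists d => // s /andP[as_ sb] std.
have key x y : a <= x -> x <= y -> y <= b -> y - x < d -> `|f y - f x| < e.
  move=> ax xy yb xyd; have := H 1%N (fun=> (x, y)).
  rewrite !big_ord1/=; apply => //.
  by move=> i j _ _ _; rewrite (ord1 i) (ord1 j).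
have [st|ts] := leP s t.
  rewrite distrC; apply: key => //; move: std; rewrite distrC ger0_norm//.
  by rewrite subr_ge0.
apply: key => //; first exact: ltW.
by move: std; rewrite gtr0_norm// subr_gt0.
Qed.

Lemma abs_continuous_continuous a b f t : abs_continuous a b f -> a < t < b ->
  {for t, continuous f}.
Proof.
move=> cf /andP[at_ tb]; apply/cvgrPdist_lt => e e0.
have atb : a <= t <= b by rewrite !ltW.
have [d d0 H] := abs_continuous_near atb cf e0.
near=> s; rewrite distrC; apply: H.
  apply/andP; split; apply: ltW.
    by near: s; exact: lt_nbhsr.
  by near: s; exact: lt_nbhsl.
by near: s; apply/nbhs_ballP; exists d => //= y; rewrite /ball/= distrC.
Unshelve. all: by end_near. Qed.

Lemma abs_continuous_within a b f : a < b -> abs_continuous a b f ->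
  {within `[a, b], continuous f}.
Proof.
move=> ab cf; apply/continuous_within_itvP => //; split.
- move=> t; rewrite in_itv/=; exact: abs_continuous_continuous.
- apply/cvgrPdist_lt => e e0.
  have aab : a <= a <= b by rewrite lexx ltW.
  have [d d0 H] := abs_continuous_near aab cf e0.
  near=> s; rewrite distrC; apply: H.
    apply/andP; split; first by near: s; exact: nbhs_right_ge.
    by near: s; exact: nbhs_right_le.
  rewrite ger0_norm ?subr_ge0; last by near: s; exact: nbhs_right_ge.
  by rewrite ltrBlDl; near: s; apply: nbhs_right_lt; rewrite ltrDl.
- apply/cvgrPdist_lt => e e0.
  have abb : a <= b <= b by rewrite lexx ltW.
  have [d d0 H] := abs_continuous_near abb cf e0.
  near=> s; rewrite distrC; apply: H.
    apply/andP; split; first by near: s; exact: nbhs_left_ge.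
    by near: s; exact: nbhs_left_le.
  rewrite distrC ger0_norm ?subr_ge0; last by near: s; exact: nbhs_left_le.
  by rewrite ltrBlDl -ltrBlDr; near: s; apply: nbhs_left_gt; rewrite ltrBlDr ltrDl.
Unshelve. all: by end_near. Qed.

Lemma is_derive_cumul f T t : bounded_measurable T f -> 0 < t < T ->
  {for t, continuous f} -> is_derive t (1 : R) (cumul f) (f t).
Proof.
move=> bf /andP[t0 tT] cf.
have [d1 d2] := @continuous_FTC1_closed _ f 0 t T tT
  (bounded_measurable_integrable bf (lexx T)) t0 cf.
apply: DeriveDef; first exact: d1.
rewrite -derive1E; exact: d2.
Qed.

Lemma is_derive_sum_ord (n : nat) (f : nat -> R -> R) (d : nat -> R) t :
  (forall l, (l < n)%N -> is_derive t (1 : R) (f l) (d l)) ->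
  is_derive t (1 : R) (fun s => \sum_(l < n) f l s) (\sum_(l < n) d l).
Proof.
elim: n => [|n IH] H.
  have -> : (fun s => \sum_(l < 0) f l s) = cst 0.
    by apply/funext => s; rewrite big_ord0.
  by rewrite big_ord0; exact: is_derive_cst.
have -> : (fun s => \sum_(l < n.+1) f l s) = (fun s => \sum_(l < n) f l s) + f n.
  by apply/funext => s; rewrite big_ord_recr.
rewrite big_ord_recr/=; apply: is_deriveD.
  by apply: IH => l ln; apply: H; exact: ltnW.
exact: H.
Qed.

End calculus.

(** * The arrival rates of the fluid model along the enumeration *)

Section fluid_arrival_rates.
Context {R : realType} {m : nat}.
Variables (lambda mu : R) (u : 'I_m.+1 -> R -> R) (alpha : 'I_m.+1 -> R).
Hypothesis u_concave : forall i, concave_on [set x : R | 0 <= x] (u i).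
Implicit Types (p : idx m -> R) (x : idx m).

Lemma Qfluid_drop p : (forall i, 0 < alpha i) -> Qfluid alpha p ->
  exists i j, p (i, j) < alpha i.
Proof.
move=> alpha_gt0 [p1 _ _ _]; have [j pj] := ell1_vanish ord0 p1 (alpha_gt0 ord0).
by exists ord0, j; exact: le_lt_trans (ler_norm _) pj.
Qed.

Lemma Qfluid_start p : Qfluid alpha p -> forall i, p (i, 0%N) = alpha i.
Proof. by move=> []. Qed.

Lemma Qfluid_mono p : Qfluid alpha p -> forall i j, p (i, j.+1) <= p (i, j).
Proof. by move=> [_ _ H _] i j; have /andP[] := H i j. Qed.

Lemma Qfluid_le p x : Qfluid alpha p -> p x <= alpha x.1.
Proof.
case: x => i [|j] [_ _ H1 H2]/=; rewrite -H2//.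
by have /andP[] := H1 i j.+1; have /andP[] := H1 i j.
Qed.

Let rate p x := mu * x.2%:R * (alpha x.1 - p (x.1, x.2.+1)).

Lemma Lambda_above p s k : sigma u p = ranked u s -> (k < s)%N ->
  Lambda lambda mu u alpha p (ranked u k) = rate p (ranked u k).
Proof.
move=> sE ks; rewrite /Lambda sE.
case: eqP => [/(ranked_inj u_concave) E|_]; first by move: ks; rewrite E ltnn.
have lt := ranked_lt u_concave ks.
case: ifP => // gt; have := rank_lt_trans lt gt.
by rewrite rank_lt_irr.
Qed.

Lemma Lambda_below p x : rank_lt u x (sigma u p) ->
  Lambda lambda mu u alpha p x = 0.
Proof.
move=> h; rewrite /Lambda h; case: eqP => // E.
by move: h; rewrite E rank_lt_irr.
Qed.

Lemma Lambda_at p s : sigma u p = ranked u s ->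
  Lambda lambda mu u alpha p (ranked u s) = lambda - \sum_(l < s) rate p (ranked u l).
Proof.
move=> sE; rewrite /Lambda sE eqxx; congr (_ - _).
have -> : [set y | Iplus y /\ rank_lt u (ranked u s) y] =
    [set y | y \in ranked_upto u s].
  apply/seteqP; split => y /=.
    by move=> [Iy sy]; apply/ranked_uptoP; exact: ranked_gt.
  move=> /ranked_uptoP[l ls ->]; split; last exact: ranked_lt.
  by have [] := rankedP u_concave l.
rewrite -(@fsbig_seq _ _ _ _ (ranked_upto u s)); last first.
  by rewrite ranked_uptoE map_inj_uniq ?iota_uniq//; exact: ranked_inj.
rewrite ranked_uptoE big_map.
have -> : iota 0 s = index_iota 0 s by rewrite /index_iota subn0.
by rewrite big_mkord.
Qed.

(** The position [sigma u p] receives what the higher ones leave of [lambda], and the lower ones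
    receive nothing. *)
Lemma Lambda_sum p s k : sigma u p = ranked u s -> (s < k)%N ->
  \sum_(l < k) Lambda lambda mu u alpha p (ranked u l) = lambda.
Proof.
move=> sE; elim: k => // k IH; rewrite ltnS leq_eqVlt => /orP[/eqP sk|sk].
  rewrite -sk big_ord_recr/= Lambda_at//.
  rewrite (eq_bigr (fun l : 'I_s => rate p (ranked u l))) ?subrKC ?addrC ?subrK//.
  by move=> l _; apply: Lambda_above sE _.
rewrite big_ord_recr/= IH// Lambda_below ?addr0// sE.
exact: ranked_lt.
Qed.

End fluid_arrival_rates.

(** * Fluid trajectories as exact reflected systems *)

Section fluid_trajectory.
Context {R : realType} {m : nat}.
Variables (lambda mu : R) (u : 'I_m.+1 -> R -> R) (alpha : 'I_m.+1 -> R).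
Variables (q : R -> idx m -> R).
Hypothesis u_concave : forall i, concave_on [set x : R | 0 <= x] (u i).
Hypothesis alpha_gt0 : forall i, 0 < alpha i.
Hypothesis lambda_ge0 : 0 <= lambda.
Hypothesis mu_ge0 : 0 <= mu.
Hypothesis fluid : fluid_trajectory lambda mu u alpha q.
Variables (T eta beta : R) (K L : nat).
Hypothesis T_gt0 : 0 < T.
Hypothesis eta_ge0 : 0 <= eta.
Hypothesis ranked_level : forall l, (l < K)%N -> ((ranked u l).2 <= L)%N.
Hypothesis capacity : \sum_(l < K) q 0 (ranked u l) + lambda * T <
  \sum_(l < K) alpha (ranked u l).1.
Hypothesis init_tail : forall x, (L < x.2)%N -> q 0 x <= beta.
Implicit Types (x : idx m) (s t r : R).
Notation leb := (@lebesgue_measure R).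

Let rateL t x := Lambda lambda mu u alpha (q t) x.

(** A fluid trajectory carries no arrival process: the arrivals are read off the balance
    equation. *)
Definition fluid_arrivals t x : R :=
  if x.2 == 0%N then 0 else q t x - q 0 x + cumul (dep mu q x) t.

Let a := fluid_arrivals.

Let state t : 0 <= t -> Qfluid alpha (q t).
Proof. by have [+ _ _] := fluid; exact. Qed.

Let q01 t x : 0 <= t <= T -> 0 <= q t x <= 1.
Proof. by move=> /andP[t0 _]; have [_ + _ _] := state t0; exact. Qed.

Let q_ac x : abs_continuous 0 T (q^~ x).
Proof. by have [_ + _] := fluid; apply; exact: ltW. Qed.

Let q_bounded x : bounded_measurable T (q^~ x).
Proof.
by apply: continuous_bounded_measurable; apply: abs_continuous_within.
Qed.

Let dep_bounded x : bounded_measurable T (dep mu q x).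
Proof. by apply: bounded_measurableZ; apply: bounded_measurableB. Qed.

Let dep_ge0 t x : 0 <= t -> Iplus x -> 0 <= dep mu q x t.
Proof.
move=> /state[_ _ H _] _; rewrite /dep !mulr_ge0//.
by rewrite subr_ge0; case: x => i j; have /andP[] := H i j.
Qed.

Let dep_continuous x t : 0 < t < T -> {for t, continuous (dep mu q x)}.
Proof.
move=> tT; apply: cvgM; first exact: cvg_cst.
by apply: cvgB; exact: (abs_continuous_continuous (q_ac _) tT).
Qed.

Let cumul_ac x : abs_continuous 0 T (cumul (dep mu q x)).
Proof.
have [_ [B HB]] := dep_bounded x.
apply: (@lipschitz_abs_continuous _ _ _ _ B) => s t s0 st tT.
have := cumul_norm_le (dep_bounded x) (bounded_measurable_cst T B) s0 st tT.
rewrite !cumul_cst ?(le_trans s0)// -mulrBr; apply => r /andP[sr rt].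
by apply: HB; rewrite (le_trans s0 (ltW sr)) (le_trans rt).
Qed.

Let aE x : Iplus x -> a^~ x = (fun t => q t x - q 0 x + cumul (dep mu q x) t).
Proof.
by rewrite /Iplus/= lt0n => /negbTE x0; apply/funext => t; rewrite /a /fluid_arrivals x0.
Qed.

Let a_ac x : Iplus x -> abs_continuous 0 T (a^~ x).
Proof.
move=> Ix; rewrite aE//.
have h0 : abs_continuous 0 T (fun _ : R => - q 0 x).
  by apply: (@lipschitz_abs_continuous _ _ _ _ 0) => s t _ _ _; rewrite subrr normr0 mul0r.
exact: abs_continuousD (abs_continuousD (q_ac x) h0) (cumul_ac x).
Qed.

Let good t := forall x, Iplus x ->
  [/\ is_derive t (1 : R) (q^~ x) (rateL t x - dep mu q x t),
      is_derive t (1 : R) (a^~ x) (rateL t x) & 0 <= rateL t x].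

Let ae_good : {ae leb, forall t, 0 < t < T -> good t}.
Proof.
have [_ _] := fluid; apply: filterS.
  exact: (ae_filter_ringOfSetsType leb).
move=> t H tT x Ix.
have /andP[t0 tT'] := tT.
have [dq L0] := H (ltW t0) x Ix; split => //.
rewrite aE//.
have dc := is_derive_cumul (dep_bounded x) tT (@dep_continuous x t tT).
have d0 : is_derive t (1 : R) (fun _ : R => - q 0 x) 0 by exact: is_derive_cst.
apply: (is_derive_eq (is_deriveD (is_deriveD dq d0) dc)).
by rewrite addr0 subrK.
Qed.

Let nonincreasing f s t : abs_continuous 0 T f -> 0 <= s -> s <= t -> t <= T ->
  (forall r, s < r < t -> good r -> exists2 d, is_derive r (1 : R) f d & d <= 0) ->
  f t <= f s.
Proof.
move=> cf s0 st tT H.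
apply: (abs_continuous_nonincreasing st (abs_continuousS s0 tT cf)).
move: ae_good; apply: filterS; first exact: (ae_filter_ringOfSetsType leb).
move=> r Hr srt; apply: H => //; apply: Hr.
by case/andP: srt => h1 h2; rewrite (le_lt_trans s0 h1) (lt_le_trans h2).
Qed.

Let nondecreasing f s t : abs_continuous 0 T f -> 0 <= s -> s <= t -> t <= T ->
  (forall r, s < r < t -> good r -> exists2 d, is_derive r (1 : R) f d & 0 <= d) ->
  f s <= f t.
Proof.
move=> cf s0 st tT H; rewrite -lerN2.
apply: (@nonincreasing (fun r => - f r)) => //.
  by have := abs_continuousZ (-1) cf; under eq_fun do rewrite mulN1r.
move=> r sr gr; have [d fd d0] := H r sr gr.
by exists (- d); [exact: is_deriveN|rewrite oppr_le0].
Qed.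

Let linear_ac c : abs_continuous 0 T (fun t => c * t).
Proof.
apply: (@lipschitz_abs_continuous _ _ _ _ `|c|) => s t _ st _.
by rewrite -mulrBr normrM (ger0_norm (x := t - s)) ?subr_ge0.
Qed.

Let linear_derive c r : is_derive r (1 : R) (fun t => c * t) c.
Proof.
have d : is_derive r (1 : R) (fun t => c * t) (c *: (1 : R)) by exact: is_deriveZ.
by apply: (is_derive_eq d); rewrite /GRing.scale/= mulr1.
Qed.

Let sigma_full t k : 0 <= t -> sigma u (q t) \notin ranked_upto u k ->
  forall l, (l < k)%N -> q t (ranked u l) = alpha (ranked u l).1.
Proof.
move=> /state st; apply: (@sigma_notin_full _ _ u u_concave alpha).
- exact: Qfluid_start.
- exact: Qfluid_mono st.
- exact: Qfluid_drop alpha_gt0 st.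
Qed.

Let RI l : Iplus (ranked u l).
Proof. by have [] := rankedP u_concave l. Qed.

(** The mass of the first [K] positions minus [lambda * t] is nonincreasing. Where [sigma] is
    listed, the listed rates sum to [lambda] and departures only help; where it is not, that mass is
    at its maximum and its derivative vanishes. Hence the first [K] positions cannot all be full
    before [T]. *)
Let sigma_in t : 0 <= t <= T -> sigma u (q t) \in ranked_upto u K.
Proof.
move=> /andP[t0 tT]; apply: contraT => /(sigma_full t0) full; exfalso.
suff : \sum_(l < K) q t (ranked u l) - lambda * t <=
    \sum_(l < K) q 0 (ranked u l) - lambda * 0.
  rewrite mulr0 subr0 (eq_bigr (fun l : 'I_K => alpha (ranked u l).1)); last first.
    by move=> l _; exact: full.
  have : lambda * t <= lambda * T by rewrite ler_wpM2l.
  by move: capacity; lra.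
pose f t := \sum_(l < K) q t (ranked u l) + - lambda * t.
have fac : abs_continuous 0 T f.
  apply: abs_continuousD (linear_ac _).
  by apply: abs_continuous_sum => l.
have := @nonincreasing f 0 t fac (lexx _) t0 tT; rewrite /f !mulNr; apply.
move=> r /andP[r0 rt] gr.
have r0' := ltW r0.
have dsum : is_derive r (1 : R) (fun s => \sum_(l < K) q s (ranked u l))
    (\sum_(l < K) (rateL r (ranked u l) - dep mu q (ranked u l) r)).
  apply: (@is_derive_sum_ord _ K (fun l s => q s (ranked u l))
    (fun l => rateL r (ranked u l) - dep mu q (ranked u l) r)) => l _.
  by have [] := gr _ (RI l).
exists (\sum_(l < K) (rateL r (ranked u l) - dep mu q (ranked u l) r) + - lambda).
  exact: is_deriveD.
rewrite subr_le0.
have [/ranked_uptoP[s sK sE]|nin] := boolP (sigma u (q r) \in ranked_upto u K).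
  rewrite -(Lambda_sum lambda mu alpha u_concave sE sK).
  by apply: ler_sum => l _; rewrite gerBl dep_ge0.
rewrite (is_derive_max dsum)//.
near=> s.
apply: ler_sum => l _; rewrite (sigma_full r0' nin)//.
apply: Qfluid_le; apply: state; apply: ltW.
by near: s; exact: lt_nbhsr.
Unshelve. all: by end_near. Qed.

Let sigma_ranked t : 0 <= t <= T -> exists2 s, (s < K)%N & sigma u (q t) = ranked u s.
Proof. by move=> /sigma_in/ranked_uptoP. Qed.

Let a0 x : a 0 x = 0.
Proof. by rewrite /a/fluid_arrivals; case: ifP; rewrite // cumul0 subrr addr0. Qed.

Let a_out t x : 0 <= t <= T -> Iplus x ->
  (forall l, (l < K)%N -> x <> ranked u l) -> a t x = 0.
Proof.
move=> /andP[t0 tT] Ix nx.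
have H r : 0 < r < t -> good r -> is_derive r (1 : R) (a^~ x) 0.
  move=> /andP[r0 rt] gr; have [_ + _] := gr x Ix.
  rewrite /rateL Lambda_below//.
  have rT : 0 <= r <= T by rewrite ltW//= (le_trans (ltW rt)).
  have [s sK ->] := sigma_ranked rT.
  apply: (@ranked_notin _ _ _ u_concave K) => //.
  by apply/negP => /ranked_uptoP[l lK]; exact: nx.
rewrite -[RHS](a0 x); apply/eqP; rewrite eq_le; apply/andP; split.
  by apply: (nonincreasing (a_ac Ix)) => // r rt gr; exists 0 => //; exact: H.
by apply: (nondecreasing (a_ac Ix)) => // r rt gr; exists 0 => //; exact: H.
Qed.

Let sum_derive k r : good r ->
  is_derive r (1 : R) (fun s => \sum_(l < k) a s (ranked u l)) (\sum_(l < k) rateL r (ranked u l)).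
Proof.
move=> gr; apply: (@is_derive_sum_ord _ k (fun l s => a s (ranked u l))
    (fun l => rateL r (ranked u l))) => l _.
by have [] := gr _ (RI l).
Qed.

Let overflow_derive k r : good r ->
  is_derive r (1 : R) (overflow (ranked u) a (fun t => lambda * t) k)
    (lambda - \sum_(l < k.+1) rateL r (ranked u l)).
Proof. by move=> gr; exact: is_deriveB (linear_derive lambda r) (sum_derive k.+1 gr). Qed.

Let overflow_ac k : abs_continuous 0 T (overflow (ranked u) a (fun t => lambda * t) k).
Proof.
have h := @abs_continuous_sum _ 0 T _ (index_enum 'I_k.+1) _ (fun l : 'I_k.+1 => a_ac (RI l)).
have := abs_continuousD (linear_ac lambda) (abs_continuousZ (-1) h).
by congr (abs_continuous _ _ _); apply/funext => t; rewrite mulN1r.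
Qed.

Let partial_rate k r : (k < K)%N -> 0 <= r <= T -> good r ->
  \sum_(l < k.+1) rateL r (ranked u l) <= lambda.
Proof.
move=> kK rT gr; have [s sK sE] := sigma_ranked rT.
rewrite -[X in _ <= X](Lambda_sum lambda mu alpha u_concave sE sK).
rewrite -(big_mkord xpredT (fun l => rateL r (ranked u l))).
rewrite -(big_mkord xpredT (fun l => Lambda lambda mu u alpha (q r) (ranked u l))).
rewrite [X in _ <= X](big_cat_nat _ kK)//= lerDl sumr_ge0// => l _.
by have [] := gr _ (RI l).
Qed.

(** Balance and total arrivals are exact, so any [eta >= 0] will do. Below capacity at rank [k],
    [sigma] is among the first [k.+1] positions; their rates then sum to [lambda] and the overflow
    has derivative zero. *)
Lemma fluid_approx_system :
  approx_system lambda mu T (ranked u) K L eta beta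
    (fun k => mass (ranked u) k (fun x => alpha x.1)) q a (fun t => lambda * t).
Proof.
have mono x s t : 0 <= s -> s <= t -> t <= T -> a s x <= a t x.
  move=> s0 st tT; have [x0|xn] := eqVneq x.2 0%N.
    by rewrite /a/fluid_arrivals x0 eqxx.
  have Ix : Iplus x by rewrite /Iplus/= lt0n.
  apply: (nondecreasing (a_ac Ix)) => // r _ gr.
  by have [_ d L0] := gr x Ix; exists (rateL r x).
split => //.
- by move=> x; have [] := q_bounded x.
- move=> t x tT Ix _; have := congr1 (fun f => f t) (aE Ix) => /= ->.
  rewrite (_ : _ - _ = 0) ?normr0//; ring.
- by move=> t tT; rewrite subrr normr0.
- move=> k s t kK s0 st tT; apply/andP; split.
    rewrite subr_ge0.
    apply: (nondecreasing (overflow_ac k)) => // r /andP[sr rt] gr.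
    exists (lambda - \sum_(l < k.+1) rateL r (ranked u l)); first exact: overflow_derive.
    rewrite subr_ge0; apply: partial_rate => //.
    by rewrite (le_trans s0 (ltW sr)) (le_trans (ltW rt)).
  have : mass (ranked u) k (a s) <= mass (ranked u) k (a t).
    by apply: ler_sum => l _; exact: mono.
  rewrite /overflow; lra.
- move=> k s t kK s0 st tT H r /andP[sr rt].
  have r0 : 0 <= r := le_trans s0 (ltW sr).
  have D r' : r < r' < t -> good r' ->
      is_derive r' (1 : R) (overflow (ranked u) a (fun t => lambda * t) k) 0.
    move=> /andP[rr' r't] gr.
    have r'0 : 0 <= r' := le_trans r0 (ltW rr').
    have r'T : 0 <= r' <= T by rewrite r'0 (le_trans (ltW r't)).
    have [s' s'K sE] := sigma_ranked r'T.
    have s'k : (s' < k.+1)%N.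
      rewrite ltnNge; apply/negP => ks'.
      have := H r'; rewrite (lt_trans sr rr') (ltW r't) => /(_ isT).
      rewrite /mass (eq_bigr (fun l : 'I_k.+1 => alpha (ranked u l).1)) ?ltxx//.
      move=> l _; apply: (@sigma_full r' k.+1) => //.
      apply/negP => /ranked_uptoP[l' l'k].
      rewrite sE => /(ranked_inj u_concave) E.
      by move: ks'; rewrite E ltnNge -ltnS l'k.
    have := overflow_derive k gr.
    by rewrite /rateL (Lambda_sum lambda mu alpha u_concave sE s'k) subrr.
  apply/eqP; rewrite eq_le; apply/andP; split.
    by apply: (nondecreasing (overflow_ac k)) => // r' h gr; exists 0 => //; exact: D.
  by apply: (nonincreasing (overflow_ac k)) => // r' h gr; exists 0 => //; exact: D.
- move=> k t kK /andP[t0 _]; apply: ler_sum => l _.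
  by apply: Qfluid_le; exact: state.
- move=> t x tT Lx; have Ix : Iplus x by exact: leq_ltn_trans Lx.
  have /andP[t0 tT'] := tT.
  have nx l : (l < K)%N -> x <> ranked u l.
    by move=> lK E; have := ranked_level lK; rewrite -E leqNgt Lx.
  have := a_out tT Ix nx; have := congr1 (fun f => f t) (aE Ix) => /= -> E.
  apply: le_trans (init_tail Lx).
  have := @cumul_ge_cst _ _ _ 0 0 t (dep_bounded x) (lexx _) t0 tT'.
  rewrite cumul0 !subr0 mul0r => h.
  have : 0 <= cumul (dep mu q x) t by apply: h => r /andP[r0 _]; apply: dep_ge0 => //; exact: ltW.
  lra.
Qed.

End fluid_trajectory.

(** * Limits of approximate systems *)

Section limit_preliminaries.
Context {R : realType}.
Implicit Types (f : R -> R) (x y C d t : R).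

Lemma ler_eps x y C : 0 <= C -> (forall e, 0 < e -> x <= y + C * e) -> x <= y.
Proof.
move=> C0 H; apply/ler_addgt0Pr => e e0.
have C1 : 0 < C + 1 by rewrite ltr_wpDl.
apply: le_trans (H (e / (C + 1)) (divr_gt0 e0 C1)) _.
rewrite lerD2l mulrCA ler_piMr ?(ltW e0)// ler_pdivrMr// mul1r lerDl//.
Qed.

Lemma is_derive_ext f g t (d : R) : f =1 g -> is_derive t (1 : R) f d ->
  is_derive t (1 : R) g d.
Proof. by move=> /funext ->. Qed.

Lemma is_derive_nondecreasing_ge0 f t d a b : a < t < b ->
  (forall r s, a <= r -> r <= s -> s <= b -> f r <= f s) ->
  is_derive t (1 : R) f d -> 0 <= d.
Proof.
move=> /andP[at_ tb] mono /is_derive_nearP H.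
apply: (@ler_eps _ _ 1) => // e e0; rewrite mul1r.
have [h h0 K] := H e e0.
pose s := Num.min (h / 2) (b - t).
have s0 : 0 < s by rewrite lt_min divr_gt0//= subr_gt0.
have sh : s < h.
  by apply: (@le_lt_trans _ _ (h / 2)); [rewrite ge_min lexx|lra].
have sb : s <= b - t by rewrite ge_min lexx orbT.
have := K (t + s); rewrite addrAC subrr add0r gtr0_norm// => /(_ sh)/ler_normlP[k1 k2].
have : f t <= f (t + s) by apply: mono; [exact: ltW|lra|lra].
move=> k3; rewrite -(pmulr_lge0 _ s0) mulrDl; lra.
Qed.

Lemma lipschitz_continuous f C : (forall s t, `|f s - f t| <= C * `|s - t|) ->
  continuous f.
Proof.
move=> H t; apply/cvgrPdist_le => e e0.
have C1 : 0 < `|C| + 1 by rewrite ltr_wpDl.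
apply/nbhs_ballP; exists (e / (`|C| + 1)); first exact: divr_gt0.
move=> s; rewrite /ball/= ltr_pdivlMr// => /ltW h.
apply: le_trans (H t s) _; apply: le_trans h; rewrite mulrC ler_wpM2l//.
by rewrite (le_trans (ler_norm C))// lerDl.
Qed.

(** Projection onto [[0, T]]: it extends a path from [[0, T]] to the continuous function on the line
    that the reflected path lemmas take. *)
Definition clamp (T t : R) := Num.max 0 (Num.min t T).

Lemma clamp_in T t : 0 <= T -> 0 <= clamp T t <= T.
Proof.
move=> T0; rewrite /clamp le_max lexx/= ge_max T0/=.
by rewrite ge_min lexx orbT.
Qed.

Lemma clamp_id T t : 0 <= t <= T -> clamp T t = t.
Proof. by move=> /andP[t0 tT]; rewrite /clamp min_l// max_r. Qed.

Lemma clamp_lipschitz T s t : 0 <= T -> `|clamp T s - clamp T t| <= `|s - t|.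
Proof.
move=> T0; rewrite /clamp.
have [|] := leP s T => hs; have [|] := leP t T => ht;
  do ?[rewrite (max_r T0)]; rewrite ?subrr ?normr0//.
- by case: (leP 0 s) => h1; case: (leP 0 t) => h2; rewrite ?subrr ?normr0//;
    case: (ler0P (s - t)) => h; rewrite ler_norml; apply/andP; split; lra.
- by case: (leP 0 s) => h1; case: (ler0P (s - t)) => h; rewrite ler_norml; apply/andP; split; lra.
- by case: (leP 0 t) => h1; case: (ler0P (s - t)) => h; rewrite ler_norml; apply/andP; split; lra.
Qed.

Lemma clamp_near T t : 0 < t < T -> \forall s \near t, clamp T s = s.
Proof.
move=> /andP[t0 tT]; near=> s; apply: clamp_id; apply/andP; split; apply: ltW.
  by near: s; exact: lt_nbhsr.
by near: s; exact: lt_nbhsl.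
Unshelve. all: by end_near. Qed.

End limit_preliminaries.

Section limit_system.
Context {R : realType} {m : nat}.
Variables (lambda mu : R) (u : 'I_m.+1 -> R -> R) (alpha : 'I_m.+1 -> R).
Variables (q : R -> idx m -> R) (T : R) (K : nat).
Hypothesis u_concave : forall i, concave_on [set x : R | 0 <= x] (u i).
Hypothesis alpha_gt0 : forall i, 0 < alpha i.
Hypothesis lambda_ge0 : 0 <= lambda.
Hypothesis mu_ge0 : 0 <= mu.
Hypothesis T_gt0 : 0 < T.
Implicit Types (x : idx m) (s t r e : R) (k l : nat).
Notation leb := (@lebesgue_measure R).

Let cap k := mass (ranked u) k (fun x => alpha x.1).

Hypothesis state : forall t, 0 <= t <= T -> Qfluid alpha (q t).
Hypothesis capacity : \sum_(l < K) q 0 (ranked u l) + lambda * T <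
  \sum_(l < K) alpha (ranked u l).1.
(** The freedom in [L0] lets the approximate equation reach any prescribed position. *)
Hypothesis approximable : forall (L0 : nat) e, 0 < e ->
  exists L beta c' q' a' th',
  [/\ (L0 <= L)%N,
      approx_system lambda mu T (ranked u) K L e beta c' q' a' th',
      forall t x, 0 <= t <= T -> `|q' t x - q t x| <= e &
      forall k, (k < K)%N -> `|c' k - cap k| <= e].

Let T_ge0 : 0 <= T. Proof. exact: ltW. Qed.

Let K_gt0 : (0 < K)%N.
Proof.
rewrite lt0n; apply/eqP => K0; move: capacity; rewrite K0 !big_ord0 add0r.
by apply/negP; rewrite -leNgt mulr_ge0.
Qed.

Let RI l : Iplus (ranked u l).
Proof. by have [] := rankedP u_concave l. Qed.

Let q_bounded x : bounded_measurable T (q^~ x).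
Proof.
split; last first.
  exists 1 => t tT; have [_ /(_ x)/andP[h1 h2] _ _] := state tT.
  by rewrite ger0_norm.
have /choice[F HF] : forall n : nat, exists f : R -> R, measurable_fun `[0, T] f /\
    forall t, 0 <= t <= T -> `|f t - q t x| <= n.+1%:R^-1.
  move=> n; have n0 : 0 < n.+1%:R^-1 :> R by rewrite invr_gt0.
  have [L [beta [c' [q' [a' [th' [_ S qq _]]]]]]] := approximable 0 n0.
  by exists (q'^~ x); split; [exact: approx_measurable S x|move=> t; exact: qq].
apply: (@measurable_fun_cvg _ _ _ _ F); first by move=> n; have [] := HF n.
move=> t /=; rewrite in_itv/= => tT; apply/cvgrPdist_le => e e0.
near=> n; rewrite distrC; apply: le_trans ((HF n).2 t tT) _.
by apply: ltW; near: n; exact: near_infty_natSinv_lt (PosNum e0).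
Unshelve. all: by end_near. Qed.

Let dep_bounded x : bounded_measurable T (dep mu q x).
Proof. by apply: bounded_measurableZ; apply: bounded_measurableB. Qed.

Let dep_01 t x : 0 <= t <= T -> 0 <= dep mu q x t <= mu * x.2%:R.
Proof.
move=> /state[_ H1 H2 _].
have /andP[h0 h1] := H1 x; have /andP[h2 h3] := H1 (next x).
have d0 : 0 <= q t x - q t (next x).
  by rewrite subr_ge0; case: x {H1 h0 h1 h2 h3} => i j; have /andP[] := H2 i j.
rewrite /dep !mulr_ge0//= -[X in _ <= X]mulr1 ler_wpM2l ?mulr_ge0//; lra.
Qed.

Definition limit_arrivals t x : R := q t x - q 0 x + cumul (dep mu q x) t.

Let a := limit_arrivals.

Let a0 x : a 0 x = 0.
Proof. by rewrite /a/limit_arrivals cumul0 subrr addr0. Qed.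

(** One error from the equation, two from the states at times 0 and [t], and the rest from the
    integrated departure rates. *)
Let C x := 3 + 2 * (mu * x.2%:R) * T.

Let C_ge0 x : 0 <= C x.
Proof. by rewrite addr_ge0// !mulr_ge0. Qed.

Let a_close L e beta c' q' a' th' x t :
  approx_system lambda mu T (ranked u) K L e beta c' q' a' th' ->
  (forall t x, 0 <= t <= T -> `|q' t x - q t x| <= e) ->
  Iplus x -> (x.2 <= L)%N -> 0 <= t <= T -> `|a' t x - a t x| <= C x * e.
Proof.
move=> S qq Ix xL tT; have /andP[t0 tT'] := tT.
have T0 : 0 <= (0 : R) <= T by rewrite lexx.
have /ler_normlP[e1 e2] := approx_eq S tT Ix xL.
have /ler_normlP[f1 f2] := qq t x tT; have /ler_normlP[g1 g2] := qq 0 x T0.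
have bq' y : bounded_measurable T (q'^~ y) by exact: approx_bounded S.
have bd' : bounded_measurable T (dep mu q' x).
  by apply: bounded_measurableZ; apply: bounded_measurableB.
have mj : 0 <= mu * x.2%:R by rewrite mulr_ge0.
have : `|cumul (fun s => dep mu q' x s - dep mu q x s) t
       - cumul (fun s => dep mu q' x s - dep mu q x s) 0| <=
    cumul (fun=> mu * x.2%:R * (2 * e)) t - cumul (fun=> mu * x.2%:R * (2 * e)) 0.
  apply: (@cumul_norm_le _ T) => //.
  - exact: bounded_measurableB.
  - exact: bounded_measurable_cst.
  - move=> s /andP[s0 st].
    have sT : 0 <= s <= T by rewrite ltW//= (le_trans st).
    have -> : dep mu q' x s - dep mu q x s = mu * x.2%:R *
      ((q' s x - q s x) - (q' s (next x) - q s (next x))) by rewrite /dep; ring.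
    rewrite normrM ger0_norm// ler_wpM2l//.
    apply: le_trans (ler_normB _ _) _.
    by have h1 := qq s x sT; have h2 := qq s (next x) sT; lra.
rewrite !cumul0 !subr0 cumul_cst// (@cumulB _ T)// => /ler_normlP[k1 k2].
have e0 : 0 <= e by exact: le_trans (normr_ge0 _) (qq t x tT).
have : mu * x.2%:R * (2 * e) * t <= mu * x.2%:R * (2 * e) * T.
  by rewrite ler_wpM2l// mulr_ge0// mulr_ge0.
rewrite ler_norml /a /limit_arrivals /C => k3; apply/andP; split; lra.
Qed.

Let a_mono x s t : Iplus x -> 0 <= s -> s <= t -> t <= T -> a s x <= a t x.
Proof.
move=> Ix s0 st tT; apply: (@ler_eps _ _ _ (2 * C x)); first by rewrite mulr_ge0.
move=> e e0; have [L [beta [c' [q' [a' [th' [xL S qq _]]]]]]] := approximable x.2 e0.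
have sT : 0 <= s <= T by rewrite s0 (le_trans st).
have tT' : 0 <= t <= T by rewrite (le_trans s0).
have /ler_normlP[h1 h2] := a_close S qq Ix xL sT.
have /ler_normlP[h3 h4] := a_close S qq Ix xL tT'.
have := approx_mono S x s0 st tT; lra.
Qed.

Let a_out x t : Iplus x -> (forall l, (l < K)%N -> x <> ranked u l) ->
  0 <= t <= T -> a t x = 0.
Proof.
move=> Ix nx tT; apply/eqP; rewrite -normr_eq0 eq_le normr_ge0 andbT.
apply: (@ler_eps _ _ _ (C x)) => // e e0; rewrite add0r.
have [L [beta [c' [q' [a' [th' [xL S qq _]]]]]]] := approximable x.2 e0.
have := a_close S qq Ix xL tT.
by rewrite (approx_out S tT Ix nx) sub0r normrN.
Qed.

Let ov k t := overflow (ranked u) a (fun t => lambda * t) k t.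

Let M := \max_(l < K) (ranked u l).2.

Let MP l : (l < K)%N -> ((ranked u l).2 <= M)%N.
Proof.
by move=> lK; exact: (@leq_bigmax _ (fun l : 'I_K => (ranked u l).2) (Ordinal lK)).
Qed.

Let D := \sum_(l < K) C (ranked u l).

Let D_ge0 : 0 <= D. Proof. exact: sumr_ge0. Qed.

Let ov_close L e beta c' q' a' th' k t :
  approx_system lambda mu T (ranked u) K L e beta c' q' a' th' ->
  (forall t x, 0 <= t <= T -> `|q' t x - q t x| <= e) ->
  (M <= L)%N -> (k < K)%N -> 0 <= t <= T ->
  `|overflow (ranked u) a' th' k t - ov k t| <= (1 + D) * e.
Proof.
move=> S qq ML kK tT.
have e0 : 0 <= e by exact: le_trans (normr_ge0 _) (qq t (ord0, 0%N) tT).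
have -> : overflow (ranked u) a' th' k t - ov k t =
  (th' t - lambda * t) - (mass (ranked u) k (a' t) - mass (ranked u) k (a t)).
  by rewrite /ov /overflow; ring.
apply: le_trans (ler_normB _ _) _; rewrite mulrDl mul1r.
apply: lerD; first exact: approx_arrivals S _ tT.
rewrite /mass -sumrB; apply: le_trans (ler_norm_sum _ _ _) _.
apply: (@le_trans _ _ (\sum_(l < k.+1) C (ranked u l) * e)).
  apply: ler_sum => l _; have lK : (l < K)%N := leq_trans (ltn_ord l) kK.
  by apply: a_close S qq _ _ tT => //; exact: leq_trans (MP lK) ML.
rewrite -mulr_suml ler_wpM2r//.
exact: (@ler_sum_ord_widen _ (fun l => C (ranked u l)) k.+1 K kK).
Qed.

Let ov_mono k s t : (k < K)%N -> 0 <= s -> s <= t -> t <= T -> ov k s <= ov k t.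
Proof.
move=> kK s0 st tT; apply: (@ler_eps _ _ _ (2 * (1 + D))); first by rewrite mulr_ge0// addr_ge0.
move=> e e0; have [L [beta [c' [q' [a' [th' [ML S qq _]]]]]]] := approximable M e0.
have sT : 0 <= s <= T by rewrite s0 (le_trans st).
have tT' : 0 <= t <= T by rewrite (le_trans s0).
have /ler_normlP[h1 h2] := ov_close S qq ML kK sT.
have /ler_normlP[h3 h4] := ov_close S qq ML kK tT'.
have /andP[h5 _] := approx_overflow S kK s0 st tT; lra.
Qed.

(** Arrivals at one listed position are at most those at all [K] of them, and these grow no faster
    than [lambda * t] because the overflow beyond the last one is monotone. *)
Let a_lipschitz x s t : Iplus x -> 0 <= s -> s <= t -> t <= T ->
  `|a t x - a s x| <= lambda * (t - s).
Proof.
move=> Ix s0 st tT; rewrite ger0_norm ?subr_ge0; last exact: a_mono.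
have sT : 0 <= s <= T by rewrite s0 (le_trans st).
have tT' : 0 <= t <= T by rewrite (le_trans s0).
have [[l lK xl]|nF] := pselect (exists2 l, (l < K)%N & x = ranked u l); last first.
  have nx l : (l < K)%N -> x <> ranked u l by move=> lK E; apply: nF; exists l.
  by rewrite !a_out// subrr mulr_ge0// subr_ge0.
have kK : (K.-1 < K)%N by rewrite prednK.
have := ov_mono kK s0 st tT; rewrite /ov /overflow /mass prednK// => h.
have : a t x - a s x <= \sum_(l < K) (a t (ranked u l) - a s (ranked u l)).
  rewrite (bigD1 (Ordinal lK))//= xl lerDl sumr_ge0// => l' _.
  by rewrite subr_ge0; exact: a_mono.
rewrite sumrB; lra.
Qed.

Let cumul_lipschitz x s t : 0 <= s -> s <= t -> t <= T ->
  0 <= cumul (dep mu q x) t - cumul (dep mu q x) s <= mu * x.2%:R * (t - s).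
Proof.
move=> s0 st tT.
have H r : s < r <= t -> 0 <= dep mu q x r <= mu * x.2%:R.
  by move=> /andP[sr rt]; apply: dep_01; rewrite (le_trans s0 (ltW sr)) (le_trans rt).
apply/andP; split.
  rewrite -(mul0r (t - s)); apply: (cumul_ge_cst (dep_bounded x)) => // r /H.
  by case/andP.
by apply: (cumul_le_cst (dep_bounded x)) => // r /H; case/andP.
Qed.

Let qE t x : q t x = q 0 x + a t x - cumul (dep mu q x) t.
Proof. by rewrite /a/limit_arrivals; ring. Qed.

Lemma limit_lipschitz x s t : 0 <= s -> s <= t -> t <= T ->
  `|q t x - q s x| <= (lambda + mu * x.2%:R) * (t - s).
Proof.
move=> s0 st tT.
have sT : 0 <= s <= T by rewrite s0 (le_trans st).
have tT' : 0 <= t <= T by rewrite (le_trans s0).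
have [x0|xn] := eqVneq x.2 0%N.
  case: x x0 => i j /= ->; have [_ _ _ h1] := state sT; have [_ _ _ h2] := state tT'.
  by rewrite h1 h2 subrr normr0 mulr0 addr0 mulr_ge0// subr_ge0.
have Ix : Iplus x by rewrite /Iplus/= lt0n.
have /ler_normlP[h1 h2] := a_lipschitz Ix s0 st tT.
have /andP[h3 h4] := cumul_lipschitz x s0 st tT.
rewrite (qE t) (qE s) ler_norml; apply/andP; split.
  have : 0 <= a t x - a s x by rewrite subr_ge0; exact: a_mono.
  have : 0 <= lambda * (t - s) by rewrite mulr_ge0// subr_ge0.
  lra.
lra.
Qed.

Let q_ac x : abs_continuous 0 T (q^~ x).
Proof. by apply: lipschitz_abs_continuous => s t; exact: limit_lipschitz. Qed.

Let mass_lipschitz k s t : 0 <= s -> s <= t -> t <= T ->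
  `|mass (ranked u) k (q t) - mass (ranked u) k (q s)| <=
  (\sum_(l < k.+1) (lambda + mu * (ranked u l).2%:R)) * (t - s).
Proof.
move=> s0 st tT; rewrite /mass -sumrB mulr_suml.
apply: le_trans (ler_norm_sum _ _ _) _.
by apply: ler_sum => l _; exact: limit_lipschitz.
Qed.

(** By the Lipschitz bound the mass stays below capacity with a margin around [t]. Close enough
    approximate systems are then below their own capacity on the same window, where their overflow
    is constant; so is the limit. *)
Let ov_locally_constant k t : (k < K)%N -> 0 < t < T ->
  mass (ranked u) k (q t) < cap k -> is_derive t (1 : R) (ov k) 0.
Proof.
move=> kK /andP[t0 tT] vc.
pose B := \sum_(l < k.+1) (lambda + mu * (ranked u l).2%:R).
have B0 : 0 <= B by apply: sumr_ge0 => l _; rewrite addr_ge0// mulr_ge0.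
(* One third of the gap pays for the motion of the mass on the window, one for the approximation
   error [(K + 1) * e'], and one keeps the inequality strict. *)
pose rho := (cap k - mass (ranked u) k (q t)) / 3.
have rho0 : 0 < rho by rewrite divr_gt0// subr_gt0.
pose h := Num.min (rho / (B + 1)) (Num.min t (T - t)).
have B1 : 0 < B + 1 by rewrite ltr_wpDl.
have h0 : 0 < h by rewrite !lt_min divr_gt0// t0 subr_gt0.
have hB : B * h <= rho.
  have : h <= rho / (B + 1) by rewrite ge_min lexx.
  rewrite ler_pdivlMr// => hB; have : 0 <= h by exact: ltW.
  lra.
have ht : h <= t by rewrite /h !ge_min lexx orbT.
have hT : h <= T - t by rewrite /h !ge_min lexx !orbT.
have low r : t - h <= r <= t + h -> mass (ranked u) k (q r) <= cap k - 2 * rho.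
  move=> /andP[r1 r2].
  have : mass (ranked u) k (q r) <= mass (ranked u) k (q t) + rho.
    have [rt|tr] := leP r t.
      have rr0 : 0 <= r by lra.
      have := @mass_lipschitz k r t rr0 rt (ltW tT); rewrite -/B => /ler_normlP[l1 l2].
      have : B * (t - r) <= B * h by rewrite ler_wpM2l//; lra.
      lra.
    have rrT : r <= T by lra.
    have := @mass_lipschitz k t r (ltW t0) (ltW tr) rrT; rewrite -/B => /ler_normlP[l1 l2].
    have : B * (r - t) <= B * h by rewrite ler_wpM2l//; lra.
    lra.
  by rewrite /rho; lra.
have d0 : is_derive t (1 : R) (fun _ : R => ov k t) 0 by exact: is_derive_cst.
have key r s : t - h < r -> r <= s -> s <= t + h -> ov k s <= ov k r.
  move=> hr rs sh; apply: (@ler_eps _ _ _ (2 * (1 + D) + 0)).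
    by rewrite addr0 mulr_ge0// addr_ge0.
  move=> e; rewrite addr0 => e0.
  pose e' := Num.min e (rho / (K%:R + 1)).
  have K1 : 0 < K%:R + 1 :> R by rewrite ltr_wpDl.
  have e'0 : 0 < e' by rewrite lt_min e0 divr_gt0.
  have e'e : e' <= e by rewrite ge_min lexx.
  have e'r : (K%:R + 1) * e' <= rho.
    have : e' <= rho / (K%:R + 1) by rewrite ge_min lexx orbT.
    by rewrite ler_pdivlMr// mulrC.
  have [L [beta [c' [q' [a' [th' [ML S qq cc]]]]]]] := approximable M e'0.
  have th0 : 0 <= t - h by lra.
  have sT : s <= T by lra.
  have const : overflow (ranked u) a' th' k r = overflow (ranked u) a' th' k s.
    apply: (approx_reflection S kK th0 (lt_le_trans hr rs) sT); last by rewrite hr.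
    move=> z /andP[hz zs].
    have zT : 0 <= z <= T by apply/andP; split; lra.
    have hh : t - h <= z <= t + h by apply/andP; split; lra.
    have h1 := low z hh.
    have h2 : mass (ranked u) k (q' z) <= mass (ranked u) k (q z) + K%:R * e'.
      rewrite -lerBlDl /mass -sumrB.
      apply: (@le_trans _ _ (\sum_(l < k.+1) e')).
        by apply: ler_sum => l _; have /ler_normlP[] := qq z (ranked u l) zT.
      rewrite big_const_ord iter_addr addr0 -[e' *+ _]mulr_natl ler_wpM2r ?(ltW e'0)//.
      by rewrite ler_nat.
    have /ler_normlP[h3 h4] := cc k kK; lra.
  have rT : 0 <= r <= T by apply/andP; split; lra.
  have sT' : 0 <= s <= T by apply/andP; split; lra.
  have /ler_normlP[h1 h2] := ov_close S qq ML kK rT.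
  have /ler_normlP[h3 h4] := ov_close S qq ML kK sT'.
  have : (1 + D) * e' <= (1 + D) * e by rewrite ler_wpM2l// addr_ge0.
  lra.
move: d0; apply: is_derive_near_eq.
apply/nbhs_ballP; exists h => // r; rewrite /ball/= ltr_norml => /andP[r1 r2].
apply/eqP; rewrite eq_le.
have [rt|tr] := leP r t.
  by rewrite key ?ov_mono//; lra.
by rewrite ov_mono ?key//; lra.
Qed.

Let mass_le k t : (k < K)%N -> 0 <= t <= T ->
  mass (ranked u) k (q t) <= mass (ranked u) k (q 0) + lambda * t - ov k t.
Proof.
move=> kK /andP[t0 tT].
suff : mass (ranked u) k (q t) <= mass (ranked u) k (q 0) + mass (ranked u) k (a t).
  by rewrite /ov /overflow; lra.
rewrite /mass -big_split/=; apply: ler_sum => l _; rewrite (qE t) gerBl.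
by have /andP[] := cumul_lipschitz (ranked u l) (lexx _) t0 tT; rewrite cumul0 subr0.
Qed.

Let not_full t : 0 <= t <= T -> mass (ranked u) K.-1 (q t) < cap K.-1.
Proof.
move=> tT; have kK : (K.-1 < K)%N by rewrite prednK.
have /andP[t0 tT'] := tT.
have := mass_le kK tT; have := ov_mono kK (lexx _) t0 tT'.
rewrite {1}/ov {1}/overflow mulr0 sub0r {1}/mass big1; last by move=> l _; exact: a0.
have : lambda * t <= lambda * T by rewrite ler_wpM2l.
have : mass (ranked u) K.-1 (q 0) + lambda * T < cap K.-1.
  by rewrite /cap /mass prednK.
lra.
Qed.

Let sigma_ranked t : 0 <= t <= T ->
  exists2 s, (s < K)%N & sigma u (q t) = ranked u s.
Proof.
move=> tT; apply/ranked_uptoP; apply: contraT => ns; exfalso.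
have := not_full tT.
have full := @sigma_notin_full _ _ u u_concave alpha (q t) (Qfluid_start (state tT))
  (Qfluid_mono (state tT)) (Qfluid_drop alpha_gt0 (state tT)) K ns.
rewrite /cap /mass (eq_bigr (fun l : 'I_K.-1.+1 => alpha (ranked u l).1)) ?ltxx// => l _.
by apply: full; apply: (leq_trans (ltn_ord l)); rewrite prednK.
Qed.

(** The position [sigma] itself is strictly below its capacity, and no other exceeds its own. *)
Let mass_lt k (s : nat) t : 0 <= t <= T -> sigma u (q t) = ranked u s -> (s <= k)%N ->
  mass (ranked u) k (q t) < cap k.
Proof.
move=> tT sE sk; rewrite /cap /mass.
have sk' : (s < k.+1)%N by [].
rewrite (bigD1 (Ordinal sk'))//= [X in _ < X](bigD1 (Ordinal sk'))//=.
apply: ltr_leD.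
  rewrite -sE; apply: (@sigma_lt _ _ u u_concave alpha).
  - exact: Qfluid_start (state tT).
  - exact: Qfluid_mono (state tT).
  - exact: Qfluid_drop (state tT).
by apply: ler_sum => l _; exact: Qfluid_le (state tT).
Qed.

Let dep_continuous x t : 0 < t < T -> {for t, continuous (dep mu q x)}.
Proof.
move=> tT; apply: cvgM; first exact: cvg_cst.
by apply: cvgB; exact: (abs_continuous_continuous (q_ac _) tT).
Qed.

Let cumul_derive x t : 0 < t < T ->
  is_derive t (1 : R) (cumul (dep mu q x)) (dep mu q x t).
Proof. by move=> tT; exact: is_derive_cumul (dep_bounded x) tT (@dep_continuous x t tT). Qed.

Let linear_derive t : is_derive t (1 : R) (fun t => lambda * t) lambda.
Proof.
have d : is_derive t (1 : R) (fun t => lambda * t) (lambda *: (1 : R)) by exact: is_deriveZ.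
by apply: (is_derive_eq d); rewrite /GRing.scale/= mulr1.
Qed.

Let a_q_derive x t d : 0 < t < T -> is_derive t (1 : R) (a^~ x) d ->
  is_derive t (1 : R) (q^~ x) (d - dep mu q x t).
Proof.
move=> tT da; have dc := cumul_derive x tT.
have d0 : is_derive t (1 : R) (fun _ : R => q 0 x) 0 by exact: is_derive_cst.
have := is_deriveB (is_deriveD d0 da) dc; rewrite add0r.
apply: is_derive_ext => s; rewrite [RHS]qE//.
Qed.

Let q_a_derive x t d : 0 < t < T -> is_derive t (1 : R) (q^~ x) d ->
  is_derive t (1 : R) (a^~ x) (d + dep mu q x t).
Proof.
move=> tT dq; have dc := cumul_derive x tT.
have d0 : is_derive t (1 : R) (fun _ : R => - q 0 x) 0 by exact: is_derive_cst.
by have := is_deriveD (is_deriveD dq d0) dc; rewrite addr0.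
Qed.

(** The free capacity [z] is nonnegative and Lipschitz. Where it is positive the overflow is locally
    constant, so it moves at the continuous rate [g], total departures minus [lambda]: it is a
    reflected path. *)
Let mass_ae_derivable k : (k < K)%N ->
  {ae leb, forall t, 0 < t < T -> derivable (fun s => mass (ranked u) k (q s)) t 1}.
Proof.
move=> kK.
pose z0 s := cap k - mass (ranked u) k (q s).
pose g0 s := \sum_(l < k.+1) dep mu q (ranked u l) s - lambda.
pose z s := z0 (clamp T s); pose g s := g0 (clamp T s).
pose B := \sum_(l < k.+1) (lambda + mu * (ranked u l).2%:R).
have B0 : 0 <= B by apply: sumr_ge0 => l _; rewrite addr_ge0// mulr_ge0.
have z0L s t : 0 <= s <= T -> 0 <= t <= T -> `|z0 s - z0 t| <= B * `|s - t|.
  wlog st : s t / s <= t => [W sT tT|/andP[s0 sT] /andP[t0 tT]].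
    have [st|/ltW ts] := leP s t; first exact: W.
    by rewrite distrC (distrC s); exact: W.
  rewrite (distrC s) (ger0_norm (x := t - s)) ?subr_ge0//.
  have -> : z0 s - z0 t = mass (ranked u) k (q t) - mass (ranked u) k (q s) by rewrite /z0; ring.
  exact: mass_lipschitz.
have zL s t : `|z s - z t| <= B * `|s - t|.
  apply: le_trans (z0L _ _ (clamp_in _ T_ge0) (clamp_in _ T_ge0)) _.
  by rewrite ler_wpM2l// clamp_lipschitz.
have cz : continuous z by exact: lipschitz_continuous zL.
have cq x : continuous (fun s => q (clamp T s) x).
  apply: (@lipschitz_continuous _ _ (lambda + mu * x.2%:R)) => s t.
  have := clamp_lipschitz s t T_ge0; have := clamp_in s T_ge0; have := clamp_in t T_ge0.
  have D0 : 0 <= lambda + mu * x.2%:R by rewrite addr_ge0// mulr_ge0.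
  move: (clamp T s) (clamp T t) => s' t' /andP[t0 tT'] /andP[s0 sT'] st.
  apply: (@le_trans _ _ ((lambda + mu * x.2%:R) * `|s' - t'|)); last by rewrite ler_wpM2l.
  have [st'|/ltW ts'] := leP s' t'.
    by rewrite distrC (distrC s') (ger0_norm (x := t' - s')) ?subr_ge0//; exact: limit_lipschitz.
  by rewrite (ger0_norm (x := s' - t')) ?subr_ge0//; exact: limit_lipschitz.
have cg : continuous g.
  move=> t; apply: cvgB; last exact: cvg_cst.
  apply: (cvg_big add_continuous) => l _; apply: cvgM; first exact: cvg_cst.
  by apply: cvgB; exact: cq.
have zge s : 0 <= s <= T -> 0 <= z s.
  move=> sT; rewrite /z clamp_id// subr_ge0; apply: ler_sum => l _.
  exact: Qfluid_le (state sT).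
have zd s : 0 < s < T -> 0 < z s -> is_derive s (1 : R) z (g s).
  move=> sT; have sT' : 0 <= s <= T by case/andP: sT => h1 h2; rewrite !ltW.
  rewrite /z /g clamp_id// subr_gt0 => vc.
  have dov := ov_locally_constant kK sT vc.
  have dsum : is_derive s (1 : R) (fun r => \sum_(l < k.+1) cumul (dep mu q (ranked u l)) r)
      (\sum_(l < k.+1) dep mu q (ranked u l) s).
    apply: (@is_derive_sum_ord _ k.+1 (fun l => cumul (dep mu q (ranked u l)))
      (fun l => dep mu q (ranked u l) s)) => l _; exact: cumul_derive.
  have dc : is_derive s (1 : R) (fun _ : R => cap k - mass (ranked u) k (q 0)) 0.
    exact: is_derive_cst.
  have := is_deriveB (is_deriveD (is_deriveD dc dsum) dov) (linear_derive s).
  rewrite add0r addr0; apply: is_derive_near_eq.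
  have := clamp_near sT; apply: filterS => r ->.
  rewrite /z0 /ov /overflow /mass.
  have -> : \sum_(l < k.+1) q r (ranked u l) = \sum_(l < k.+1) q 0 (ranked u l) +
     \sum_(l < k.+1) a r (ranked u l) - \sum_(l < k.+1) cumul (dep mu q (ranked u l)) r.
    by rewrite -big_split/= -sumrB; apply: eq_bigr => l _; exact: qE.
  rewrite -[LHS]/(cap k - \sum_(l < k.+1) q 0 (ranked u l) +
    \sum_(l < k.+1) cumul (dep mu q (ranked u l)) r +
    (lambda * r - \sum_(l < k.+1) a r (ranked u l)) - lambda * r).
  by ring.
have zL' s r : 0 <= s <= T -> 0 <= r <= T -> `|z s - z r| <= B * `|s - r|.
  by move=> _ _; exact: zL.
have := reflected_path_ae_derivable cz cg zge zL' zd.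
apply: filterS; first exact: (ae_filter_ringOfSetsType leb).
move=> t Ht tT; have dz : is_derive t (1 : R) z ('D_1 z t) by split => //; exact: Ht.
have dcap : is_derive t (1 : R) (fun _ : R => cap k) 0 by exact: is_derive_cst.
have : is_derive t (1 : R) (fun s => mass (ranked u) k (q s)) (0 - 'D_1 z t).
  have := is_deriveB dcap dz; apply: is_derive_near_eq.
  have := clamp_near tT; apply: filterS => r E.
  by rewrite -[LHS]/(cap k - z0 (clamp T r)) E /z0; ring.
by move=> ?; exact: ex_derive.
Qed.

Let good t := forall k, (k < K)%N -> derivable (fun s => mass (ranked u) k (q s)) t 1.

Let q_derivable l t : (l < K)%N -> good t -> derivable (q^~ (ranked u l)) t 1.
Proof.
move=> lK gt; have := gt l lK; case: l lK => [|l] lK.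
  have -> : (fun s => mass (ranked u) 0 (q s)) = q^~ (ranked u 0).
    by apply/funext => s; rewrite /mass big_ord1.
  by [].
move=> d1; have d2 := gt l (ltnW lK).
have -> : q^~ (ranked u l.+1) = (fun s => mass (ranked u) l.+1 (q s)) - (fun s => mass (ranked u) l (q s)).
  by apply/funext => s; rewrite -[RHS]/(mass _ l.+1 (q s) - mass _ l (q s)) massS; ring.
exact: derivableB.
Qed.

(** Below [sigma], arrivals are a difference of two locally constant overflows, or vanish if
    unlisted. Above it, the coordinate is at its maximum, so arrivals match departures. At [sigma]
    itself remains the part of [lambda] not yet used, and its sign comes from the monotonicity of
    [a]. *)
Let fluid_at t x : 0 < t < T -> good t -> Iplus x ->
  is_derive t (1 : R) (a^~ x) (Lambda lambda mu u alpha (q t) x) /\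
  0 <= Lambda lambda mu u alpha (q t) x.
Proof.
move=> tT gt Ix; have /andP[t0 tT'] := tT.
have tTc : 0 <= t <= T by rewrite !ltW.
have [s sK sE] := sigma_ranked tTc.
have ov0 k : (s <= k)%N -> (k < K)%N -> is_derive t (1 : R) (ov k) 0.
  by move=> sk kK; apply: ov_locally_constant => //; exact: mass_lt sE sk.
have below y : Iplus y -> rank_lt u y (ranked u s) ->
    is_derive t (1 : R) (a^~ y) (Lambda lambda mu u alpha (q t) y).
  move=> Iy ys; rewrite Lambda_below ?sE//.
  have [[l lK yl]|nF] := pselect (exists2 l, (l < K)%N & y = ranked u l); last first.
    have d0 : is_derive t (1 : R) (fun _ : R => 0 : R) 0 by exact: is_derive_cst.
    move: d0; apply: is_derive_near_eq; near=> r; rewrite a_out//.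
      by move=> l lK E; apply: nF; exists l.
    apply/andP; split; apply: ltW; near: r; [exact: lt_nbhsr|exact: lt_nbhsl].
  have sl : (s < l)%N.
    rewrite ltnNge leq_eqVlt; apply/negP => /orP[/eqP ls|ls].
      by move: ys; rewrite yl ls rank_lt_irr.
    have := rank_lt_trans (ranked_lt u_concave ls) _; rewrite -yl => /(_ _ ys).
    by rewrite rank_lt_irr.
  case: l sl lK yl => // l sl lK yl.
  have := is_deriveB (ov0 l sl (ltnW lK)) (ov0 l.+1 (ltnW sl) lK).
  rewrite subrr; apply: is_derive_ext => r.
  by rewrite -[LHS]/(ov l r - ov l.+1 r) /ov /overflow massS yl; ring.
have above l : (l < s)%N ->
    is_derive t (1 : R) (a^~ (ranked u l)) (Lambda lambda mu u alpha (q t) (ranked u l)) /\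
    0 <= Lambda lambda mu u alpha (q t) (ranked u l).
  move=> ls; have lK := ltn_trans ls sK.
  have full : q t (ranked u l) = alpha (ranked u l).1.
    apply: (@sigma_above _ _ u u_concave alpha) => //.
    - exact: Qfluid_start (state tTc).
    - exact: Qfluid_mono (state tTc).
    - exact: Qfluid_drop (state tTc).
    - by rewrite sE; exact: ranked_lt.
  rewrite (Lambda_above _ _ _ u_concave sE ls).
  have -> : mu * (ranked u l).2%:R * (alpha (ranked u l).1 - q t ((ranked u l).1, (ranked u l).2.+1))
     = dep mu q (ranked u l) t by rewrite /dep full.
  have dq : is_derive t (1 : R) (q^~ (ranked u l)) ('D_1 (q^~ (ranked u l)) t).
    by split => //; exact: q_derivable.
  have d0 : 'D_1 (q^~ (ranked u l)) t = 0.
    apply: (is_derive_max dq); near=> r; rewrite full; apply: Qfluid_le; apply: state.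
    apply/andP; split; apply: ltW; near: r; [exact: lt_nbhsr|exact: lt_nbhsl].
  have := q_a_derive tT dq; rewrite d0 add0r => da; split => //.
  by have /andP[] := dep_01 (ranked u l) tTc.
have at_s : is_derive t (1 : R) (a^~ (ranked u s)) (Lambda lambda mu u alpha (q t) (ranked u s)).
  rewrite (Lambda_at lambda mu alpha u_concave sE).
  have dsum := @is_derive_sum_ord _ s (fun l r => a r (ranked u l)) _ t (fun l ls => (above l ls).1).
  have := is_deriveB (is_deriveB (linear_derive t) dsum) (ov0 s (leqnn _) sK).
  rewrite subr0 (eq_bigr (fun l : 'I_s =>
    mu * (ranked u l).2%:R * (alpha (ranked u l).1 - q t ((ranked u l).1, (ranked u l).2.+1)))); last first.
    by move=> l _; exact: (Lambda_above _ _ _ u_concave sE).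
  apply: is_derive_ext => r.
  rewrite -[LHS]/(lambda * r - \sum_(l < s) a r (ranked u l) - ov s r).
  by rewrite /ov /overflow /mass big_ord_recr/=; ring.
have at0 : 0 <= Lambda lambda mu u alpha (q t) (ranked u s).
  apply: (is_derive_nondecreasing_ge0 tT _ at_s) => r1 r2 h1 h2 h3.
  exact: a_mono.
have [->//|xs] := eqVneq x (ranked u s).
have [lt|gt'] := rank_lt_total u (elimN eqP xs).
  by split; [exact: below|rewrite Lambda_below// sE].
by have [l ls ->] := ranked_gt u_concave Ix gt'; exact: above.
Unshelve. all: by end_near. Qed.

Lemma limit_ae_fluid : {ae leb, forall t, 0 < t < T -> forall x, Iplus x ->
  is_derive t (1 : R) (q^~ x)
    (Lambda lambda mu u alpha (q t) x - mu * x.2%:R * (q t x - q t (x.1, x.2.+1))) /\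
  0 <= Lambda lambda mu u alpha (q t) x}.
Proof.
have : {ae leb, forall t, forall k, (k < K)%N -> 0 < t < T ->
    derivable (fun s => mass (ranked u) k (q s)) t 1}.
  apply: ae_foralln => k; have [kK|Kk] := ltnP k K; last by apply: aeW.
  have := mass_ae_derivable kK; apply: filterS; first exact: (ae_filter_ringOfSetsType leb).
  by move=> t H _; exact: H.
apply: filterS; first exact: (ae_filter_ringOfSetsType leb).
move=> t H tT x Ix; have gt : good t by move=> k kK; exact: H.
have [da L0] := fluid_at tT gt Ix; split => //.
exact: a_q_derive tT da.
Qed.

End limit_system.

(** * Convergence along a fixed outcome *)

Section pathwise.
Context {R : realType} {m : nat}.
Variables (u : 'I_m.+1 -> R -> R) (lambda mu : R).
Variables (A : nat -> 'I_m.+1 -> nat) (alpha : 'I_m.+1 -> R).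
Variables (N : R -> nat) (Nd : idx m -> R -> nat).
Variables (q : nat -> R -> idx m -> R) (q0 : idx m -> R).
Implicit Types (x : idx m) (s t e T : R) (k l n L K : nat).
Hypothesis u_concave : forall i, concave_on [set x : R | 0 <= x] (u i).
Hypothesis lambda_gt0 : 0 < lambda.
Hypothesis mu_gt0 : 0 < mu.
Hypothesis A_ge1 : forall n, (m.+1 <= n)%N -> forall i, (1 <= A n i)%N.
Hypothesis A_sum : forall n, (m.+1 <= n)%N -> (\sum_i A n i)%N = n.
Hypothesis alpha01 : forall i, 0 < alpha i < 1.
Hypothesis A_cvg : forall i, ((A n i)%:R / n%:R : R) @[n --> \oo] --> alpha i.
Hypothesis N0 : N 0 = 0%N.
Hypothesis N_mono : forall s t : R, 0 <= s -> s <= t -> (N s <= N t)%N.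
Hypothesis N_right : \forall s \near 0^'+, N s = N 0.
Hypothesis N_lln : forall T e : R, 0 < e ->
  \forall n \near \oo, forall s, 0 <= s <= T ->
    `|n%:R^-1 * (N (n%:R * s))%:R - s| <= e.
Hypothesis Nd_lln : forall x, Iplus x -> forall T e : R, 0 < e ->
  \forall n \near \oo, forall s, 0 <= s <= T ->
    `|n%:R^-1 * (Nd x (n%:R * s))%:R - s| <= e.
Hypothesis q0_Q : Qfluid alpha q0.
Hypothesis q_init_cvg : l1norm (q n 0 \- q0) @[n --> \oo] --> 0%E.
Hypothesis q_solution : forall n, (m.+1 <= n)%N ->
  occupancy_solution lambda mu u n (A n) N Nd (q n).

Let alpha_gt0 i : 0 < alpha i. Proof. by have /andP[] := alpha01 i. Qed.
Let mu_ge0 : 0 <= mu. Proof. exact: ltW. Qed.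
Let lambda_ge0 : 0 <= lambda. Proof. exact: ltW. Qed.

Let RI l : Iplus (ranked u l).
Proof. by have [] := rankedP u_concave l. Qed.

Definition horizon T K := \sum_(l < K) q0 (ranked u l) + lambda * T <
  \sum_(l < K) alpha (ranked u l).1.

Let sum_ranked_le_l1norm K : ((\sum_(l < K) q0 (ranked u l))%:E <= l1norm q0)%E.
Proof.
apply: esum_ge; exists (ranked u @` `I_K).
  by split => //; apply: finite_image; exact: finite_II.
rewrite fsbig_image; last by move=> k l _ _; exact: ranked_inj.
rewrite -(fsbig_ord _ K (fun l => `|q0 (ranked u l)|%:E)) sumEFin lee_fin.
by apply: ler_sum => l _; exact: ler_norm.
Qed.

(** The right side is at least [K] times the smallest [alpha i], while the left side is at most
    [l1norm q0] plus [lambda * T] for every [K]. *)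
Let horizon_exists T : exists K, horizon T K.
Proof.
pose i0 := [arg min_(i < ord0) alpha i]%O.
have a_min i : alpha i0 <= alpha i.
  by rewrite /i0; case: arg_minP => // j _; exact.
have [q1 _ _ _] := q0_Q.
have fq : l1norm q0 \is a fin_num by rewrite ge0_fin_numE ?l1norm_ge0.
pose B := fine (l1norm q0) + lambda * T.
exists (Num.truncn (B / alpha i0)).+1; set K := _.+1.
apply: (@le_lt_trans _ _ B).
  by rewrite lerD2r -lee_fin fineK//; exact: sum_ranked_le_l1norm.
apply: (@lt_le_trans _ _ (K%:R * alpha i0)).
  by rewrite -ltr_pdivrMr//; exact: truncnS_gt.
rewrite mulr_natl -[X in _ *+ X](card_ord K) -sumr_const.
by apply: ler_sum => l _; exact: a_min.
Qed.

Let xs_closed K x : Iplus x -> (forall l, (l < K)%N -> x <> ranked u l) ->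
  forall l, (l < K)%N -> next x <> ranked u l.
Proof.
case: x => i j Ix nx l lK E.
have h : (i, j) \notin ranked_upto u K.
  by apply/negP => /ranked_uptoP[k kK]; exact: nx.
have /negP := ranked_upto_closed u_concave Ix h; apply.
by apply/ranked_uptoP; exists l.
Qed.

Let init_close e : 0 < e ->
  \forall n \near \oo, (l1norm (q n 0 \- q0)%R <= e%:E)%E.
Proof.
move=> e0; have : \forall n \near \oo, (l1norm (q n 0 \- q0)%R < e%:E)%E.
  exact: q_init_cvg (@nbhs_open_ereal_lt R 0 (fun=> e) e0).
by apply: filterS => n; exact: ltW.
Qed.

Let A_close e : 0 < e ->
  \forall n \near \oo, forall i, `|(A n i)%:R / n%:R - alpha i| <= e.
Proof.
move=> e0; apply: filter_forall => i.
by have /cvgrPdist_le/(_ e e0) := @A_cvg i; apply: filterS => n; rewrite distrC.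
Qed.

Let Nd_close L T e : 0 < e -> \forall n \near \oo,
  forall x, Iplus x -> (x.2 <= L)%N -> forall s, 0 <= s <= T ->
    `|n%:R^-1 * (Nd x (n%:R * s))%:R - s| <= e.
Proof.
move=> e0.
have : \forall n \near \oo, forall y : 'I_m.+1 * 'I_L.+1, (0 < y.2)%N ->
    forall s, 0 <= s <= T -> `|n%:R^-1 * (Nd (y.1, y.2 : nat) (n%:R * s))%:R - s| <= e.
  apply: filter_forall => -[i j]/=.
  have [j0|] := posnP j; first by apply: nearW => n; rewrite j0.
  by move=> j0; have := @Nd_lln (i, j : nat) j0 T e e0; apply: filterS => n H _.
by apply: filterS => n H [i j] /= Ix jL; exact: (H (i, Ordinal (jL : (j < L.+1)%N))).
Qed.

Definition level K := \max_(l < K) (ranked u l).2.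

Let levelP K l : (l < K)%N -> ((ranked u l).2 <= level K)%N.
Proof.
by move=> lK; exact: (@leq_bigmax _ (fun l : 'I_K => (ranked u l).2) (Ordinal lK)).
Qed.

(** With [eta / 2], two good indices are within [eta] of each other in initial states and
    capacities. *)
Definition good T K L eta beta n :=
  [/\ approx_system lambda mu T (ranked u) K L eta beta
        ((mass (ranked u))^~ (fun x => (A n x.1)%:R / n%:R)) (q n)
        (arrivals lambda u n N (q n)) (arrival_rate_path lambda n N),
      forall x, `|q n 0 x - q0 x| <= eta / 2,
      forall k, (k < K)%N -> `|mass (ranked u) k (fun x => (A n x.1)%:R / n%:R) -
        mass (ranked u) k (fun x => alpha x.1)| <= eta / 2 &
      forall t x, 0 <= t <= T -> (L < x.2)%N -> q n t x <= q n 0 x].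

Lemma eventually_good T K L eta beta : 0 < T -> horizon T K ->
  (level K <= L)%N -> 0 < eta -> (forall x, (L < x.2)%N -> q0 x + eta <= beta) ->
  \forall n \near \oo, good T K L eta beta n.
Proof.
move=> T0 hor KL eta0 tail.
have T_ge0 : 0 <= T by exact: ltW.
pose gap := \sum_(l < K) alpha (ranked u l).1 - (\sum_(l < K) q0 (ranked u l) + lambda * T).
have gap0 : 0 < gap by rewrite subr_gt0.
(* The capacity inequality loses at most [(2 * K + 1) * e], less than [gap], and a mass is off by at
   most [K * e <= eta / 2]. *)
pose e := Num.min eta gap / (2 * K%:R + 2).
have K2 : 0 < 2 * K%:R + 2 :> R by rewrite ltr_wpDl// mulr_ge0.
have e0 : 0 < e by rewrite divr_gt0// lt_min eta0.
have eK : (2 * K%:R + 2) * e <= Num.min eta gap by rewrite mulrC divfK ?gt_eqF.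
have e_gap : (2 * K%:R + 2) * e <= gap by rewrite (le_trans eK)// ge_min lexx orbT.
have e_eta : (2 * K%:R + 2) * e <= eta by rewrite (le_trans eK)// ge_min lexx.
have K_ge0 : 0 <= K%:R :> R by [].
have Ke : 0 <= K%:R * e by rewrite mulr_ge0// ltW.
have ll : forall l, (l < K)%N -> ((ranked u l).2 <= L)%N.
  by move=> l lK; exact: leq_trans (levelP lK) KL.
near=> n.
have mn : (m.+1 <= n)%N by near: n; exists m.+1.
have n0 : (0 < n)%N by exact: leq_trans mn.
have qi x : `|q n 0 x - q0 x| <= e.
  rewrite -lee_fin; apply: le_trans (l1norm_coord (q n 0 \- q0)%R x) _.
  by near: n; exact: init_close.
have An i : `|(A n i)%:R / n%:R - alpha i| <= e.
  by move: i; near: n; exact: A_close.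
have th t : 0 <= t <= T -> `|arrival_rate_path lambda n N t - lambda * t| <= e.
  move=> /andP[t_ge0 tT].
  have H : forall s, 0 <= s <= lambda * T -> `|n%:R^-1 * (N (n%:R * s))%:R - s| <= e.
    by near: n; exact: N_lln.
  have := H (lambda * t); rewrite /arrival_rate_path mulrA; apply.
  by rewrite mulr_ge0//= ler_wpM2l.
have nd x : Iplus x -> (x.2 <= L)%N -> forall s, 0 <= s <= mu * L%:R * T ->
    `|n%:R^-1 * (Nd x (n%:R * s))%:R - s| <= eta.
  by move: x; near: n; exact: Nd_close.
have massn k (f g : idx m -> R) : (k <= K)%N -> (forall x, `|f x - g x| <= e) ->
    `|\sum_(l < k) f (ranked u l) - \sum_(l < k) g (ranked u l)| <= K%:R * e.
  move=> kK fg; rewrite -sumrB; apply: le_trans (ler_norm_sum _ _ _) _.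
  apply: (@le_trans _ _ (\sum_(l < k) e)); first by apply: ler_sum => l _; exact: fg.
  by rewrite big_const_ord iter_addr addr0 -[e *+ _]mulr_natl ler_wpM2r ?(ltW e0)// ler_nat.
have e_le : e <= eta by lra.
have cap : \sum_(l < K) q n 0 (ranked u l) + arrival_rate_path lambda n N T <
    \sum_(l < K) (A n (ranked u l).1)%:R / n%:R.
  have /ler_normlP[h1 h2] := massn K _ _ (leqnn _) qi.
  have /ler_normlP[h3 h4] := massn K _ _ (leqnn _) (fun x => An x.1).
  have TT : 0 <= T <= T by rewrite T_ge0 lexx.
  have /ler_normlP[h5 h6] := th T TT.
  by rewrite /gap in e_gap; lra.
have sol := q_solution mn.
have out := occupancy_out_le u_concave lambda_gt0 mu_ge0 n0 (A_ge1 mn) (A_sum mn)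
  N0 N_mono N_right sol T_ge0 ll cap.
split.
- apply: (@occupancy_approx_system _ _ lambda mu u n (A n) N Nd (q n)) => //.
  + exact: A_ge1.
  + exact: A_sum.
  + by move=> t tT; exact: le_trans (th t tT) e_le.
  + move=> x Lx; apply: le_trans (tail x Lx).
    by have /ler_normlP[] := qi x; lra.
- by move=> x; apply: le_trans (qi x) _; lra.
- move=> k kK; apply: le_trans (massn k.+1 _ _ kK (fun x => An x.1)) _.
  lra.
- by move=> t x tT Lx; exact: out.
Unshelve. all: by end_near. Qed.

Let q0_tail e : 0 < e -> exists L0, forall L, (L0 <= L)%N ->
  forall x, (L < x.2)%N -> q0 x <= e.
Proof.
move=> e0; have [q1 _ _ _] := q0_Q.
have [L0 _ H] : exists2 L0, True & forall L, (L0 <= L)%N -> (l1tail L q0 <= e%:E)%E.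
  by have [L0 ?] := l1tail_cvg q1 e0; exists L0.
exists L0 => L L0L x Lx; rewrite -lee_fin; apply: le_trans (H L L0L).
apply: (@le_trans _ _ `|q0 x|%:E); first by rewrite lee_fin ler_norm.
apply: esum_ge; exists [set x]; last by rewrite fsbig_set1.
by split => // y /= ->.
Qed.

Definition comparison_error T K L eta beta : R :=
  let C0 := \sum_(l < K) mu * (ranked u l).2%:R in
  let eps := beta + 5 * L%:R * eta in
  4 * ((5 * K%:R + 7) * eta + C0 * T * eps) * expR ((8 * C0 + 1) * T) + eps.

(** The multipliers in [comparison_error] depend on [K] and [T] only, so [e1] is fixed before [L],
    [L] is taken large enough for the tail of [q0], and [eta] comes last to beat the factor [L]. *)
Lemma small_error T K e L0 : 0 < T -> 0 < e ->
  exists L beta eta, [/\ (L0 <= L)%N, (level K <= L)%N, 0 < eta <= e,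
    forall x, (L < x.2)%N -> q0 x + eta <= beta &
    comparison_error T K L eta beta <= e].
Proof.
move=> T0 e0.
pose C0 := \sum_(l < K) mu * (ranked u l).2%:R.
have C00 : 0 <= C0 by apply: sumr_ge0 => l _; rewrite mulr_ge0.
pose E := expR ((8 * C0 + 1) * T).
have E0 : 0 < E by exact: expR_gt0.
have C0T : 0 <= C0 * T by rewrite mulr_ge0// ltW.
pose S := 4 * ((5 * K%:R + 7) + 3 * (C0 * T)) * E + 3.
have S3 : 3 <= S by rewrite lerDr !mulr_ge0 ?addr_ge0 ?mulr_ge0// ltW.
have S0 : 0 < S by lra.
pose e1 := e / S.
have e10 : 0 < e1 by exact: divr_gt0.
have e1S : S * e1 = e by rewrite mulrC divfK// gt_eqF.
have [L1 H] := q0_tail e10.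
pose L := maxn L0 (maxn L1 (level K)).
have L5 : 0 < 1 + 5 * L%:R :> R by rewrite ltr_wpDr// mulr_ge0.
pose eta := e1 / (1 + 5 * L%:R).
have eta0 : 0 < eta by exact: divr_gt0.
have etaL : eta + 5 * L%:R * eta = e1.
  by rewrite -{1}(mul1r eta) -mulrDl mulrC divfK// gt_eqF.
have Leta : 0 <= 5 * L%:R * eta by apply: mulr_ge0; [exact: mulr_ge0|exact: ltW].
exists L, (e1 + eta), eta; split.
- exact: leq_maxl.
- by rewrite /L !leq_max leqnn !orbT.
- rewrite eta0/=; have : 3 * e1 <= S * e1 by rewrite ler_wpM2r// ltW.
  lra.
- by move=> x Lx; rewrite lerD2r; apply: H Lx; rewrite /L !leq_max leqnn !orbT.
rewrite /comparison_error -/C0 -/E -e1S /S.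
set eps := e1 + eta + _.
have eps3 : eps <= 3 * e1 by rewrite /eps; lra.
have K7 : 0 <= 5 * K%:R + 7 :> R by rewrite addr_ge0// mulr_ge0.
have h1 : (5 * K%:R + 7) * eta <= (5 * K%:R + 7) * e1 by rewrite ler_wpM2l//; lra.
have h2 : C0 * T * eps <= C0 * T * (3 * e1) by rewrite ler_wpM2l.
have h3 : ((5 * K%:R + 7) * eta + C0 * T * eps) * E <=
    ((5 * K%:R + 7) * e1 + C0 * T * (3 * e1)) * E.
  by rewrite ler_wpM2r ?lerD// ltW.
lra.
Qed.

Let q_level0 n t i : (m.+1 <= n)%N -> 0 <= t -> q n t (i, 0%N) = (A n i)%:R / n%:R.
Proof. by move=> mn t0; have [_ _ _] := occupancy_state (q_solution mn) t0. Qed.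

Lemma q_cauchy T e : 0 < T -> 0 < e ->
  exists n0, forall n n', (n0 <= n)%N -> (n0 <= n')%N ->
    forall t x, 0 <= t <= T -> `|q n t x - q n' t x| <= e.
Proof.
move=> T0 e0; have [K hor] := horizon_exists T.
have [L [beta [eta [_ KL /andP[eta0 etae] tail err]]]] := @small_error T K e 0%N T0 e0.
have [n1 _ H1] := @eventually_good T K L eta beta T0 hor KL eta0 tail.
have [n2 _ H2] := @A_close (e / 2) (divr_gt0 e0 (ltr0Sn _ 1)).
exists (maxn m.+1 (maxn n1 n2)) => n n'; rewrite !geq_max.
move=> /andP[mn /andP[n1n n2n]] /andP[mn' /andP[n1n' n2n']] t x tT.
(* Level 0 is outside [Iplus]; there the state is the class fraction, which converges. *)
have [x0|xn] := eqVneq x.2 0%N.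
  case: x x0 => i j /= ->; have /andP[t0 _] := tT; rewrite !q_level0//.
  have /= /ler_normlP[h1 h2] := H2 n n2n i; have /= /ler_normlP[h3 h4] := H2 n' n2n' i.
  by apply/ler_normlP; split; lra.
have Ix : Iplus x by rewrite /Iplus/= lt0n.
have [S I C _] := H1 n n1n; have [S' I' C' _] := H1 n' n1n'.
have T_ge0 := ltW T0.
have ll : forall l, (l < K)%N -> ((ranked u l).2 <= L)%N.
  by move=> l lK; exact: leq_trans (levelP lK) KL.
apply: le_trans err; apply: (compare_systems lambda_ge0 mu_ge0 T_ge0 RI ll (@xs_closed K) S S' _ _ tT Ix).
- move=> y _ _; have /ler_normlP[h1 h2] := I y; have /ler_normlP[h3 h4] := I' y.
  by apply/ler_normlP; split; lra.
- move=> k kK; have /ler_normlP[h1 h2] := C k kK; have /ler_normlP[h3 h4] := C' k kK.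
  by apply/ler_normlP; split; lra.
Qed.


Definition limit_path t x : R := lim (q n t x @[n --> \oo]).

Let qf := limit_path.

Let horizon_of t : 0 <= t -> exists2 T, 0 < T & 0 <= t <= T.
Proof. by move=> t0; exists (t + 1); [rewrite ltr_wpDl|rewrite t0 lerDl ler01]. Qed.

Let limit_path_cvg t x : 0 <= t -> q n t x @[n --> \oo] --> qf t x.
Proof.
move=> /horizon_of[T T0 tT]; apply: cauchy_cvg; apply: cauchy_exP => e e0.
have e2 : 0 < e / 2 by rewrite divr_gt0.
have [n0 H] := q_cauchy T0 e2; exists (q n0 t x); exists n0 => // n n0n.
rewrite /ball/=; apply: le_lt_trans (H n0 n (leqnn _) n0n t x tT) _; lra.
Qed.

Lemma limit_path_uniform T e : 0 < T -> 0 < e -> \forall n \near \oo,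
  forall t x, 0 <= t <= T -> `|q n t x - qf t x| <= e.
Proof.
move=> T0 e0; have [n0 H] := q_cauchy T0 e0; exists n0 => // n n0n t x tT.
apply: (@ler_eps _ _ _ 1) => // e' e'0; rewrite mul1r.
have /andP[t0 _] := tT.
have /cvgrPdist_le/(_ e' e'0)[n1 _ H1] := @limit_path_cvg t x t0.
have /= h1 := H1 (maxn n0 n1) (leq_maxr _ _).
have h2 := H n (maxn n0 n1) n0n (leq_maxl _ _) t x tT.
rewrite distrC in h1.
by apply: le_trans (ler_distD (q (maxn n0 n1) t x) _ _) _; exact: lerD.
Qed.

Let limit_unique (f : nat -> R) (l l' : R) :
  f n @[n --> \oo] --> l -> f n @[n --> \oo] --> l' -> l = l'.
Proof. by move=> h h'; rewrite -(cvg_lim (@Rhausdorff R) h) (cvg_lim (@Rhausdorff R) h'). Qed.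

Lemma limit_path0 : qf 0 = q0.
Proof.
apply/funext => x; apply: limit_unique (@limit_path_cvg 0 x (lexx 0)) _.
apply/cvgrPdist_le => e e0; apply: filterS (init_close e0) => n h.
rewrite distrC -lee_fin; apply: le_trans h; exact: (l1norm_coord (q n 0 \- q0) x).
Qed.

Let limit_le (f g : nat -> R) (a b : R) : f n @[n --> \oo] --> a ->
  g n @[n --> \oo] --> b -> (\forall n \near \oo, f n <= g n) -> a <= b.
Proof.
move=> fa gb fg; rewrite -(cvg_lim (@Rhausdorff R) fa) -(cvg_lim (@Rhausdorff R) gb).
by apply: ler_lim => //; apply/cvg_ex; [exists a|exists b].
Qed.

Let init_cvg x : q n 0 x @[n --> \oo] --> q0 x.
Proof. by rewrite -limit_path0; exact: (@limit_path_cvg 0 x (lexx 0)). Qed.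

Let large : \forall n \near \oo, (m.+1 <= n)%N. Proof. by exists m.+1. Qed.

Let limit_path_level0 t i : 0 <= t -> qf t (i, 0%N) = alpha i.
Proof.
move=> t0; apply: limit_unique (@limit_path_cvg t _ t0) _.
apply: cvg_trans (@A_cvg i); apply: near_eq_cvg.
by apply: filterS large => n mn; rewrite q_level0.
Qed.

Let limit_path_mono t i j : 0 <= t -> qf t (i, j.+1) <= qf t (i, j) <= qf t (i, 0%N).
Proof.
move=> t0; apply/andP; split; apply: (limit_le (@limit_path_cvg t _ t0) (@limit_path_cvg t _ t0));
  apply: filterS large => n mn;
  by have [_ _ /(_ i j)/andP[]] := occupancy_state (q_solution mn) t0.
Qed.

Let limit_path_ge0 t x : 0 <= t -> 0 <= qf t x.
Proof.
move=> t0; apply: (limit_le (cvg_cst 0) (@limit_path_cvg t x t0)).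
apply: filterS large => n mn; apply: (occupancy_ge0 _ (q_solution mn)) => //.
exact: leq_trans mn.
Qed.

Lemma eventually_tail T : 0 < T -> exists L1, \forall n \near \oo,
  forall t x, 0 <= t <= T -> (L1 < x.2)%N -> q n t x <= q n 0 x.
Proof.
move=> T0; have [K hor] := horizon_exists T.
(* Any admissible parameters will do here, hence the tolerance 1. *)
have [L [beta [eta [_ KL /andP[eta0 _] tail _]]]] := @small_error T K 1 0%N T0 ltr01.
exists L; apply: filterS (@eventually_good T K L eta beta T0 hor KL eta0 tail).
by move=> n [].
Qed.

Let limit_path_tail T : 0 < T ->
  exists L1, forall t x, 0 <= t <= T -> (L1 < x.2)%N -> qf t x <= q0 x.
Proof.
move=> T0; have [L1 H] := eventually_tail T0; exists L1 => t x tT Lx.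
have /andP[t0 _] := tT.
apply: (limit_le (@limit_path_cvg t x t0) (@init_cvg x)).
by apply: filterS H => n; exact.
Qed.

Let q0_ge0 x : 0 <= q0 x.
Proof. by have [_ /(_ x)/andP[]] := q0_Q. Qed.

Let q0_ell1 : (l1norm q0 < +oo)%E.
Proof. by have [] := q0_Q. Qed.

Lemma limit_path_state t : 0 <= t -> Qfluid alpha (qf t).
Proof.
move=> t0; have le1 x : 0 <= qf t x <= 1.
  rewrite limit_path_ge0//=; case: x => i j.
  have /andP[_ h] := limit_path_mono i j t0; apply: le_trans h _.
  by rewrite limit_path_level0//; have /andP[_ /ltW] := alpha01 i.
split => //.
- have [T T0 tT] := horizon_of t0; have [L1 H] := limit_path_tail T0.
  have [C C0 HC] := @l1norm_le R m L1.
  apply: (@le_lt_trans _ _ ((C * 1)%:E + l1tail L1 (qf t))%E).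
    apply: HC => // x _; have /andP[h1 h2] := le1 x; by rewrite ger0_norm.
  apply: (@le_lt_trans _ _ ((C * 1)%:E + l1norm q0)%E).
    rewrite leeD2l//; apply: le_trans (l1tail_norm L1 q0); apply: l1tail_le => x Lx.
    by rewrite !ger0_norm// ?limit_path_ge0//; exact: H.
  by rewrite lte_add_pinfty// ltry.
- by move=> i j; exact: limit_path_mono.
- by move=> i; exact: limit_path_level0.
Qed.

Let approximable T K : 0 < T -> horizon T K -> forall L0 e, 0 < e ->
  exists L beta c' q' a' th', [/\ (L0 <= L)%N,
      approx_system lambda mu T (ranked u) K L e beta c' q' a' th',
      forall t x, 0 <= t <= T -> `|q' t x - qf t x| <= e &
      forall k, (k < K)%N ->
        `|c' k - mass (ranked u) k (fun x => alpha x.1)| <= e].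
Proof.
move=> T0 hor L0 e e0; have [L1 HL] := q0_tail ltr01.
pose L := maxn L0 (maxn L1 (level K)).
have tail x : (L < x.2)%N -> q0 x + e <= 1 + e.
  by move=> Lx; rewrite lerD2r; apply: HL Lx; rewrite /L !leq_max leqnn !orbT.
have KL : (level K <= L)%N by rewrite /L !leq_max leqnn !orbT.
have [n [[S I C _] U]] : exists n, good T K L e (1 + e) n /\
    (forall t x, 0 <= t <= T -> `|q n t x - qf t x| <= e).
  apply: (@filter_ex _ \oo); apply: filterI.
    exact: eventually_good.
  exact: limit_path_uniform.
exists L, (1 + e), ((mass (ranked u))^~ (fun x => (A n x.1)%:R / n%:R)), (q n),
  (arrivals lambda u n N (q n)), (arrival_rate_path lambda n N); split.
- exact: leq_maxl.
- exact: S.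
- exact: U.
- by move=> k kK; apply: le_trans (C k kK) _; lra.
Qed.

Let limit_path_lipschitz T x s t : 0 < T -> 0 <= s -> s <= t -> t <= T ->
  `|qf t x - qf s x| <= (lambda + mu * x.2%:R) * (t - s).
Proof.
move=> T0; have [K hor] := horizon_exists T.
apply: (limit_lipschitz u_concave lambda_ge0 mu_ge0 T0 _ _ (approximable T0 hor)).
  by move=> r /andP[r0 _]; exact: limit_path_state.
by rewrite limit_path0.
Qed.

Lemma limit_path_fluid : fluid_trajectory lambda mu u alpha qf.
Proof.
split; first exact: limit_path_state.
  move=> x T T0; apply: (@lipschitz_abs_continuous _ _ _ _ (lambda + mu * x.2%:R)).
  move=> s t s0 st tT; apply: (@limit_path_lipschitz (T + 1)) => //; first by rewrite ltr_wpDl.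
  by rewrite (le_trans tT)// lerDl.
(* [K] depends on the horizon, so the null sets of countably many horizons are collected. *)
have H1 : {ae @lebesgue_measure R, forall t, forall n : nat, 0 < t < n.+1%:R ->
    forall x, Iplus x -> is_derive t (1 : R) (qf^~ x)
      (Lambda lambda mu u alpha (qf t) x - mu * x.2%:R * (qf t x - qf t (x.1, x.2.+1))) /\
    0 <= Lambda lambda mu u alpha (qf t) x}.
  apply: ae_foralln => n; have T0 : 0 < n.+1%:R :> R by [].
  have [K hor] := horizon_exists n.+1%:R.
  apply: (limit_ae_fluid u_concave alpha_gt0 lambda_ge0 mu_ge0 T0 _ _ (approximable T0 hor)).
    by move=> r /andP[r0 _]; exact: limit_path_state.
  by rewrite limit_path0.
(* Derivatives are two-sided, which rules out time 0. *)
have H0 : {ae @lebesgue_measure R, forall t : R, t != 0}.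
  exists [set 0]; split => //; first exact: lebesgue_measure_set1.
  by move=> t /= /negP; rewrite negbK => /eqP.
have aeF := ae_filter_ringOfSetsType (@lebesgue_measure R).
apply: filterS2 H0 H1 => t tn0 h t0 x Ix.
apply: (h (Num.truncn t)) => //.
by rewrite lt_neqAle eq_sym tn0 t0/= truncnS_gt.
Qed.


Lemma limit_path_unique q' : fluid_trajectory lambda mu u alpha q' ->
  q' 0 = q0 -> forall t, 0 <= t -> q' t = qf t.
Proof.
move=> fq' q'0 t t0; have [T T0 tT] := horizon_of t0.
apply/funext => x; have [x0|xn] := eqVneq x.2 0%N.
  case: x x0 => i j /= ->; rewrite limit_path_level0//.
  by have [/(_ t t0)[_ _ _ ->]] := fq'.
have Ix : Iplus x by rewrite /Iplus/= lt0n.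
apply/eqP; rewrite -subr_eq0 -normr_eq0 eq_le normr_ge0 andbT.
apply: (@ler_eps _ _ _ 2) => // e e0; rewrite add0r.
have [K hor] := horizon_exists T.
have [L [beta [eta [_ KL /andP[eta0 etae] tail err]]]] := @small_error T K e 0%N T0 e0.
have ll : forall l, (l < K)%N -> ((ranked u l).2 <= L)%N.
  by move=> l lK; exact: leq_trans (levelP lK) KL.
(* [[eta *%R lambda]] is the eta-expansion notation for [fun t => lambda * t], unrelated to the real
   [eta]. *)
have S' : approx_system lambda mu T (ranked u) K L eta beta
    ((mass (ranked u))^~ (fun x => alpha x.1)) q' (fluid_arrivals mu q') [eta *%R lambda].
  apply: fluid_approx_system => //; first exact: ltW.
    by rewrite q'0.
  by move=> y Ly; rewrite q'0; have := tail y Ly; lra.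
have [n [[S I C _] U]] : exists n, good T K L eta beta n /\
    (forall t x, 0 <= t <= T -> `|q n t x - qf t x| <= e).
  apply: (@filter_ex _ \oo); apply: filterI.
    exact: eventually_good.
  exact: limit_path_uniform.
have /ler_normlP[h1 h2] := U t x tT.
have : `|q n t x - q' t x| <= e.
  apply: le_trans err.
  apply: (compare_systems lambda_ge0 mu_ge0 (ltW T0) RI ll (@xs_closed K) S S' _ _ tT Ix).
    by move=> y _ _; rewrite q'0; apply: le_trans (I y) _; lra.
  by move=> k kK; apply: le_trans (C k kK) _; lra.
move=> /ler_normlP[h3 h4]; apply/ler_normlP; split; lra.
Qed.

(** Up to level [L] the coordinates share the Lipschitz constant [B]; above it both states lie
    between 0 and [q0], so their difference is dominated by [q0]. *)
Let limit_path_modulus T e : 0 < T -> 0 < e -> exists2 delta : R, 0 < delta &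
  forall s t, 0 <= s <= T -> 0 <= t <= T -> `|s - t| <= delta ->
    (l1norm (qf s \- qf t)%R <= e%:E)%E.
Proof.
move=> T0 e0; have e2 : 0 < e / 2 by rewrite divr_gt0.
have [q1 _ _ _] := q0_Q.
have [L1 H1] := limit_path_tail T0; have [L2 H2] := l1tail_cvg q1 e2.
pose L := maxn L1 L2; have [C C0 HC] := @l1norm_le R m L.
pose B := lambda + mu * L%:R.
have B0 : 0 < B by rewrite ltr_wpDr// mulr_ge0.
have C1 : 0 < C + 1 by rewrite ltr_wpDl.
exists (e / 2 / (C + 1) / B); first by rewrite !divr_gt0.
move=> s t sT tT st; have /andP[s0 sT'] := sT; have /andP[t0 tT'] := tT.
have st' : B * `|s - t| <= e / 2 / (C + 1) by rewrite mulrC -ler_pdivlMr.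
have Lip x : (x.2 <= L)%N -> `|qf s x - qf t x| <= e / 2 / (C + 1).
  move=> xL; apply: le_trans st'.
  have xB : lambda + mu * x.2%:R <= B by rewrite lerD2l ler_wpM2l// ler_nat.
  apply: (@le_trans _ _ ((lambda + mu * x.2%:R) * `|s - t|)); last by rewrite ler_wpM2r.
  have [le_st|/ltW le_ts] := leP s t.
    rewrite distrC (distrC s) (ger0_norm (x := t - s)) ?subr_ge0//.
    exact: limit_path_lipschitz tT'.
  rewrite (ger0_norm (x := s - t)) ?subr_ge0//.
  exact: limit_path_lipschitz sT'.
have tail : (l1tail L (qf s \- qf t)%R <= (e / 2)%:E)%E.
  apply: le_trans (H2 L (leq_maxr _ _)); apply: l1tail_le => x Lx.
  have Lx1 : (L1 < x.2)%N by apply: leq_ltn_trans Lx; exact: leq_maxl.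
  have := H1 s x sT Lx1; have := H1 t x tT Lx1.
  have := limit_path_ge0 x s0; have := limit_path_ge0 x t0.
  rewrite [X in _ -> _ -> _ -> _ -> _ <= X](ger0_norm (@q0_ge0 x)) => h1 h2 h3 h4.
  by apply/ler_normlP; split; rewrite /=; lra.
have e21 : 0 <= e / 2 / (C + 1) by rewrite divr_ge0 ?ltW.
apply: le_trans (HC _ _ e21 Lip) _.
apply: (@le_trans _ _ ((C * (e / 2 / (C + 1)))%:E + (e / 2)%:E)%E); first by rewrite leeD2l.
rewrite -EFinD lee_fin.
have : (C + 1) * (e / 2 / (C + 1)) = e / 2 by rewrite mulrC divfK// gt_eqF.
lra.
Qed.

Lemma limit_path_cadlag : cadlag qf.
Proof.
split.
- by move=> t t0; have [] := limit_path_state t0.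
- move=> t t0; apply: l1_cvg0 => e e0.
  have [d d0 H] := @limit_path_modulus (t + 1) e (ltr_wpDl t0 ltr01) e0.
  near=> s; have ts : t < s by near: s; exact: nbhs_right_gt.
  have sd : s < t + d by near: s; apply: nbhs_right_lt; rewrite ltrDl.
  have s1 : s < t + 1 by near: s; apply: nbhs_right_lt; rewrite ltrDl.
  apply: H; [lra|lra|].
  by rewrite gtr0_norm ?subr_gt0//; lra.
- move=> t t0; exists (qf t); first by have [] := limit_path_state (ltW t0).
  apply: l1_cvg0 => e e0.
  have [d d0 H] := limit_path_modulus t0 e0.
  near=> s; have ts : s < t by near: s; exact: nbhs_left_lt.
  have sd : t - d < s by near: s; apply: nbhs_left_gt; rewrite gtrBl.
  have s0 : 0 < s by near: s; exact: nbhs_left_gt.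
  apply: H; [lra|lra|].
  by rewrite ltr0_norm ?subr_lt0//; lra.
Unshelve. all: by end_near. Qed.

Lemma limit_path_cvg_D : cvg_D q qf.
Proof.
split; last 2 first.
- exact: limit_path_cadlag.
- move=> D cD D0 e e0.
  have [T T0 DT] : exists2 T, 0 < T & forall t, D t -> 0 <= t <= T.
    have [M [_ HM]] := compact_bounded cD.
    exists (`|M| + 1); first by rewrite ltr_wpDl.
    move=> t Dt; rewrite D0//=; apply: le_trans (ler_norm t) _.
    by apply: (HM (`|M| + 1)) => //; rewrite (le_lt_trans (ler_norm M))// ltrDl.
  (* One quarter each for the levels up to [L], the initial distance and the tail of [q0]; the last
     one keeps the inequality strict. *)
  have e4 : 0 < e / 4 by rewrite divr_gt0.
  have [q1 _ _ _] := q0_Q.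
  have [L1 H1] := limit_path_tail T0; have [L2 H2] := l1tail_cvg q1 e4.
  have [L3 H3] := eventually_tail T0.
  pose L := maxn L1 (maxn L2 L3); have [C C0 HC] := @l1norm_le R m L.
  have C1 : 0 < C + 1 by rewrite ltr_wpDl.
  pose d := e / 4 / (C + 1); have d0 : 0 < d by rewrite !divr_gt0.
  near=> n.
  have mn : (m.+1 <= n)%N by near: n; exact: large.
  have U : forall t x, 0 <= t <= T -> `|q n t x - qf t x| <= d.
    by near: n; exact: limit_path_uniform.
  have tailn : forall t x, 0 <= t <= T -> (L3 < x.2)%N -> q n t x <= q n 0 x.
    by near: n.
  have init : (l1norm (q n 0 \- q0)%R <= (e / 4)%:E)%E by near: n; exact: init_close.
  move=> t /DT tT; have /andP[t0 _] := tT.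
  apply: le_lt_trans (HC _ d (ltW d0) (fun x _ => U t x tT)) _.
  (* In the tail both states are nonnegative and below their initial values, so they differ by at
     most [q0 x] plus the initial gap. *)
  have tail : (l1tail L (q n t \- qf t)%R <= (e / 4 + e / 4)%:E)%E.
    apply: (@le_trans _ _ (l1tail L ((fun x => `|q n 0 x - q0 x|) \+ q0)%R)).
      apply: l1tail_le => x Lx.
      have Lx1 : (L1 < x.2)%N by apply: leq_ltn_trans Lx; exact: leq_maxl.
      have Lx3 : (L3 < x.2)%N by apply: leq_ltn_trans Lx; rewrite /L !leq_max leqnn !orbT.
      have := H1 t x tT Lx1; have := tailn t x tT Lx3.
      have := limit_path_ge0 x t0.
      have := occupancy_ge0 (leq_trans (ltn0Sn m) mn) (q_solution mn) x t0.
      have := ler_norm (q n 0 x - q0 x); have := normr_ge0 (q n 0 x - q0 x).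
      have := q0_ge0 x; set z := `|q n 0 x - q0 x| => h1 h2 h3 h4 h5 h6 h7.
      rewrite [X in _ <= X]ger0_norm; last exact: addr_ge0.
      by rewrite /= -/z; apply/ler_normlP; split; lra.
    apply: le_trans (l1tailD _ _ _) _; rewrite EFinD; apply: leeD.
      apply: le_trans (le_trans (l1tail_norm L _) init).
      by apply: l1tail_le => x _; rewrite normr_id.
    by apply: H2; rewrite /L !leq_max leqnn !orbT.
  apply: (@le_lt_trans _ _ ((C * d)%:E + (e / 4 + e / 4)%:E)%E); first by rewrite leeD2l.
  rewrite -EFinD lte_fin.
  have : (C + 1) * d = e / 4 by rewrite mulrC divfK// gt_eqF.
  lra.
- by apply: filterS large => n mn; have [] := q_solution mn.
Unshelve. all: by end_near. Qed.

End pathwise.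

(** * From a fixed outcome to almost every outcome *)

Lemma ae_forall_countable d (T : measurableType d) (R : realType)
    (mu : {measure set T -> \bar R}) (I : countType) (Q : I -> T -> Prop) :
  (forall i, {ae mu, forall w, Q i w}) -> {ae mu, forall w, forall i, Q i w}.
Proof.
move=> H; have : {ae mu, forall w, forall n : nat,
    if @choice.unpickle I n is Some i then Q i w else True}.
  apply: ae_foralln => n; case: (@choice.unpickle I n) => [i|]; first exact: H.
  exact: aeW.
by apply: filterS => w Hw i; have := Hw (choice.pickle i); rewrite choice.pickleK.
Qed.

Lemma probability_ae_set d (T : measurableType d) (R : realType)
    (P : probability T R) (Q : T -> Prop) : {ae P, forall w, Q w} ->
  exists Gamma, [/\ measurable Gamma, P Gamma = 1%E & forall w, Gamma w -> Q w].
Proof.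
move=> [B [mB PB QB]]; exists (~` B); split; first exact: measurableC.
  by rewrite probability_setC// PB sube0.
by move=> w nB; apply: contrapT => nQ; apply: nB; exact: QB.
Qed.

Theorem theorem5 (R : realType) (m : nat)
  (u : 'I_m.+1 -> R -> R)
  (u_concave : forall i, concave_on [set x : R | 0 <= x] (u i))
  (lambda mu : R) (lambda_gt0 : 0 < lambda) (mu_gt0 : 0 < mu)
  (A : nat -> 'I_m.+1 -> nat) (alpha : 'I_m.+1 -> R)
  (A_ge1 : forall n, (m.+1 <= n)%N -> forall i, (1 <= A n i)%N)
  (A_sum : forall n, (m.+1 <= n)%N -> (\sum_i A n i)%N = n)
  (alpha01 : forall i, 0 < alpha i < 1)
  (A_cvg : forall i, ((A n i)%:R / n%:R : R) @[n --> \oo] --> alpha i)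
  (d : measure_display) (Omega : measurableType d) (P : probability Omega R)
  (P_complete : measure_is_complete P)
  (N : Omega -> R -> nat) (Nd : idx m -> Omega -> R -> nat)
  (q : nat -> Omega -> R -> idx m -> R) (q0 : Omega -> idx m -> R)
  (N_poisson : unit_poisson_process P N)
  (Nd_poisson : forall x, Iplus x -> unit_poisson_process P (Nd x))
  (q_init_meas : forall n, (m.+1 <= n)%N ->
     forall x, measurable_fun setT (fun w => q n w 0 x))
  (q_init_Qn : forall n, (m.+1 <= n)%N -> forall w, Qn n (A n) (q n w 0))
  (q0_meas : forall x, measurable_fun setT (q0^~ x))
  (q0_Q : forall w, Qfluid alpha (q0 w))
  (indep : independent P sources (sigma_source N Nd q q0))
  (q_init_cvg : {ae P, forall w,
     l1norm (q n w 0 \- q0 w) @[n --> \oo] --> 0%E})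
  (q_solution : {ae P, forall w, forall n, (m.+1 <= n)%N ->
     occupancy_solution lambda mu u n (A n) (N w) (Nd^~ w) (q n w)}) :
  exists Gamma : set Omega,
    [/\ measurable Gamma, P Gamma = 1%E &
        forall w, Gamma w ->
          exists qf : R -> idx m -> R,
            [/\ fluid_trajectory lambda mu u alpha qf,
                qf 0 = q0 w,
                forall q', fluid_trajectory lambda mu u alpha q' ->
                  q' 0 = q0 w -> forall t : R, 0 <= t -> q' t = qf t &
                cvg_D (fun n => q n w) qf]].

Proof.
have [_ N_path _ _] := N_poisson.
(* There are countably many clocks, so one null set serves all positions. *)
have Nd_lln : {ae P, forall w, forall x, Iplus x -> forall T e : R, 0 < e ->
    \forall n \near \oo, forall s, 0 <= s <= T ->
      `|n%:R^-1 * (Nd x w (n%:R * s))%:R - s| <= e}.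
  apply: ae_forall_countable => x; have [Ix|nIx] := pselect (Iplus x); last by apply: aeW.
  by have := poisson_uniform_lln (Nd_poisson x Ix); apply: filterS => w H _.
apply: probability_ae_set.
near=> w.
have [w0 w_mono w_right] : [/\ N w 0 = 0%N,
    forall s t : R, 0 <= s -> s <= t -> (N w s <= N w t)%N &
    forall t : R, 0 <= t -> \forall s \near t^'+, N w s = N w t] by near: w.
have w_lln : forall T e : R, 0 < e ->
    \forall n \near \oo, forall s, 0 <= s <= T ->
      `|n%:R^-1 * (N w (n%:R * s))%:R - s| <= e.
  by near: w; exact: poisson_uniform_lln.
have w_Nd : forall x, Iplus x -> forall T e : R, 0 < e ->
    \forall n \near \oo, forall s, 0 <= s <= T ->
      `|n%:R^-1 * (Nd x w (n%:R * s))%:R - s| <= e by near: w.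
have w_init : l1norm (q n w 0 \- q0 w) @[n --> \oo] --> 0%E by near: w.
have w_sol : forall n, (m.+1 <= n)%N ->
    occupancy_solution lambda mu u n (A n) (N w) (Nd^~ w) (q n w) by near: w.
have w_right0 := w_right 0 (lexx 0).
exists (limit_path (fun n => q n w)); split.
- exact: (limit_path_fluid u_concave lambda_gt0 mu_gt0 A_ge1 A_sum alpha01 A_cvg
    w0 w_mono w_right0 w_lln w_Nd (q0_Q w) w_init w_sol).
- exact: (limit_path0 u_concave lambda_gt0 mu_gt0 A_ge1 A_sum alpha01 A_cvg
    w0 w_mono w_right0 w_lln w_Nd (q0_Q w) w_init w_sol).
- exact: (limit_path_unique u_concave lambda_gt0 mu_gt0 A_ge1 A_sum alpha01 A_cvg
    w0 w_mono w_right0 w_lln w_Nd (q0_Q w) w_init w_sol).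
- exact: (limit_path_cvg_D u_concave lambda_gt0 mu_gt0 A_ge1 A_sum alpha01 A_cvg
    w0 w_mono w_right0 w_lln w_Nd (q0_Q w) w_init w_sol).
Unshelve. all: by end_near. Qed.
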